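(* Let $s\in(0,1)$, $p\ge2$, and let $\mathbb{R}^n_+=\{x=(x',x_n)\in\mathbb{R}^n : x_n>0\}$. Let $f:\mathbb{R}\to\mathbb{R}$ be continuous and assume that, for some $\mu>0$ and some $0<t_0<t_1<\mu$: (a) $f(t)>0$ for $t\in(0,\mu)$, and $f(t)\le0$ for $t\ge\mu$; (b) $f(t)\ge\delta_0 t$ for $t\in[0,t_0]$, for some $\delta_0>0$; (c) $f$ is nonincreasing on $(t_1,\mu)$. Consider the problem $$(-\Delta)_p^s u(x)=f(u(x)),\ x\in\mathbb{R}^n_+;\qquad u(x)>0,\ x\in\mathbb{R}^n_+;\qquad u(x)=0,\ x\in\mathbb{R}^n\setminus\mathbb{R}^n_+. \qquad (P)$$ If $u\in C^{1,1}_{loc}(\mathbb{R}^n_+)\cap\mathcal{L}_{sp}$ is a bounded solution of $(P)$, then $u$ is strictly monotone increasing in $x_n$ in $\mathbb{R}^n_+$, and moreover $u$ depends on $x_n$ only. Furthermore, the bounded solution of $(P)$ is unique, i.e. any two bounded solutions of $(P)$ in $C^{1,1}_{loc}(\mathbb{R}^n_+)\cap\mathcal{L}_{sp}$ coincide.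
   Context: The fractional $p$-Laplacian is defined by $$(-\Delta)_p^s u(x)=C_{n,s,p}\lim_{\varepsilon\to0}\int_{\mathbb{R}^n\setminus B_\varepsilon(x)}\frac{|u(x)-u(y)|^{p-2}[u(x)-u(y)]}{|x-y|^{n+sp}}\,dy,$$ where $C_{n,s,p}>0$ is a constant depending only on $n,s,p$ and $B_\varepsilon(x)$ is the ball of radius $\varepsilon$ centred at $x$. The function class is $$\mathcal{L}_{sp}=\Big\{u\in L^{p-1}_{loc}(\mathbb{R}^n)\ :\ \int_{\mathbb{R}^n}\frac{|u(x)|^{p-1}}{1+|x|^{n+sp}}\,dx<\infty\Big\}.$$ Functions $u$ are defined on all of $\mathbb{R}^n$, and equations hold pointwise. *)

(* Defs.v *)
From HB Require Import structures.
From mathcomp Require Import all_boot all_order all_algebra.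
From mathcomp Require Import all_classical all_reals all_analysis.
Set Implicit Arguments.
Unset Strict Implicit.
Unset Printing Implicit Defensive.
Import Order.TTheory GRing.Theory Num.Theory.
Import numFieldNormedType.Exports.
Local Open Scope classical_set_scope.
Local Open Scope ring_scope.

Definition measure_rV_display : measure_display -> measure_display.
Proof. exact. Qed.

(* The sigma-algebra on 'rV[R]_n generated by the coordinates, i.e. the Borel
   sigma-algebra of R^n. *)
Section measurable_rV.
Context (R : realType) (n : nat).

Let coors : 'I_n -> 'rV[R]_n -> R := fun i x => x ord0 i.

Let rV_set0 : g_sigma_preimage coors set0.
Proof. exact: sigma_algebra0. Qed.

Let rV_setC A : g_sigma_preimage coors A -> g_sigma_preimage coors (~` A).
Proof. exact: sigma_algebraC. Qed.

Let rV_bigcup (F : _^nat) : (forall i, g_sigma_preimage coors (F i)) ->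
  g_sigma_preimage coors (\bigcup_i (F i)).
Proof. exact: sigma_algebra_bigcup. Qed.

HB.instance Definition _ :=
  @isMeasurable.Build (measure_rV_display default_measure_display)
    'rV[R]_n (g_sigma_preimage coors) rV_set0 rV_setC rV_bigcup.

End measurable_rV.

Lemma measurable_coord_rV (R : realType) n (i : 'I_n) :
  measurable_fun [set: 'rV[R]_n] (fun x => x ord0 i : R).
Proof.
move=> _ Y mY; rewrite setTI; apply: sub_sigma_algebra => /=.
rewrite -bigcup_seq/=; exists i => /=; first by rewrite mem_index_enum.
by exists Y => //; rewrite setTI.
Qed.

Lemma measurable_fun_rV (R : realType) d (T : measurableType d) n
    (f : T -> 'rV[R]_n) :
  (forall i, measurable_fun [set: T] (fun t => f t ord0 i : R)) ->
  measurable_fun [set: T] f.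
Proof.
move=> mf _ A mA; rewrite setTI.
suff : g_sigma_preimage (fun i (x : 'rV[R]_n) => x ord0 i : R) `<=`
    [set B | measurable (f @^-1` B)] by apply.
apply: smallest_sub.
  split => //=; first by rewrite preimage_set0.
  - by move=> B mB; rewrite setTD preimage_setC; exact: measurableC.
  - by move=> F mF; rewrite preimage_bigcup; exact: bigcup_measurable.
rewrite -bigcup_seq => B [i _ [Y mY <-]] /=.
by rewrite setTI; have := mf i measurableT Y mY; rewrite setTI.
Qed.

Section lebesgue_rV.
Context (R : realType).

Definition cons_rV n (p : measurableTypeR R * 'rV[R]_n) : 'rV[R]_n.+1 :=
  row_mx (p.1 : R)%:M p.2 : 'rV[R]_(1 + n).

Definition uncons_rV n (x : 'rV[R]_n.+1) : measurableTypeR R * 'rV[R]_n :=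
  (x ord0 ord0, rsubmx (x : 'rV[R]_(1 + n))).

Lemma cons_rVK n : cancel (@cons_rV n) (@uncons_rV n).
Proof.
move=> [a v]; rewrite /uncons_rV /cons_rV; congr pair; last by rewrite row_mxKr.
transitivity (row_mx (a : R)%:M v ord0 (lshift n (@ord0 0))).
  by congr (row_mx _ _ _ _); exact/val_inj.
by rewrite row_mxEl mxE eqxx mulr1n.
Qed.

Lemma measurable_cons_rV n : measurable_fun setT (@cons_rV n).
Proof.
apply: measurable_fun_rV => i; rewrite /cons_rV.
case: (split_ordP (i : 'I_(1 + n))) => j ->.
  under eq_fun do rewrite (@row_mxEl R 1 1 n) (ord1 j) mxE eqxx mulr1n.
  exact: measurable_fst.
under eq_fun do rewrite (@row_mxEr R 1 1 n).
apply: (measurableT_comp (measurable_coord_rV j)); exact: measurable_snd.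
Qed.

Lemma measurable_uncons_rV n : measurable_fun setT (@uncons_rV n).
Proof.
apply/measurable_fun_pairP; split => /=.
  exact: (@measurable_coord_rV R n.+1 ord0).
apply: measurable_fun_rV => i /=.
under eq_fun do rewrite mxE.
exact: (@measurable_coord_rV R n.+1).
Qed.

Section step.
Context (n : nat) (mu : {sigma_finite_measure set 'rV[R]_n -> \bar R}).

Definition lebesgue_rV_step : set 'rV[R]_n.+1 -> \bar R :=
  pushforward (lebesgue_measure \x mu)%E (@cons_rV n).

Let step0 : lebesgue_rV_step set0 = 0%E.
Proof. by rewrite /lebesgue_rV_step /pushforward preimage_set0 measure0. Qed.

Let step_ge0 A : (0 <= lebesgue_rV_step A)%E.
Proof. by apply: measure_ge0; exact: measurable_cons_rV. Qed.

Let step_sigma_additive : semi_sigma_additive lebesgue_rV_step.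
Proof.
by apply: measure_semi_sigma_additive; exact: measurable_cons_rV.
Qed.

HB.instance Definition _ := isMeasure.Build _ _ _ lebesgue_rV_step
  step0 step_ge0 step_sigma_additive.

Let step_sigma_finite : sigma_finite setT lebesgue_rV_step.
Proof.
have /sigma_finiteP[F [FT ndF Foo]] := sigma_finiteT (@lebesgue_measure R).
have /sigma_finiteP[G [GT ndG Goo]] := sigma_finiteT mu.
exists (fun k => @uncons_rV n @^-1` (F k `*` G k)).
  apply/seteqP; split => // x _.
  have [k _ Fk] : (\bigcup_k F k) (uncons_rV x).1 by rewrite -FT.
  have [l _ Gl] : (\bigcup_k G k) (uncons_rV x).2 by rewrite -GT.
  exists (maxn k l) => //; split.
    by move: Fk; exact/subsetPset/ndF/leq_maxl.
  by move: Gl; exact/subsetPset/ndG/leq_maxr.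
move=> k; have [mF Fk] := Foo k; have [mG Gk] := Goo k; split.
  rewrite -[X in measurable X]setTI.
  by apply: measurable_uncons_rV => //; exact: measurableX.
rewrite /lebesgue_rV_step /pushforward -comp_preimage.
rewrite (_ : _ \o _ = id) ?preimage_id; last exact/funext/cons_rVK.
by rewrite product_measure1E// lte_mul_pinfty// ge0_fin_numE.
Qed.

HB.instance Definition _ := Measure_isSigmaFinite.Build _ _ _ lebesgue_rV_step
  step_sigma_finite.

End step.

(* Lebesgue measure on R^n, as the n-fold product of [lebesgue_measure]. *)
Fixpoint lebesgue_rV n : {sigma_finite_measure set 'rV[R]_n -> \bar R} :=
  match n with
  | 0 => dirac (0 : 'rV[R]_0)
  | m.+1 => lebesgue_rV_step (lebesgue_rV m)
  end.

End lebesgue_rV.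
Arguments lebesgue_rV {R} n.

Lemma lebesgue_rV_box (R : realType) n (A : 'I_n -> set R) :
  (forall i, measurable (A i)) ->
  lebesgue_rV n [set x | forall i, A i (x ord0 i)] =
  (\prod_(i < n) lebesgue_measure (A i))%E.
Proof.
elim: n A => [|n IH] A mA.
  rewrite big_ord0 /= diracE mem_set //=; by case.
rewrite big_ord_recl -IH// /= /lebesgue_rV_step /pushforward.
have mB : measurable [set x : 'rV[R]_n | forall i, A (lift ord0 i) (x ord0 i)].
  rewrite (_ : [set x | _] = \bigcap_(i in [set: 'I_n]) ((fun x : 'rV[R]_n => x ord0 i) @^-1` A (lift ord0 i))).
    apply: fin_bigcap_measurable => // i _.
    by rewrite -[X in measurable X]setTI; apply: measurable_coord_rV.
  by apply/seteqP; split => x /= H i; [move=> _; exact: H | exact: (H i I)].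
have <- := @product_measure1E _ _ (measurableTypeR R) _ R lebesgue_measure (lebesgue_rV n) _ _ (mA ord0) mB.
congr (product_measure1 _ _ _); apply/seteqP; split => -[a v] /=.
  move=> H; split.
    have := H ord0; have -> : cons_rV (a,v) ord0 ord0 = (uncons_rV (cons_rV (a, v))).1 by [].
    by rewrite cons_rVK.
  move=> i; have := H (lift ord0 i).
  rewrite /cons_rV (_ : lift ord0 i = rshift 1 i) ?(@row_mxEr R 1 1 n)//; exact/val_inj.
move=> [H1 H2] i; rewrite /cons_rV.
case: (split_ordP (i : 'I_(1 + n))) => j ->.
  rewrite (@row_mxEl R 1 1 n) (ord1 j) mxE eqxx mulr1n.
  rewrite (_ : lshift n 0 = ord0)//; exact/val_inj.
rewrite (@row_mxEr R 1 1 n) (_ : rshift 1 j = lift ord0 j)//; exact/val_inj.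
Qed.

Section fractional_p_laplacian.
Context (R : realType) (n : nat).
Local Notation E := 'rV[R]_n.
Local Notation mu := (@lebesgue_rV R n).
Implicit Types (u : E -> R) (x : E).

(* The norm `|x| of the library on 'rV[R]_n is the sup norm. *)
Definition enorm x : R := Num.sqrt (\sum_(i < n) x ord0 i ^+ 2).

Definition eball x (e : R) : set E := [set y | enorm (x - y) < e].

Definition gradient u x : E := \row_(i < n) 'D_(delta_mx ord0 i) u x.

Definition C11_loc (A : set E) u :=
  forall x, A x -> differentiable u x /\
    exists2 U, nbhs x U & [lipschitz gradient u y | y in U].

(* [measurable_fun] is Borel measurability. *)
Definition lebesgue_measurable_fun u :=
  exists2 v : E -> R, measurable_fun setT v & {ae mu, forall x, u x = v x}.

Definition Lloc (q : R) u := lebesgue_measurable_fun u /\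
  forall K : set E, compact K -> (\int[mu]_(x in K) (`|u x| `^ q)%:E < +oo)%E.

Definition Lsp (s p : R) u := Lloc (p - 1) u /\
  (\int[mu]_x (`|u x| `^ (p - 1) / (1 + enorm x `^ (n%:R + s * p)))%:E < +oo)%E.

Definition fplap_trunc (s p : R) u x (e : R) : \bar R :=
  (\int[mu]_(y in ~` eball x e)
    (`|u x - u y| `^ (p - 2) * (u x - u y)
       / enorm (x - y) `^ (n%:R + s * p))%:E)%E.

(* The principal value; meaningful when the limit exists. *)
Definition fplap (C s p : R) u x : \bar R :=
  (C%:E * lim (fplap_trunc s p u x e @[e --> 0^'+]))%E.

End fractional_p_laplacian.

Definition halfspace (R : realType) (n : nat) : set 'rV[R]_n.+1 :=
  [set x | 0 < x ord0 ord_max].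

Definition solution (R : realType) (n : nat) (C s p : R) (f : R -> R)
    (u : 'rV[R]_n.+1 -> R) :=
  [/\ forall x, halfspace x ->
        cvg (fplap_trunc s p u x e @[e --> 0^'+]) /\
        fplap C s p u x = (f (u x))%:E,
      forall x, halfspace x -> 0 < u x &
      forall x, ~ halfspace x -> u x = 0].

Definition bounded_solution (R : realType) (n : nat) (C s p : R) (f : R -> R)
    (u : 'rV[R]_n.+1 -> R) :=
  [/\ C11_loc (@halfspace R n) u, Lsp s p u, bounded_fun u &
      solution C s p f u].

(* Main.v *)
Require Import Defs.
From mathcomp Require Import all_boot all_order all_algebra.
From mathcomp Require Import all_classical all_reals all_analysis measurable_realfun.
From mathcomp Require Import ring lra.

(** Everything follows from one comparison principle ([sliding]): if [u] and
    [v] are bounded solutions, then [u x <= v y] whenever [y] is strictly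
    higher than [x], whatever the horizontal positions.  Letting the height
    gap tend to 0, continuity of [v] gives [u x <= v y] as soon as [y] is at
    least as high as [x].  Exchanging [u] and [v] yields uniqueness, and taking
    [u = v] shows that [u] is a nondecreasing function of the height.  It is
    strictly increasing, because if [u] and its upward translate touched at an
    interior point, the two principal values there would coincide, whereas
    the strip where one function vanishes and the other is positive separates
    them strictly.

    The comparison principle is a sliding argument in which near-maxima and
    touching paraboloids replace compactness of translates. Write [tau0] for
    the least gap above which [u x <= v y] holds and suppose [tau0 > 0]. For
    gaps slightly smaller than [tau0] the difference [u x - v y] is positive
    somewhere; the variables are doubled, the gap is penalised smoothly, and a
    small hump localises a maximum. At the maximum [(x, y)] both [u] and [v]
    are touched by paraboloids with constants that do not depend on the
    smallness of the hump ([pv_paraboloid]); as [t |-> |t|^(p-2) t] is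
    monotone and odd, the part of the singular integrals near the origin has a
    controlled sign, even though [u] and [v] have no uniform smoothness. What
    remains is [doubling]: the difference [f (u x) - f (v y)] controls from
    above every integral over a cube on which the translates of [u] and [v]
    are better separated than at the maximum. Three cubes then give a
    contradiction:
    - if [v y > t1], then [f (u x) <= f (v y)] and a cube below the boundary,
      where [u] vanishes, is enough ([doubling_nonincreasing]);
    - otherwise [y] lies in a fixed strip, and a cube below the boundary where
      [u] vanishes and the translate of [v] is positive gives a lower bound for
      [f (u x) - f (v y)], hence for [u x - v y] ([doubling_strip]);
    - such a gap between [u] and [v] is impossible close to [tau0]
      ([doubling_jump]): the lower envelope of [v] is a bounded monotone
      function of the height, so at one of boundedly many scales it is nearly
      constant, and the cube at that scale makes the integral too large.
      This replaces equicontinuity of the translates of [v].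

    The preliminary facts have the same flavour.  Touching [u] from above by a
    hump at the scale of the distance to the boundary gives [u <= mu] and the
    decay of [u] at the boundary ([top_estimate]); touching from below
    by multiples of a hump in large balls gives positivity at each height and
    convergence to [mu] ([bubble_below]). *)

Set Implicit Arguments.
Unset Strict Implicit.
Unset Printing Implicit Defensive.
Import Order.TTheory GRing.Theory Num.Theory.
Import numFieldNormedType.Exports.
Local Open Scope classical_set_scope.
Local Open Scope ring_scope.

(** * Lebesgue measure on R^n: cubes, translations, reflection *)
Section lebesgue_rV_theory.
Context (R : realType).
Local Notation leb := (@lebesgue_measure R).

Definition box n (B : 'I_n -> set R) : set 'rV[R]_n :=
  [set x | forall i, B i (x ord0 i)].

Lemma measurable_box n (B : 'I_n -> set R) :
  (forall i, measurable (B i)) -> measurable (box B).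
Proof.
move=> mB; rewrite (_ : box B =
    \bigcap_(i in [set: 'I_n]) ((fun x : 'rV[R]_n => x ord0 i) @^-1` B i)).
  apply: fin_bigcap_measurable => // i _.
  by rewrite -[X in measurable X]setTI; apply: measurable_coord_rV.
by apply/seteqP; split => x /= H i; [move=> _; exact: H | exact: (H i I)].
Qed.

(** Boxes are stable under intersection, generate the Borel sets, and the
    bounded ones exhaust the space. *)
Lemma lebesgue_rV_unique n (m : {measure set 'rV[R]_n -> \bar R}) :
  (forall B, (forall i, measurable (B i)) -> m (box B) = lebesgue_rV n (box B)) ->
  forall A, measurable A -> m A = lebesgue_rV n A.
Proof.
move=> mE A mA.
pose G := [set box B | B in [set B : 'I_n -> set R | forall i, measurable (B i)]].
pose g k : set 'rV[R]_n := box (fun=> `]- k%:R, k%:R[%classic : set R).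
apply: (@g_sigma_algebra_measure_unique _ _ _ G _ g) => //.
- by move=> _ [B mB <-]; exact: measurable_box.
- by move=> k; exists (fun=> `]- k%:R, k%:R[%classic) => //= i; exact: measurable_itv.
- apply/seteqP; split => // x _.
  have [k xk] : exists k : nat, forall i, `|x ord0 i| < k%:R.
    exists (Num.trunc (\sum_i `|x ord0 i|)).+1 => i.
    apply: le_lt_trans (truncnS_gt _).
    by rewrite (bigD1 i)//= lerDl sumr_ge0.
  by exists k => // i /=; rewrite in_itv/= -ltr_norml.
- move=> _ _ [B mB <-] [B' mB' <-]; exists (fun i => B i `&` B' i).
    by move=> i; exact: measurableI.
  apply/seteqP; split => x /=; first by move=> H; split=> i; have [] := H i.
  by move=> [H H'] i; split.
- by move=> _ [B mB <-]; exact: mE.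
- move=> k; rewrite mE; last by move=> i; exact: measurable_itv.
  rewrite lebesgue_rV_box; last by move=> i; exact: measurable_itv.
  rewrite -ge0_fin_numE; last by apply: prode_ge0.
  apply: prode_fin_num => i _.
  by rewrite lebesgue_measure_itv/=; case: ifP.
- move: A mA; apply: smallest_sub; first exact: smallest_sigma_algebra.
  rewrite -bigcup_seq => B [i _ [Y mY <-]] /=; rewrite setTI.
  apply: sub_sigma_algebra; exists (fun j => if j == i then Y else setT).
    by move=> j /=; case: ifP.
  apply/seteqP; split => x /=; first by move/(_ i); rewrite eqxx.
  by move=> Yx j; case: eqP => // ->.
Qed.

Lemma lebesgue_measure_shift (a : R) (A : set R) : measurable A ->
  leb ((fun x => a + x) @^-1` A) = leb A.
Proof.
move=> mA.
have ms : measurable_fun setT (fun x : measurableTypeR R => a + x : measurableTypeR R).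
  exact: measurable_funD.
apply/esym.
apply: (@lebesgue_measure_unique R (pushforward leb
  (fun x : measurableTypeR R => a + x : measurableTypeR R))) => //.
move=> _ [[b c] _ <-].
rewrite /pushforward/=.
transitivity (leb `](b - a), (c - a)]%classic); last first.
  congr (leb _); apply/seteqP; split => x /=; rewrite !in_itv/=; lra.
rewrite !lebesgue_measure_itv/= !lte_fin.
have -> : (b - a < c - a) = (b < c) by lra.
by case: ifP => // _; rewrite -!EFinB; congr EFin; lra.
Qed.

Definition cube n (c : 'rV[R]_n) (w : R) : set 'rV[R]_n :=
  box (fun i => `[c ord0 i - w, c ord0 i + w]%classic).

Lemma measurable_cube n (c : 'rV[R]_n) w : measurable (cube c w).
Proof. by apply: measurable_box => i; exact: measurable_itv. Qed.

Lemma cubeP n (c x : 'rV[R]_n) w :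
  cube c w x <-> forall i, `|x ord0 i - c ord0 i| <= w.
Proof.
by split=> H i; move: (H i); rewrite /= in_itv/= ler_norml; lra.
Qed.

Lemma lebesgue_cube n (c : 'rV[R]_n) w : 0 <= w ->
  lebesgue_rV n (cube c w) = ((2 * w) ^+ n)%:E.
Proof.
move=> w0; rewrite lebesgue_rV_box; last by move=> i; exact: measurable_itv.
rewrite (eq_bigr (fun=> (2 * w)%:E)) => [|i _].
  by rewrite prodEFin prodr_const card_ord.
rewrite lebesgue_measure_itv/= lte_fin.
case: ifPn => [_|]; first by rewrite -EFinB; congr EFin; lra.
by rewrite -leNgt => h; congr EFin; lra.
Qed.

(** By uniqueness on boxes, invariance under a map acting coordinatewise
    reduces to dimension one. *)
Lemma lebesgue_rV_preimage n (T : 'rV[R]_n -> 'rV[R]_n) (t : 'I_n -> R -> R) :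
  (forall x i, T x ord0 i = t i (x ord0 i)) ->
  (forall i, measurable_fun setT (t i)) ->
  (forall i B, measurable B -> leb (t i @^-1` B) = leb B) ->
  measurable_fun setT T /\
  forall A, measurable A -> lebesgue_rV n (T @^-1` A) = lebesgue_rV n A.
Proof.
move=> Tt mt tE.
have mT : measurable_fun setT T.
  apply: measurable_fun_rV => i; under eq_fun do rewrite Tt.
  exact: measurableT_comp (mt i) (measurable_coord_rV i).
split=> // A mA.
apply: (@lebesgue_rV_unique n (pushforward (lebesgue_rV n) T)) => // B mB.
transitivity (lebesgue_rV n (box (fun i => t i @^-1` B i))).
  congr (lebesgue_rV n _).
  by apply/seteqP; split=> x H i; move: (H i); rewrite /= Tt.
have mtB j : measurable (t j @^-1` B j).
  by rewrite -[X in measurable X]setTI; apply: mt.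
rewrite [LHS]lebesgue_rV_box// [RHS]lebesgue_rV_box//.
by apply: eq_bigr => i _; exact: tE.
Qed.

Lemma lebesgue_rV_shift n (x : 'rV[R]_n) :
  measurable_fun setT (fun z => x + z) /\
  forall A : set 'rV[R]_n, measurable A ->
    lebesgue_rV n ((fun z => x + z) @^-1` A) = lebesgue_rV n A.
Proof.
apply: (@lebesgue_rV_preimage _ _ (fun i a => x ord0 i + a)).
- by move=> z i; rewrite mxE.
- by move=> i; exact: measurable_funD.
- by move=> i B mB; exact: lebesgue_measure_shift.
Qed.

Lemma lebesgue_rV_opp n :
  measurable_fun setT (fun z : 'rV[R]_n => - z) /\
  forall A : set 'rV[R]_n, measurable A ->
    lebesgue_rV n ((fun z => - z) @^-1` A) = lebesgue_rV n A.
Proof.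
apply: (@lebesgue_rV_preimage _ _ (fun i a => - a)).
- by move=> z i; rewrite mxE.
- by move=> i; exact: oppr_measurable.
- by move=> i B mB; exact: lebesgue_measureN.
Qed.

End lebesgue_rV_theory.

(** * Euclidean norm and measurability of continuous functions *)
Section enorm_theory.
Context (R : realType) (n : nat).
Local Notation E := 'rV[R]_n.
Implicit Types (x y z : E).

Definition sqn x : R := \sum_(i < n) x ord0 i ^+ 2.

Lemma sqn_ge0 x : 0 <= sqn x.
Proof. by apply: sumr_ge0 => i _; exact: sqr_ge0. Qed.

Lemma enorm_ge0 x : 0 <= enorm x.
Proof. exact: sqrtr_ge0. Qed.

Lemma enorm_sqr x : enorm x ^+ 2 = sqn x.
Proof. by rewrite sqr_sqrtr// sqn_ge0. Qed.

Lemma sqn_le x (a : R) : 0 <= a -> (enorm x <= a) = (sqn x <= a ^+ 2).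
Proof. by move=> a0; rewrite -enorm_sqr ler_pXn2r// nnegrE ?enorm_ge0. Qed.

Lemma sqn_lt x (a : R) : 0 <= a -> (enorm x < a) = (sqn x < a ^+ 2).
Proof. by move=> a0; rewrite -enorm_sqr ltr_pXn2r// nnegrE ?enorm_ge0. Qed.

Lemma sqnN x : sqn (- x) = sqn x.
Proof. by apply: eq_bigr => i _; rewrite mxE sqrrN. Qed.

Lemma enormN x : enorm (- x) = enorm x.
Proof. by congr Num.sqrt; exact: sqnN. Qed.

Lemma sqn0 : sqn 0 = 0.
Proof. by rewrite /sqn big1// => i _; rewrite mxE expr0n. Qed.

Lemma coord_le_enorm x i : `|x ord0 i| <= enorm x.
Proof.
rewrite -(@ler_pXn2r _ 2) ?nnegrE ?enorm_ge0// enorm_sqr real_normK ?num_real//.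
by rewrite /sqn (bigD1 i)//= lerDl sumr_ge0// => j _; exact: sqr_ge0.
Qed.

Lemma sqn_coord_le x (a : R) : (forall i, `|x ord0 i| <= a) ->
  sqn x <= n%:R * a ^+ 2.
Proof.
move=> xa; have -> : n%:R * a ^+ 2 = \sum_(i < n) a ^+ 2.
  by rewrite sumr_const card_ord mulr_natl.
apply: ler_sum => i _; rewrite -real_normK ?num_real//.
by rewrite ler_pXn2r ?nnegrE// (le_trans _ (xa i)).
Qed.

Lemma enorm_coord_le x (a : R) : 0 <= a -> (forall i, `|x ord0 i| <= a) ->
  enorm x <= n%:R * a.
Proof.
move=> a0 xa; rewrite sqn_le ?mulr_ge0//.
apply: le_trans (sqn_coord_le xa) _.
rewrite exprMn ler_wpM2r ?sqr_ge0// -natrX ler_nat.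
by case: n => // m; rewrite expnS expn1 leq_pmull.
Qed.

Lemma sqnD_le x y : sqn (x + y) <= 2 * sqn x + 2 * sqn y.
Proof.
rewrite /sqn !mulr_sumr -big_split; apply: ler_sum => i _ /=; rewrite mxE.
have := sqr_ge0 (x ord0 i - y ord0 i); nra.
Qed.

Definition dotp x y : R := \sum_(i < n) x ord0 i * y ord0 i.

Lemma sqnDE x y : sqn (x + y) = sqn x + 2 * dotp x y + sqn y.
Proof.
rewrite /sqn /dotp mulr_sumr -!big_split; apply: eq_bigr => i _ /=; rewrite mxE.
by ring.
Qed.

Lemma dotpN x z : dotp x (- z) = - dotp x z.
Proof. by rewrite /dotp -sumrN; apply: eq_bigr => i _; rewrite mxE mulrN. Qed.

(** The constant [n%:R] is cruder than Cauchy-Schwarz, and constants do not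
    matter below. *)
Lemma dotp_le x y : `|dotp x y| <= n%:R * (enorm x * enorm y).
Proof.
have -> : n%:R * (enorm x * enorm y) = \sum_(i < n) enorm x * enorm y.
  by rewrite sumr_const card_ord mulr_natl.
apply: le_trans (ler_norm_sum _ _ _) _; apply: ler_sum => i _.
by rewrite normrM ler_pM// coord_le_enorm.
Qed.

Lemma measurable_dotp x : measurable_fun setT (dotp x).
Proof.
apply: measurable_sum => i; apply: measurable_funM => //.
exact: measurable_coord_rV.
Qed.

Lemma measurable_sqn : measurable_fun setT sqn.
Proof.
apply: measurable_sum => i; apply: measurable_funX.
exact: measurable_coord_rV.
Qed.

Lemma measurable_enorm : measurable_fun setT (@enorm R n).
Proof.
rewrite /enorm; apply: (measurableT_comp _ measurable_sqn).
by apply: continuous_measurable_fun; exact: sqrt_continuous.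
Qed.

Lemma continuous_coord (i : 'I_n) : continuous (fun x : E => x ord0 i).
Proof. exact: coord_continuous. Qed.

Lemma continuous_sqn : continuous sqn.
Proof.
move=> x; rewrite /sqn; elim: (index_enum _) => [|i r IH].
  by under eq_fun do rewrite big_nil; exact: cst_continuous.
rewrite /continuous_at big_cons; under eq_fun do rewrite big_cons.
have ci := @continuous_coord i x.
exact: (cvgD (cvgM ci ci) IH).
Qed.

(** An open set is the union of the cubes with rational centre and half-width
    [1/k] that it contains. *)
Lemma measurable_open_rV (A : set E) : open A -> measurable A.
Proof.
move=> oA.
pose F m : set E := if (unpickle m : option ('rV[rat]_n * nat)%type) is Some ck then
  let D := cube (map_mx ratr ck.1) (ck.2.+1%:R^-1 : R) in
  if pselect (D `<=` A) then D else set0 else set0.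
suff -> : A = \bigcup_m F m.
  apply: bigcup_measurable => m _; rewrite /F.
  case: unpickle => // ck; case: pselect => //= ?; exact: measurable_cube.
apply/seteqP; split => [x Ax|x [m _]]; last first.
  by rewrite /F; case: unpickle => // ck; case: pselect => //= DA /DA.
have /nbhs_ballP[e /= e0 xe] : nbhs x A by exact: open_nbhs_nbhs.
have [k [d [d0 de dk]]] : exists k d, [/\ 0 < d, d < e / 2 & d = k.+1%:R^-1 :> R].
  exists (Num.trunc (e / 2)^-1); eexists; split; last by [].
    by rewrite invr_gt0.
  by rewrite invf_plt ?posrE ?divr_gt0//; exact: truncnS_gt.
have H i : exists q : rat, `|x ord0 i - ratr q| < d.
  have [|q] := @rat_in_itvoo _ (x ord0 i - d) (x ord0 i + d); first by lra.
  by rewrite in_itv/= => /andP[? ?]; exists q; rewrite ltr_norml; apply/andP; lra.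
pose c : 'rV[rat]_n := \row_i sval (cid (H i)).
exists (pickle (c, k)) => //; rewrite /F pickleK/= -dk.
have xc i : `|x ord0 i - (map_mx ratr c : E) ord0 i| < d.
  by rewrite !mxE; case: cid.
case: pselect => [?/=|[]]; first by apply/cubeP => i; exact/ltW/xc.
move=> y /cubeP yc; apply: xe; split=> // i j; rewrite (ord1 i) /ball/=.
have Hy := yc j; have Hx := xc j.
rewrite ltr_norml in Hx; rewrite ler_norml in Hy; rewrite ltr_norml.
case/andP: Hx Hy => Hx1 Hx2 /andP[Hy1 Hy2].
by apply/andP; split; lra.
Qed.

Lemma measurable_fun_continuous_on (A : set E) (u : E -> R) : open A ->
  (forall x, A x -> {for x, continuous u}) -> (forall x, ~ A x -> u x = 0) ->
  measurable_fun setT u.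
Proof.
move=> oA cu u0.
have mA := measurable_open_rV oA.
rewrite -(setUCr A); apply/measurable_funU => //; first exact: measurableC.
split; last first.
  apply: (@eq_measurable_fun _ _ E R _ (fun=> 0 : R)); last exact: measurable_cst.
  by move=> x; rewrite inE => /u0 ->.
move=> _; apply: (measurability _ (RGenOInfty.measurableE R)) => //.
move=> /= _ [_ [a ->] <-]; rewrite preimage_itvoy.
apply: measurable_open_rV; rewrite openE => x [Ax /= ax].
have /cu ux := Ax.
have : \forall y \near x, a < u y by exact: (cvgr_gt _ ux).
have : \forall y \near x, A y by exact: open_nbhs_nbhs.
by rewrite /interior; apply: filterS2.
Qed.
End enorm_theory.

(** * Real powers *)
Section powR_extra.
Context (R : realType).
Implicit Types (r x y : R).

Lemma ler_powRl r x y : 0 <= r -> 0 <= x -> x <= y -> x `^ r <= y `^ r.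
Proof.
move=> r0 x0 xy; apply: ge0_ler_powR => //; rewrite nnegrE//.
exact: le_trans xy.
Qed.

Lemma ltr_powRl r x y : 0 < r -> 0 <= x -> x < y -> x `^ r < y `^ r.
Proof.
move=> r0 x0 xy; apply: gt0_ltr_powR => //; rewrite nnegrE//.
exact: le_trans (ltW xy).
Qed.

Lemma powR_lt1 r x : 0 < r -> 0 <= x -> x < 1 -> x `^ r < 1.
Proof. by move=> r0 x0 /(ltr_powRl r0 x0); rewrite powR1. Qed.

Lemma powR_gt1 r x : 0 < r -> 1 < x -> 1 < x `^ r.
Proof. by move=> r0 /(ltr_powRl r0 ler01); rewrite powR1. Qed.

Lemma powRX r x k : 0 <= x -> (x ^+ k) `^ r = (x `^ r) ^+ k.
Proof.
by move=> x0; rewrite -powR_mulrn// -powRrM mulrC powRrM powR_mulrn ?powR_ge0.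
Qed.

End powR_extra.

(** * Integrals of the kernel |z|^-(n+al) *)
Section kernel.
Context (R : realType) (n : nat) (al : R) (al0 : 0 < al).
Local Notation E := 'rV[R]_n.
Local Notation mu := (@lebesgue_rV R n).

(** The singular kernel of the fractional operator, with [al] for [s * p]. *)
Definition ker (z : E) : R := (enorm z `^ (n%:R + al))^-1.

Lemma ker_ge0 z : 0 <= ker z.
Proof. by rewrite invr_ge0 powR_ge0. Qed.

Lemma kerN z : ker (- z) = ker z.
Proof. by rewrite /ker enormN. Qed.

Lemma measurable_ker : measurable_fun setT ker.
Proof.
rewrite (_ : ker = (fun a => a `^ (- (n%:R + al))) \o @enorm R n); last first.
  by apply/funext => z; rewrite /ker /= powRN.
exact: measurableT_comp (measurable_powR _) (@measurable_enorm R n).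
Qed.

Lemma ker_le z (t : R) : 0 < t -> t <= enorm z -> ker z <= t `^ (- (n%:R + al)).
Proof.
move=> t0 tz; have z0 : 0 < enorm z := lt_le_trans t0 tz.
rewrite powRN lef_pV2 ?posrE ?powR_gt0//.
by apply: ge0_ler_powR; rewrite ?nnegrE ?enorm_ge0 ?(ltW t0)// addr_ge0// ltW.
Qed.

Lemma ker_ge z (t : R) : 0 < enorm z -> enorm z <= t ->
  t `^ (- (n%:R + al)) <= ker z.
Proof.
move=> z0 zt; have t0 : 0 < t := lt_le_trans z0 zt.
rewrite powRN lef_pV2 ?posrE ?powR_gt0//.
by apply: ge0_ler_powR; rewrite ?nnegrE ?enorm_ge0 ?(ltW t0)// addr_ge0// ltW.
Qed.

Lemma nneseries_geometric (a q : R) : 0 <= a -> 0 <= q -> q < 1 ->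
  (\sum_(j <oo) (a * q ^+ j)%:E = (a / (1 - q))%:E)%E.
Proof.
move=> a0 q0 q1; apply/cvg_lim => //.
have -> : (fun k => \sum_(0 <= j < k) (a * q ^+ j)%:E)%E =
    EFin \o series (geometric a q).
  by apply/funext => k /=; rewrite sumEFin.
apply: cvg_EFin; first exact: nearW.
by apply: cvg_geometric_series; rewrite ger0_norm.
Qed.

(** The function is dominated by a series of multiples of indicators of cubes,
    each of which contributes a term of a geometric series. *)
Lemma integral_shells (D : set E) (g : E -> R) (t : nat -> R) (a q : R) :
  measurable D -> measurable_fun setT g -> (forall z, 0 <= g z) ->
  (forall j, 0 < t j) -> 0 <= a -> 0 <= q -> q < 1 ->
  (forall z, D z -> exists j, enorm z <= 2 * t j /\
     g z * (4 * t j) ^+ n <= a * q ^+ j) ->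
  (\int[mu]_(z in D) (g z)%:E <= (a / (1 - q))%:E)%E.
Proof.
move=> mD mg g0 t0 a0 q0 q1 H.
pose c j := a * q ^+ j / (4 * t j) ^+ n.
have T0 j : 0 < (4 * t j) ^+ n by rewrite exprn_gt0// mulr_gt0.
have c0 j : 0 <= c j by rewrite divr_ge0 ?(ltW (T0 j))// mulr_ge0 ?exprn_ge0.
pose C j : set E := cube 0 (2 * t j).
have mC j : measurable (C j) by exact: measurable_cube.
pose h j z := (c j * \1_(C j) z)%:E.
have h0 j z : (0 <= h j z)%E by rewrite lee_fin mulr_ge0.
have mh j : measurable_fun D (h j).
  apply/measurable_EFinP/measurable_funTS/measurable_funM.
    exact: measurable_cst.
  exact: measurable_indic.
apply: (@le_trans _ _ (\int[mu]_(z in D) (\sum_(j <oo) h j z))%E).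
  apply: ge0_le_integral => //.
  - by move=> z _; rewrite lee_fin.
  - exact/measurable_EFinP/measurable_funTS.
  - by apply: ge0_emeasurable_sum => // j z _ _.
  - move=> z /H[j [zt gz]].
    apply: le_trans (nneseries_lim_ge j.+1 _) => //.
    rewrite big_nat_recr//= -[X in (X <= _)%E]add0e leeD//.
      by apply: sume_ge0 => i _.
    rewrite /h indicE mem_set ?mulr1; last first.
      apply/cubeP => i; rewrite mxE subr0.
      exact: le_trans (coord_le_enorm _ _) zt.
    by rewrite lee_fin /c ler_pdivlMr.
rewrite integral_nneseries// -nneseries_geometric//.
apply: lee_nneseries => [j _ _|j _]; first by apply: integral_ge0.
rewrite /h (integralZl_indic mD (fun=> C j))//; last first.
  by move=> cj; have := c0 j; rewrite leNgt cj.
have muC : (mu (C j) <= ((4 * t j) ^+ n)%:E)%E.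
  rewrite /C lebesgue_cube ?mulr_ge0 ?(ltW (t0 j))//.
  by rewrite lee_fin (_ : 2 * (2 * t j) = 4 * t j)//; ring.
rewrite integral_indic//.
rewrite (_ : a * q ^+ j = c j * (4 * t j) ^+ n); last by rewrite /c divfK ?gt_eqF.
rewrite [X in (_ <= X)%E]EFinM; apply: lee_wpmul2l; first by rewrite lee_fin.
by apply: le_trans muC; apply: le_measure; rewrite ?inE//; exact: measurableI.
Qed.

Lemma ex_pow2_ge (y : R) : exists j : nat, y <= 2 ^+ j.
Proof.
exists (Num.trunc y).+1; apply: (le_trans (ltW (truncnS_gt _))).
by rewrite -natrX ler_nat ltnW// ltn_expl.
Qed.

Lemma kernel_tail : exists2 k : R, 0 < k & forall rho, 0 < rho ->
  (\int[mu]_(z in [set z | (rho <= enorm z)%R]) (ker z)%:E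
    <= (k * rho `^ (- al))%:E)%E.
Proof.
have q1 : 2 `^ (- al) < 1 :> R.
  rewrite powRN invf_lt1 ?powR_gt0//.
  by apply: powR_gt1 => //; lra.
exists (4 ^+ n / (1 - 2 `^ (- al))).
  by rewrite divr_gt0 ?exprn_gt0// subr_gt0.
move=> rho rho0.
rewrite (_ : _ * _ = 4 ^+ n * rho `^ (- al) / (1 - 2 `^ (- al))); last first.
  by rewrite mulrAC.
apply: (@integral_shells _ _ (fun j => rho * 2 ^+ j)) => //.
- rewrite -[X in measurable X]setTI.
  rewrite (_ : [set z | _] = @enorm R n @^-1` `[rho, +oo[%classic); last first.
    by apply/seteqP; split => z /=; rewrite in_itv/= andbT.
  by apply: measurable_enorm => //; exact: measurable_itv.
- exact: measurable_ker.
- exact: ker_ge0.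
- by move=> j; rewrite mulr_gt0// exprn_gt0.
- by rewrite mulr_ge0 ?powR_ge0.
move=> z /= rz.
have [j0 hj0] := ex_pow2_ge (enorm z / rho).
have ex : exists j, enorm z <= rho * 2 ^+ j.+1.
  exists j0; rewrite mulrC -ler_pdivrMr//; apply: le_trans hj0 _.
  by rewrite exprS ler_peMl ?exprn_ge0// ler1n.
(* The least such [j] is the index of the dyadic shell of [z]. *)
case: (ex_minnP ex) => j zj jmin.
have jz : rho * 2 ^+ j <= enorm z.
  case: j zj jmin => [|j] zj jmin; first by rewrite expr0 mulr1.
  by rewrite leNgt; apply/negP => /ltW/jmin; rewrite ltnn.
exists j; split; first by rewrite mulrCA -exprS.
have T0 : 0 < rho * 2 ^+ j by rewrite mulr_gt0 ?exprn_gt0.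
apply: (@le_trans _ _ ((rho * 2 ^+ j) `^ (- (n%:R + al)) * (4 * (rho * 2 ^+ j)) ^+ n)).
  by rewrite ler_wpM2r ?ker_le// exprn_ge0// mulr_ge0// ltW.
rewrite exprMn mulrCA -mulrA ler_wpM2l ?exprn_ge0//.
rewrite -[X in _ * X]powR_mulrn ?(ltW T0)// -powRD ?(gt_eqF T0) ?implybT//.
rewrite (_ : - (n%:R + al) + n%:R = - al); last by ring.
by rewrite powRM ?(ltW rho0) ?exprn_ge0// powRX.
Qed.

Lemma kernel_near (p : R) : al < p -> exists2 k : R, 0 < k & forall rho, 0 < rho ->
  (\int[mu]_(z in [set z | (enorm z < rho)%R]) (enorm z `^ p * ker z)%:E
    <= (k * rho `^ (p - al))%:E)%E.
Proof.
move=> alp.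
have q1 : 2^-1 `^ (p - al) < 1 :> R.
  by apply: powR_lt1; lra.
have p0 : 0 < p by exact: lt_trans alp.
exists (4 ^+ n * 2 `^ p * 2^-1 `^ (p - al) / (1 - 2^-1 `^ (p - al))).
  by rewrite divr_gt0 ?subr_gt0// !mulr_gt0 ?powR_gt0 ?exprn_gt0 ?invr_gt0.
move=> rho rho0.
rewrite (_ : _ * _ `^ (p - al) = 4 ^+ n * 2 `^ p * (rho / 2) `^ (p - al) /
   (1 - 2^-1 `^ (p - al))); last first.
  by rewrite powRM ?invr_ge0 ?ltW// mulrAC -!mulrA; congr (_ * (_ * _)); rewrite mulrCA mulrA.
apply: (@integral_shells _ _ (fun j => rho / 2 * 2^-1 ^+ j)) => //.
- rewrite -[X in measurable X]setTI.
  rewrite (_ : [set z | _] = @enorm R n @^-1` `]-oo, rho[%classic); last first.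
    by apply/seteqP; split => z /=; rewrite in_itv/=.
  by apply: measurable_enorm => //; exact: measurable_itv.
- apply: measurable_funM measurable_ker.
  exact: measurableT_comp (measurable_powR _) (@measurable_enorm R n).
- by move=> z; rewrite mulr_ge0 ?powR_ge0 ?ker_ge0.
- by move=> j; rewrite !mulr_gt0// exprn_gt0.
- by rewrite !mulr_ge0 ?powR_ge0.
move=> z /= rz.
have [z0|z0] := eqVneq (enorm z) 0.
  exists 0%N; rewrite z0 powR0 ?gt_eqF// !mul0r expr0 !mulr1; split.
    by rewrite mulr_ge0// divr_ge0// ltW.
  by rewrite !mulr_ge0 ?powR_ge0 ?exprn_ge0.
have {}z0 : 0 < enorm z by rewrite lt_neqAle eq_sym z0 enorm_ge0.
have [j0 hj0] := ex_pow2_ge (rho / enorm z).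
have ex : exists j, rho / 2 * 2^-1 ^+ j <= enorm z.
  exists j0; rewrite exprVn ler_pdivrMr ?exprn_gt0//.
  move: hj0; rewrite ler_pdivrMr// mulrC => hj0.
  by apply: le_trans hj0; lra.
case: (ex_minnP ex) => j zj jmin.
have jz : enorm z <= 2 * (rho / 2 * 2^-1 ^+ j).
  case: j zj jmin => [|j] zj jmin; first by rewrite expr0 mulr1; lra.
  rewrite leNgt; apply/negP => h.
  suff /jmin : rho / 2 * 2^-1 ^+ j <= enorm z by rewrite ltnn.
  by move: h; rewrite exprS => /ltW; apply: le_trans; rewrite le_eqVlt; apply/orP; left; apply/eqP; field.
exists j; split=> //.
set T := rho / 2 * _ in zj jz *.
have T0 : 0 < T by rewrite !mulr_gt0 ?exprn_gt0 ?invr_gt0.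
apply: (@le_trans _ _ ((2 * T) `^ p * T `^ (- (n%:R + al)) * (4 * T) ^+ n)).
  apply: ler_wpM2r; first by rewrite exprn_ge0// mulr_ge0// ltW.
  apply: ler_pM; rewrite ?powR_ge0 ?ker_ge0 ?ker_le//.
  by apply: ler_powRl; rewrite ?(ltW p0) ?enorm_ge0.
rewrite exprMn powRM ?(ltW T0)//.
rewrite (_ : _ * _ = 4 ^+ n * 2 `^ p * (T `^ p * T `^ (- (n%:R + al)) * T ^+ n)); last by ring.
rewrite -[leRHS]mulrA ler_wpM2l ?mulr_ge0 ?powR_ge0 ?exprn_ge0//.
rewrite -[X in _ * X]powR_mulrn ?(ltW T0)// -!powRD ?(gt_eqF T0) ?implybT//.
rewrite (_ : p + - (n%:R + al) + n%:R = p - al); last by ring.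
rewrite /T powRM ?mulr_ge0 ?exprn_ge0 ?invr_ge0 ?(ltW rho0)//.
by rewrite powRX ?invr_ge0// ltW.
Qed.

End kernel.

(** * The odd power |t|^(p-2) t *)
Section signed_power.
Context (R : realType) (p : R) (p2 : 2 <= p).
Implicit Types (a b t g m : R).

Definition spow t : R := `|t| `^ (p - 2) * t.

Let q0 : 0 < p - 1. Proof. by move: p2 => ?; lra. Qed.
Let r0 : 0 <= p - 2. Proof. by move: p2 => ?; lra. Qed.

Lemma spowN t : spow (- t) = - spow t.
Proof. by rewrite /spow normrN mulrN. Qed.

Lemma spow0 : spow 0 = 0.
Proof. by rewrite /spow mulr0. Qed.

Lemma spow_ge0E t : 0 <= t -> spow t = t `^ (p - 1).
Proof.
move=> t0; rewrite /spow ger0_norm// mulrC.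
by rewrite -(mulr_powRB1 t0 q0) (_ : p - 1 - 1 = p - 2)//; ring.
Qed.

Lemma spow_ge0 t : 0 <= t -> 0 <= spow t.
Proof. by move=> t0; rewrite spow_ge0E// powR_ge0. Qed.

Lemma spow_le0 t : t <= 0 -> spow t <= 0.
Proof. by move=> t0; rewrite -oppr_ge0 -spowN spow_ge0// oppr_ge0. Qed.

Let spow_mono_ge0 a b : 0 <= b -> b <= a -> spow b <= spow a.
Proof.
move=> b0 ba; rewrite !spow_ge0E//; last exact: le_trans ba.
by apply: ler_powRl => //; exact: ltW.
Qed.

Lemma spow_mono a b : b <= a -> spow b <= spow a.
Proof.
move=> ba; have [b0|b0] := lerP 0 b; first exact: spow_mono_ge0.
have [a0|a0] := lerP 0 a.
  by apply: (@le_trans _ _ 0); [exact/spow_le0/ltW|exact: spow_ge0].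
by rewrite -lerN2 -!spowN spow_mono_ge0 ?lerN2// oppr_ge0 ltW.
Qed.

Let spow_gap_ge0 a b g : 0 <= g -> 0 <= b -> b + g <= a ->
  g `^ (p - 1) <= spow a - spow b.
Proof.
have [q1 r1] := (q0, r0).
move=> g0 b0 bga.
apply: (@le_trans _ _ (spow (b + g) - spow b)); last first.
  by rewrite lerD2r; exact: spow_mono.
rewrite /spow !ger0_norm ?addr_ge0//.
have bb : b `^ (p - 2) <= (b + g) `^ (p - 2) by apply: ler_powRl => //; lra.
have gg : g `^ (p - 2) <= (b + g) `^ (p - 2) by apply: ler_powRl => //; lra.
have -> : g `^ (p - 1) = g `^ (p - 2) * g.
  by rewrite -spow_ge0E// /spow ger0_norm.
have [] := (ler_wpM2r b0 bb, ler_wpM2r g0 gg); rewrite mulrDr; lra.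
Qed.

(** Either both points are on the same side of 0, or one of them is at
    distance at least [g / 2] from 0. *)
Lemma spow_gap a b g : 0 <= g -> b + g <= a ->
  (g / 2) `^ (p - 1) <= spow a - spow b.
Proof.
have [q1 r1] := (q0, r0).
move=> g0 bga.
have hg : (g / 2) `^ (p - 1) <= g `^ (p - 1).
  by apply: ler_powRl; lra.
have [b0|b0] := lerP 0 b.
  by apply: le_trans hg _; exact: spow_gap_ge0.
have [a0|a0] := lerP a 0.
  apply: le_trans hg _.
  rewrite (_ : spow a - spow b = spow (- b) - spow (- a)); last by rewrite !spowN; ring.
  by apply: spow_gap_ge0; lra.
have sa := spow_ge0 (ltW a0); have sb := spow_le0 (ltW b0).
have [ag|ag] := lerP (g / 2) a.
  have : spow (g / 2) <= spow a by exact: spow_mono.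
  by rewrite spow_ge0E; lra.
have : spow (g / 2) <= spow (- b) by apply: spow_mono; lra.
by rewrite spowN spow_ge0E; lra.
Qed.

(** Serves in place of the mean value theorem: only a Lipschitz bound with
    some constant is required of [spow]. *)
Lemma bernoulli (r : R) k : 0 <= r -> r <= 1 -> 1 - k%:R * (1 - r) <= r ^+ k.
Proof.
move=> h0 h1; elim: k => [|k IH]; first by rewrite mul0r subr0 expr0.
rewrite exprS; apply: (@le_trans _ _ (r * (1 - k%:R * (1 - r)))); last exact: ler_wpM2l.
have : 0 <= k%:R * (1 - r) ^+ 2 by rewrite mulr_ge0 ?sqr_ge0.
rewrite -natr1; nra.
Qed.

(** On the positive side, divide by [a] and bound the real power [p - 1] of [b
    / a] by an integer power. *)
Lemma spow_lipschitz : exists2 k, 0 < k & forall m a b, `|a| <= m -> `|b| <= m ->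
  `|spow a - spow b| <= k * m `^ (p - 2) * `|a - b|.
Proof.
have [q1 r1] := (q0, r0).
pose k := (Num.trunc (p - 1)).+1.
have pk : p - 1 <= k%:R by exact/ltW/truncnS_gt.
have k1 : 1 <= k%:R :> R by rewrite ler1n.
exists k%:R => //.
have pos m a b : 0 <= b -> b <= a -> a <= m ->
    spow a - spow b <= k%:R * m `^ (p - 2) * (a - b).
  move=> b0 ba am; have a0 := le_trans b0 ba.
  move: a0; rewrite le_eqVlt => /predU1P[a0|a0].
    have -> : a = b by lra.
    by rewrite !subrr mulr0.
  apply: (@le_trans _ _ (k%:R * a `^ (p - 2) * (a - b))); last first.
    apply: ler_wpM2r; first by lra.
    by apply: ler_wpM2l => //; apply: ler_powRl => //; exact: ltW.
  rewrite /spow !ger0_norm ?(ltW a0)//.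
  have ba1 : b / a <= 1 by rewrite ler_pdivrMr// mul1r.
  have br : (b / a) ^+ k <= (b / a) `^ (p - 1).
    have [->|b1] := eqVneq b 0.
      by rewrite mul0r expr0n/= powR_ge0.
    rewrite -powR_mulrn ?divr_ge0 ?(ltW a0)//.
    apply: ger_powR => //; rewrite ba1 andbT divr_gt0// lt_neqAle eq_sym b1//.
  have bE : b `^ (p - 2) * b = a `^ (p - 2) * a * (b / a) `^ (p - 1).
    have -> : b `^ (p - 2) * b = b `^ (p - 1) by rewrite -spow_ge0E// /spow ger0_norm.
    have -> : a `^ (p - 2) * a = a `^ (p - 1).
      by rewrite -spow_ge0E ?(ltW a0)// /spow ger0_norm// ltW.
    rewrite -powRM ?(ltW a0) ?divr_ge0 ?(ltW a0)//.
    by congr (_ `^ _); field; exact: lt0r_neq0.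
  rewrite bE.
  have aa : 0 <= a `^ (p - 2) * a by rewrite mulr_ge0 ?powR_ge0// ltW.
  have := ler_wpM2l aa (le_trans (@bernoulli (b / a) k _ ba1) br).
  rewrite divr_ge0 ?(ltW a0)// => /(_ isT).
  have -> : a `^ (p - 2) * a * (1 - k%:R * (1 - b / a)) =
    a `^ (p - 2) * a - k%:R * a `^ (p - 2) * (a - b).
    by field; exact: lt0r_neq0.
  lra.
have main m a b : b <= a -> `|a| <= m -> `|b| <= m ->
    `|spow a - spow b| <= k%:R * m `^ (p - 2) * `|a - b|.
  move=> ba /[1!ler_norml] /andP[a1 a2] /[1!ler_norml] /andP[b1 b2].
  have -> : `|a - b| = a - b by rewrite ger0_norm// subr_ge0.
  have -> : `|spow a - spow b| = spow a - spow b.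
    by rewrite ger0_norm// subr_ge0 spow_mono.
  have [b0|b0] := lerP 0 b; first exact: pos.
  have [a0|a0] := lerP a 0.
    rewrite (_ : spow a - spow b = spow (- b) - spow (- a)); last by rewrite !spowN; ring.
    by rewrite (_ : a - b = - b - - a); [apply: pos; lra|ring].
  have := pos m a 0 (lexx _) (ltW a0) a2.
  have := pos m (- b) 0 (lexx _).
  rewrite oppr_ge0 => /(_ (ltW b0)); rewrite spow0 spowN !subr0 => H1 H2.
  have := H1 ltac:(lra).
  lra.
move=> m a b am bm; case/orP: (le_total b a) => [ba|ab]; first exact: main.
by rewrite (distrC (spow a)) (distrC a); exact: main.
Qed.

Lemma measurable_spow : measurable_fun setT spow.
Proof.
apply: measurable_funM => //.
exact: measurableT_comp (measurable_powR _) (@normr_measurable R setT).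
Qed.

Lemma spow_norm t : `|spow t| = spow `|t|.
Proof. by rewrite /spow normrM normr_id ger0_norm ?powR_ge0. Qed.

Lemma spow_bound t m : `|t| <= m -> `|spow t| <= m `^ (p - 1).
Proof.
move=> tm; rewrite spow_norm -spow_ge0E; first exact: spow_mono.
exact: le_trans tm.
Qed.

End signed_power.

(** * Averages against the kernel away from the origin *)
Section kernel_average.
Context (R : realType) (n : nat) (al : R) (al0 : 0 < al).
Local Notation E := 'rV[R]_n.
Local Notation mu := (@lebesgue_rV R n).
Local Notation ker := (@ker R n al).
Implicit Types (h : E -> R) (e : R).

Definition far e : set E := [set z | e <= enorm z].

Definition bdd_meas h := measurable_fun setT h /\ exists M, forall z, `|h z| <= M.

Definition kernel_int e h : R := \int[mu]_(z in far e) (h z * ker z).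

Lemma measurable_far e : measurable (far e).
Proof.
rewrite -[X in measurable X]setTI.
rewrite (_ : far _ = @enorm R n @^-1` `[e, +oo[%classic).
  by apply: measurable_enorm => //; exact: measurable_itv.
by apply/seteqP; split => z /=; rewrite in_itv/= andbT.
Qed.

Lemma measurable_near_ball e : measurable [set z : E | enorm z < e].
Proof.
rewrite (_ : [set z | _] = ~` far e); last first.
  by apply/seteqP; split => z /=; rewrite /far/= ltNge => /negP.
by apply: measurableC; exact: measurable_far.
Qed.

Lemma integrable_ker e : 0 < e -> mu.-integrable (far e) (fun z => (ker z)%:E).
Proof.
move=> e0; apply/integrableP; split.
  by apply/measurable_EFinP; apply: measurable_funTS; exact: measurable_ker.
have [k _ /(_ _ e0) kt] := @kernel_tail R n _ al0.
under eq_integral do rewrite gee0_abs ?lee_fin ?ker_ge0//.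
exact: le_lt_trans kt (ltry _).
Qed.

Lemma integrable_far e h : 0 < e -> bdd_meas h ->
  mu.-integrable (far e) (fun z => (h z * ker z)%:E).
Proof.
move=> e0 [mh [M hM]].
apply: (le_integrable (measurable_far e) _ _
  (integrableZl (measurable_far e) M (integrable_ker e0))).
- apply/measurable_EFinP/measurable_funTS/measurable_funM => //.
  exact: measurable_ker.
- move=> z _; rewrite lee_fin !normrM ler_wpM2r//.
  exact: le_trans (hM z) (ler_norm _).
Qed.

Lemma kernel_intD e h1 h2 : 0 < e -> bdd_meas h1 -> bdd_meas h2 ->
  kernel_int e (fun z => h1 z + h2 z) = kernel_int e h1 + kernel_int e h2.
Proof.
move=> e0 b1 b2; rewrite /kernel_int.
rewrite -RintegralD; [|exact: measurable_far|exact: integrable_far..].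
by apply: eq_Rintegral => z _; rewrite mulrDl.
Qed.

Lemma kernel_int0 e : kernel_int e (fun=> 0) = 0.
Proof.
rewrite /kernel_int; under eq_Rintegral do rewrite mul0r.
by rewrite /Rintegral integral0.
Qed.

Lemma kernel_intZ e c h : 0 < e -> bdd_meas h -> kernel_int e (fun z => c * h z) = c * kernel_int e h.
Proof.
move=> e0 b1; rewrite /kernel_int.
rewrite -RintegralZl; [|exact: measurable_far|exact: integrable_far].
by apply: eq_Rintegral => z _; rewrite mulrA.
Qed.

Lemma le_kernel_int e h1 h2 : 0 < e -> bdd_meas h1 -> bdd_meas h2 ->
  (forall z, e <= enorm z -> h1 z <= h2 z) -> kernel_int e h1 <= kernel_int e h2.
Proof.
move=> e0 b1 b2 h12; apply: le_Rintegral; [exact: measurable_far|exact: integrable_far..|].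
by move=> z /h12; apply: ler_wpM2r; exact: ker_ge0.
Qed.

Lemma bdd_measD h1 h2 : bdd_meas h1 -> bdd_meas h2 -> bdd_meas (fun z => h1 z + h2 z).
Proof.
move=> [m1 [M1 H1]] [m2 [M2 H2]]; split; first exact: measurable_funD.
by exists (M1 + M2) => z; apply: le_trans (ler_normD _ _) _; exact: lerD.
Qed.

Lemma bdd_measZ c h : bdd_meas h -> bdd_meas (fun z => c * h z).
Proof.
move=> [m1 [M1 H1]]; split; first exact: measurable_funM.
by exists (`|c| * M1) => z; rewrite normrM ler_wpM2l.
Qed.

Lemma bdd_meas_indic (A : set E) : measurable A -> bdd_meas \1_A.
Proof.
move=> mA; split; first exact: measurable_indic.
by exists 1 => z; rewrite indicE; case: (_ \in _); rewrite ?normr1 ?normr0.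
Qed.

(** The measure and the kernel are invariant under [z |-> - z]. *)
Lemma kernel_int_odd e h : 0 < e -> bdd_meas h -> (forall z, h (- z) = - h z) ->
  kernel_int e h = 0.
Proof.
move=> e0 bh odd_h.
have [mN NE] := @lebesgue_rV_opp R n.
have bhN : bdd_meas (h \o -%R).
  case: bh => mh [M hM]; split; first exact: measurableT_comp mh mN.
  by exists M => z; exact: hM.
have farN : (fun z : E => - z) @^-1` far e = far e.
  by apply/seteqP; split => z /=; rewrite /far/= enormN.
have : kernel_int e h = kernel_int e (h \o -%R).
  have mhk : measurable_fun setT (fun z => (h z * ker z)%:E).
    by apply/measurable_EFinP/measurable_funM; [exact: bh.1|exact: measurable_ker].
  have ihk : mu.-integrable ((fun z : E => - z) @^-1` far e)
      ((fun z => (h z * ker z)%:E) \o (fun z : E => - z)).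
    rewrite farN; apply: eq_integrable (integrable_far e0 bhN).
      exact: measurable_far.
    by move=> z _ /=; rewrite kerN.
  have := integral_pushforward mN mhk ihk (measurable_far e).
  rewrite farN => pushE.
  rewrite /kernel_int /Rintegral; congr fine.
  transitivity (\int[pushforward mu (fun z : E => (- z)%R)]_(z in far e) (h z * ker z)%:E)%E.
    by apply: eq_measure_integral => A mA _; exact/esym/NE.
  rewrite pushE; apply: eq_integral => z _ /=.
  by rewrite kerN.
have -> : kernel_int e (h \o -%R) = - kernel_int e h.
  rewrite -mulN1r -kernel_intZ//; congr kernel_int; apply/funext => z /=.
  by rewrite odd_h mulN1r.
by move=> ?; lra.
Qed.

Lemma kernel_int_indic_le e (B : set E) h (c : R) : 0 < e -> measurable B ->
  measurable_fun setT h -> bdd_meas (fun z => \1_B z * h z) ->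
  (forall z, 0 <= h z) ->
  (\int[mu]_(z in B) (h z * ker z)%:E <= c%:E)%E ->
  kernel_int e (fun z => \1_B z * h z) <= c.
Proof.
move=> e0 mB mh bb h0 H.
have mhk : measurable_fun setT (fun z => (h z * ker z)%:E).
  by apply/measurable_EFinP/measurable_funM => //; exact: measurable_ker.
rewrite -lee_fin /kernel_int /Rintegral fineK; last first.
  by apply: integrable_fin_num; [exact: measurable_far|exact: integrable_far].
apply: le_trans H.
have -> : (\int[mu]_(z in far e) (\1_B z * h z * ker z)%:E =
  \int[mu]_(z in far e `&` B) (h z * ker z)%:E)%E.
  rewrite integral_mkcondr; apply: eq_integral => z _.
  by rewrite patchE indicE; case: ifPn => zB; rewrite ?mul1r ?mul0r.
apply: ge0_subset_integral => //.
- by apply: measurableI => //; exact: measurable_far.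
- exact: measurable_funTS.
- by move=> z _; rewrite lee_fin mulr_ge0 ?ker_ge0.
Qed.

Lemma kernel_int_cube_ge e (c : E) (w T : R) : 0 < e -> 0 < w ->
  (forall z, cube c w z -> e <= enorm z /\ enorm z <= T) ->
  (2 * w) ^+ n * T `^ (- (n%:R + al)) <= kernel_int e \1_(cube c w).
Proof.
move=> e0 w0 H; have mC := @measurable_cube R n c w.
rewrite -lee_fin /kernel_int /Rintegral fineK; last first.
  by apply: integrable_fin_num; [exact: measurable_far|exact/integrable_far/bdd_meas_indic].
apply: (@le_trans _ _ (\int[mu]_(z in far e)
    (T `^ (- (n%:R + al)) * \1_(cube c w) z)%:E)%E).
  rewrite (integralZl_indic (measurable_far e) (fun=> cube c w))//; last first.
    by rewrite ltNge powR_ge0.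
  rewrite integral_indic//; last exact: measurable_far.
  have -> : cube c w `&` far e = cube c w.
    by apply/setIidl => z /H[].
  have muC : (((2 * w) ^+ n)%:E <= mu (cube c w))%E by rewrite lebesgue_cube// ltW.
  by rewrite mulrC EFinM; apply: lee_wpmul2l; rewrite ?lee_fin ?powR_ge0.
apply: ge0_le_integral.
- exact: measurable_far.
- by move=> z _; rewrite lee_fin mulr_ge0 ?powR_ge0.
- apply/measurable_EFinP; apply: measurable_funTS; apply: measurable_funM => //.
- apply/measurable_EFinP; apply: measurable_funTS; apply: measurable_funM.
    by apply: measurable_indic; exact: measurable_cube.
  exact: measurable_ker.
move=> z /= ez; rewrite lee_fin indicE.
have [/set_mem/H[_ zT]|_] := boolP (z \in cube c w); last by rewrite mulr0 mul0r.
by rewrite mulr1 mul1r ker_ge// (lt_le_trans e0).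
Qed.

End kernel_average.

(** * Principal values and their comparison *)
Section principal_value.
Context (R : realType) (n : nat) (p al : R) (p2 : 2 <= p) (al0 : 0 < al).
Ltac goal_lra := clear - n p al p2 al0; lra.
Local Notation E := 'rV[R]_n.
Local Notation mu := (@lebesgue_rV R n).
Local Notation ker := (@ker R n al).
Local Notation kernel_int := (@kernel_int R n al).
Local Notation G := (spow p).
Implicit Types (u v : E -> R) (x y z : E).

(** The principal value in the fractional p-Laplacian, without its constant,
    in terms of the increment [z]. *)
Definition pv u x (A : R) :=
  kernel_int e (fun z => G (u x - u (x + z))) @[e --> 0^'+] --> A.

Lemma bdd_meas_spow_diff u x : bdd_meas u -> bdd_meas (fun z => G (u x - u (x + z))).
Proof.
move=> [mu_ [M uM]]; split.
  apply: (measurableT_comp (measurable_spow p)).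
  apply: measurable_funB => //.
  exact: measurableT_comp mu_ (lebesgue_rV_shift x).1.
exists ((M + M) `^ (p - 1)) => z; apply: spow_bound => //.
by apply: le_trans (ler_normB _ _) _; exact: lerD.
Qed.

Lemma pv_zero x : pv (fun=> 0) x 0.
Proof.
rewrite /pv (_ : (fun e => _) = fun=> 0); first exact: cvg_cst.
apply/funext => e; rewrite (_ : (fun z => _) = fun=> 0) ?kernel_int0//.
by apply/funext => z; rewrite subrr spow0.
Qed.

(** Every truncated integral with [e < rho] is bounded below by the integral
    of the assumed lower bounds: the odd part [o] contributes nothing, [enorm
    z `^ p] is integrable against the kernel near the origin because [al < p],
    and the other terms are tails of the kernel. The term [ga] is the gain on
    a cube, the terms in [a1] and [a2] are losses, and the limit [e -> 0]
    gives the statement. *)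
Lemma pv_comparison : al < p -> exists2 k, 0 < k &
  forall u v x y (A B rho E0 a1 a2 ga Rr w T : R) (o : E -> R) (c : E),
  bdd_meas u -> bdd_meas v -> pv u x A -> pv v y B ->
  0 < rho -> 0 < Rr -> 0 <= E0 -> 0 <= a1 -> 0 <= a2 -> 0 <= ga -> 0 < w ->
  measurable_fun setT o -> (forall z, o (- z) = - o z) ->
  (exists M : R, forall z, enorm z < rho -> `|o z| <= M) ->
  (forall z, enorm z < rho -> o z - E0 * enorm z `^ p <=
     G (u x - u (x + z)) - G (v y - v (y + z))) ->
  (forall z, rho <= enorm z ->
     - a1 - a2 * ((Rr <= enorm z)%R)%:R + ga * \1_(cube c w) z <=
     G (u x - u (x + z)) - G (v y - v (y + z))) ->
  (forall z, cube c w z -> rho <= enorm z /\ enorm z <= T) ->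
  ga * ((2 * w) ^+ n * T `^ (- (n%:R + al))) <= A - B +
    k * (E0 * rho `^ (p - al) + a1 * rho `^ (- al) + a2 * Rr `^ (- al)).
Proof.
move=> alp.
have [k1 k10 near_k] := @kernel_near R n al al0 p alp.
have [k2 k20 tail_k] := @kernel_tail R n al al0.
exists (k1 + k2); first exact: addr_gt0.
move=> u v x y A B rho E0 a1 a2 ga Rr w T o c bu bv pu pw rho0 Rr0 E00 a10 a20 ga0 w0.
move=> mo oddo [Mo oM] nearH farH cubeH.
have p0 : 0 < p by exact: lt_le_trans p2.
have pB : (fun e => kernel_int e (fun z => G (u x - u (x + z))) -
    kernel_int e (fun z => G (v y - v (y + z)))) e @[e --> 0^'+] --> A - B.
  exact: cvgB.
set N := [set z : E | enorm z < rho].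
have mN : measurable N by exact: measurable_near_ball.
set LL := ga * _; set RR := k1 + k2.
suff H : LL - RR * (E0 * rho `^ (p - al) + a1 * rho `^ (- al) + a2 * Rr `^ (- al)) <= A - B.
  by lra.
apply: cvgr_to_ge pB _.
near=> e.
have e0 : 0 < e by [].
have erho : e < rho by near: e; exact: nbhs_right_lt.
have bN (h : E -> R) : measurable_fun setT h ->
    (exists M : R, forall z, enorm z < rho -> `|h z| <= M) -> bdd_meas (fun z => \1_N z * h z).
  move=> mh [M hM]; split.
    by apply: measurable_funM => //; exact: measurable_indic.
  exists `|M| => z; rewrite indicE.
  have [/set_mem zN|_] := boolP (z \in N); last by rewrite mul0r normr0.
  by rewrite mul1r; apply: le_trans (hM _ zN) (ler_norm _).
have mpow : measurable_fun setT (fun z : E => enorm z `^ p).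
  exact: measurableT_comp (measurable_powR _) (@measurable_enorm R n).
have bpow : bdd_meas (fun z => \1_N z * enorm z `^ p).
  apply: bN => //; exists (rho `^ p) => z zr; rewrite ger0_norm ?powR_ge0//.
  by apply: ler_powRl; rewrite ?enorm_ge0// ltW.
have bo : bdd_meas (fun z => \1_N z * o z) by apply: bN => //; exists Mo.
have b1 : bdd_meas (fun z => \1_(@far R n rho) z * 1).
  by under eq_fun do rewrite mulr1; apply: bdd_meas_indic; exact: measurable_far.
have b2 : bdd_meas (fun z => \1_(@far R n Rr) z * 1).
  by under eq_fun do rewrite mulr1; apply: bdd_meas_indic; exact: measurable_far.
have b3 : bdd_meas \1_(cube c w) by apply: bdd_meas_indic; exact: measurable_cube.
pose low z := \1_N z * o z + (- E0 * (\1_N z * enorm z `^ p) +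
  (- a1 * (\1_(@far R n rho) z * 1) + (- a2 * (\1_(@far R n Rr) z * 1) + ga * \1_(cube c w) z))).
have bZ c' h : bdd_meas h -> bdd_meas (fun z => c' * h z) by exact: bdd_measZ.
have bD h1 h2 : bdd_meas h1 -> bdd_meas h2 -> bdd_meas (fun z => h1 z + h2 z) by exact: bdd_measD.
have b4 := bD _ _ (bZ (- a2) _ b2) (bZ ga _ b3).
have b5 := bD _ _ (bZ (- a1) _ b1) b4.
have b6 := bD _ _ (bZ (- E0) _ bpow) b5.
have blow : bdd_meas low by exact: bD.
have lowE : kernel_int e low = - E0 * kernel_int e (fun z => \1_N z * enorm z `^ p) +
    (- a1 * kernel_int e (fun z => \1_(@far R n rho) z * 1) +
    (- a2 * kernel_int e (fun z => \1_(@far R n Rr) z * 1) + ga * kernel_int e \1_(cube c w))).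
  rewrite /low kernel_intD// kernel_int_odd// ?add0r; last first.
    move=> z; rewrite oddo mulrN; congr (- (_ * _)); rewrite !indicE.
    by congr (nat_of_bool _)%:R; apply/idP/idP => /set_mem; rewrite /N/= ?enormN => zr;
      apply/mem_set; rewrite /= ?enormN.
  rewrite kernel_intD//; last exact: bZ.
  rewrite kernel_intZ// kernel_intD//; last exact: bZ.
  rewrite kernel_intZ// kernel_intD//; [|exact: bZ..].
  by rewrite !kernel_intZ.
have X1 : kernel_int e (fun z => \1_N z * enorm z `^ p) <= k1 * rho `^ (p - al).
  apply: kernel_int_indic_le => //; last exact: near_k.
  by move=> z; exact: powR_ge0.
have bone : bdd_meas (fun=> 1 : R) by split=> //; exists 1 => z; rewrite normr1.
have X2 r : 0 < r -> kernel_int e (fun z => \1_(@far R n r) z * 1) <= k2 * r `^ (- al).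
  move=> r0; apply: kernel_int_indic_le => //.
  - exact: measurable_far.
  - by under eq_fun do rewrite mulr1; apply: bdd_meas_indic; exact: measurable_far.
  - by under eq_integral do rewrite mul1r; exact: tail_k.
have X4 : (2 * w) ^+ n * T `^ (- (n%:R + al)) <= kernel_int e \1_(cube c w).
  apply: kernel_int_cube_ge => // z /cubeH[rz zT]; split=> //.
  by apply: le_trans rz; exact: ltW.
have bu' := bdd_meas_spow_diff x bu; have bv' := bdd_meas_spow_diff y bv.
have -> : kernel_int e (fun z => G (u x - u (x + z))) - kernel_int e (fun z => G (v y - v (y + z))) =
   kernel_int e (fun z => G (u x - u (x + z)) + (-1) * G (v y - v (y + z))).
  by rewrite kernel_intD// ?kernel_intZ// ?mulN1r//; exact: bZ.
apply: (@le_trans _ _ (kernel_int e low)); last first.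
  apply: le_kernel_int => //; first by apply: bD => //; exact: bZ.
  move=> z ez; rewrite mulN1r /low.
  have [zr|rz] := ltP (enorm z) rho.
    have -> : \1_N z = 1 :> R by rewrite indicE mem_set.
    have -> : \1_(@far R n rho) z = 0 :> R.
      by rewrite indicE memNset// /far/=; apply/negP; rewrite -ltNge.
    have -> : \1_(cube c w) z = 0 :> R.
      by rewrite indicE memNset// => /cubeH[]; rewrite leNgt zr.
    apply: le_trans (nearH z zr).
    have : 0 <= a2 * (\1_(@far R n Rr) z * 1) by rewrite !mulr_ge0.
    by goal_lra.
  have -> : \1_N z = 0 :> R.
    by rewrite indicE memNset// /N/=; apply/negP; rewrite -leNgt.
  have -> : \1_(@far R n rho) z = 1 :> R by rewrite indicE mem_set.
  apply: le_trans (farH z rz).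
  have -> : \1_(@far R n Rr) z = ((Rr <= enorm z)%R)%:R :> R.
    by rewrite indicE; congr (nat_of_bool _)%:R; apply/idP/idP => [/set_mem//|?]; exact/mem_set.
  by goal_lra.
rewrite lowE.
have X3 := X2 _ Rr0; have {}X2 := X2 _ rho0.
have Y1 := ler_wpM2l E00 X1.
have Y2 := ler_wpM2l a10 X2.
have Y3 := ler_wpM2l a20 X3.
have Y4 := ler_wpM2l ga0 X4; rewrite -/LL in Y4.
have Z1 : 0 <= k2 * (E0 * rho `^ (p - al)) by rewrite !mulr_ge0 ?powR_ge0// ltW.
have Z2 : 0 <= k1 * (a1 * rho `^ (- al)) by rewrite !mulr_ge0 ?powR_ge0// ltW.
have Z3 : 0 <= k1 * (a2 * Rr `^ (- al)) by rewrite !mulr_ge0 ?powR_ge0// ltW.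
by move: Y1 Y2 Y3 Y4 Z1 Z2 Z3; rewrite /RR; goal_lra.
Unshelve. all: by end_near.
Qed.

End principal_value.

(** * Functions touched by paraboloids *)
Section paraboloids.
Context (R : realType) (n : nat) (p al : R) (p2 : 2 <= p) (al0 : 0 < al).
Ltac goal_lra := clear - n p al p2 al0; lra.
Local Notation E := 'rV[R]_n.
Local Notation mu := (@lebesgue_rV R n).
Local Notation G := (spow p).
Local Notation pv := (@pv R n p al).
Implicit Types (u v : E -> R) (x y z : E).

Lemma powR_sub2 (t : R) : 0 <= t -> t `^ (p - 2) * t ^+ 2 = t `^ p.
Proof.
have p1 : 0 < p - 1 by move: p2 => ?; lra.
have p0 : 0 < p by move: p2 => ?; lra.
move=> t0; rewrite expr2.
have -> : t `^ (p - 2) * (t * t) = t * (t * t `^ (p - 1 - 1)).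
  by rewrite (_ : p - 1 - 1 = p - 2); [ring|ring].
by rewrite !mulr_powRB1.
Qed.

(** These stand for the linear parts of touching paraboloids. *)
Definition oddlin (l : E -> R) (L : R) := [/\ measurable_fun setT l,
  forall z, l (- z) = - l z & forall z, `|l z| <= L * enorm z].

(** By monotonicity [spow] may be applied to the paraboloids; near the origin
    [G (l z - Q |z|^2)] differs from the odd function [G (l z)] by at most a
    multiple of [|z|^p]. The constants depend on [u] and [v] only through the
    opening of the paraboloids, so they stay the same along a sequence of
    approximate maxima. *)
Lemma pv_paraboloid : al < p -> exists2 k, 0 < k &
  forall u v x y (A B rho L Q a1 a2 ga Rr w T : R) (l1 l2 : E -> R) (c : E),
  bdd_meas u -> bdd_meas v -> pv u x A -> pv v y B ->
  0 < rho -> 0 < Rr -> 0 <= L -> 0 <= Q -> 0 <= a1 -> 0 <= a2 -> 0 <= ga -> 0 < w ->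
  oddlin l1 L -> oddlin l2 L ->
  (forall z, enorm z < rho -> l1 z - Q * sqn z <= u x - u (x + z)) ->
  (forall z, enorm z < rho -> v y - v (y + z) <= l2 z + Q * sqn z) ->
  (forall z, rho <= enorm z ->
     - a1 - a2 * ((Rr <= enorm z)%R)%:R + ga * \1_(cube c w) z <=
     G (u x - u (x + z)) - G (v y - v (y + z))) ->
  (forall z, cube c w z -> rho <= enorm z /\ enorm z <= T) ->
  ga * ((2 * w) ^+ n * T `^ (- (n%:R + al))) <= A - B +
    k * (((L * rho + Q * rho ^+ 2) `^ (p - 2) * (Q * rho ^+ 2) + a1) * rho `^ (- al)
         + a2 * Rr `^ (- al)).
Proof.
move=> alp; have [k k0 master] := @pv_comparison R n p al p2 al0 alp.
have [ka ka0 lip] := @spow_lipschitz R p p2.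
exists (k * (2 * ka + 1)); first by rewrite mulr_gt0//; lra.
move=> u v x y A B rho L Q a1 a2 ga Rr w T l1 l2 c bu bv pu pw rho0 Rr0 L0 Q0.
move=> a10 a20 ga0 w0 [ml1 ol1 bl1] [ml2 ol2 bl2] near1 near2 farH cubeH.
pose S := L + Q * rho.
have S0 : 0 <= S by rewrite addr_ge0// mulr_ge0// ltW.
pose E0 := 2 * (ka * S `^ (p - 2) * Q).
have E00 : 0 <= E0 by rewrite !mulr_ge0 ?powR_ge0// ltW.
pose o z := G (l1 z) - G (l2 z).
have lipz (l : E -> R) (d : R) z : `|l z| <= L * enorm z -> enorm z < rho ->
    `|d| <= Q * sqn z ->
    `|G (l z) - G (l z + d)| <= E0 / 2 * enorm z `^ p.
  move=> lz zr dz.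
  have z0 := enorm_ge0 z.
  have zz : Q * sqn z <= Q * rho * enorm z.
    by rewrite -enorm_sqr -mulrA expr2 ler_wpM2l// ler_wpM2r// ltW.
  have lS : `|l z| <= S * enorm z.
    apply: le_trans lz _; apply: ler_wpM2r => //.
    by rewrite lerDl mulr_ge0// ltW.
  have ldS : `|l z + d| <= S * enorm z.
    by apply: le_trans (ler_normD _ _) _; rewrite /S mulrDl; lra.
  apply: le_trans (lip _ _ _ lS ldS) _.
  rewrite (_ : l z - (l z + d) = - d); last by ring.
  rewrite normrN powRM// -powR_sub2// enorm_sqr /E0.
  apply: (@le_trans _ _ (ka * (S `^ (p - 2) * enorm z `^ (p - 2)) * (Q * sqn z))).
    by apply: ler_wpM2l => //; rewrite !mulr_ge0 ?powR_ge0// ltW.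
  by rewrite le_eqVlt; apply/orP; left; apply/eqP; field.
have nearH z : enorm z < rho -> o z - E0 * enorm z `^ p <=
    G (u x - u (x + z)) - G (v y - v (y + z)).
  move=> zr.
  have qz : 0 <= Q * sqn z by rewrite mulr_ge0// sqn_ge0.
  have d1 := lipz l1 (- (Q * sqn z)) z (bl1 z) zr _.
  have d2 := lipz l2 (Q * sqn z) z (bl2 z) zr _.
  rewrite normrN ger0_norm// in d1; rewrite ger0_norm// in d2.
  move: (d1 (lexx _)) (d2 (lexx _)); rewrite !ler_norml => /andP[_ e1] /andP[e2 _].
  have g1 : G (l1 z - Q * sqn z) <= G (u x - u (x + z)).
    by apply: spow_mono => //; exact: near1.
  have g2 : G (v y - v (y + z)) <= G (l2 z + Q * sqn z).
    by apply: spow_mono => //; exact: near2.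
  by move: e1 e2 g1 g2; rewrite /o; goal_lra.
have mo : measurable_fun setT o.
  by apply: measurable_funB; apply: (measurableT_comp (measurable_spow p)).
have oo z : o (- z) = - o z by rewrite /o ol1 ol2 !spowN; ring.
have bo : exists M : R, forall z, enorm z < rho -> `|o z| <= M.
  exists ((L * rho) `^ (p - 1) + (L * rho) `^ (p - 1)) => z zr.
  have lr : L * enorm z <= L * rho by apply: ler_wpM2l => //; exact: ltW.
  apply: le_trans (ler_normB _ _) _; apply: lerD; apply: spow_bound => //.
    exact: le_trans (bl1 z) lr.
  exact: le_trans (bl2 z) lr.
have := master u v x y A B rho E0 a1 a2 ga Rr w T o c bu bv pu pw rho0 Rr0 E00 a10 a20 ga0 w0 mo oo bo nearH farH cubeH.
move=> H; apply: le_trans H _; rewrite lerD2l.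
have -> : E0 * rho `^ (p - al) =
   2 * ka * ((L * rho + Q * rho ^+ 2) `^ (p - 2) * (Q * rho ^+ 2) * rho `^ (- al)).
  have -> : L * rho + Q * rho ^+ 2 = S * rho by rewrite /S; ring.
  rewrite powRM ?(ltW rho0)// powRD; last by apply/implyP => _; rewrite gt_eqF.
  by rewrite -(powR_sub2 (ltW rho0)) /E0; ring.
set X := _ `^ (p - 2) * _.
have X0 : 0 <= X by rewrite mulr_ge0 ?powR_ge0// mulr_ge0 ?sqr_ge0.
rewrite -[leRHS]mulrA ler_wpM2l ?(ltW k0)//.
have h1 : 0 <= X * rho `^ (- al) by rewrite mulr_ge0// powR_ge0.
have h2 : 0 <= ka * (a1 * rho `^ (- al)) by rewrite !mulr_ge0 ?powR_ge0// ltW.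
have h3 : 0 <= ka * (a2 * Rr `^ (- al)) by rewrite !mulr_ge0 ?powR_ge0// ltW.
by lra.
Qed.

End paraboloids.

(** * From the truncated operator to principal values *)
Section pv_solution.
Context (R : realType) (n : nat) (C s p : R) (hC : 0 < C) (sp0 : 0 < s * p)
  (p2 : 2 <= p).
Local Notation E := 'rV[R]_n.
Local Notation mu := (@lebesgue_rV R n).

Lemma fplap_truncE (u : E -> R) (x : E) (e : R) : bdd_meas u -> 0 < e ->
  fine (fplap_trunc s p u x e) =
  kernel_int (s * p) e (fun z => spow p (u x - u (x + z))).
Proof.
move=> bu e0.
suff -> : fplap_trunc s p u x e = (\int[mu]_(z in far e)
    (spow p (u x - u (x + z)%R) * ker (s * p) z)%:E)%E by [].
have [mx xE] := lebesgue_rV_shift x.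
pose g y := (`|u x - u y| `^ (p - 2) * (u x - u y)
       / enorm (x - y) `^ (n%:R + s * p))%:E.
have gE z : g (x + z) = (spow p (u x - u (x + z)) * ker (s * p) z)%:E.
  by rewrite /g (_ : x - (x + z) = - z) ?enormN// opprD addNKr.
have preE : (fun z => x + z) @^-1` (~` eball x e) = far e.
  apply/seteqP; split => z; rewrite /eball /far/= (_ : x - (x + z) = - z);
    rewrite ?opprD ?addNKr// enormN.
    by move/negP; rewrite -leNgt.
  by move=> ez; apply/negP; rewrite -leNgt.
have mg : measurable_fun setT g.
  apply/measurable_EFinP/measurable_funM.
    apply: (measurableT_comp (measurable_spow p)); apply: measurable_funB => //.
    exact: bu.1.
  rewrite (_ : (fun y => _) = ker (s * p) \o (fun z => - z) \o (fun y => - x + y)).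
    apply: measurableT_comp (lebesgue_rV_shift _).1.
    by apply: measurableT_comp (lebesgue_rV_opp _ _).1; exact: measurable_ker.
  by apply/funext => y /=; rewrite /ker opprD opprK.
have mball : measurable (~` eball x e).
  rewrite (_ : ~` eball x e = (fun y => - x + y) @^-1` far e).
    rewrite -[X in measurable X]setTI.
    by apply: (lebesgue_rV_shift _).1 => //; exact: measurable_far.
  have yE y : enorm (x - y) = enorm (- x + y) by rewrite -enormN opprB addrC.
  apply/seteqP; split => y; rewrite /eball /far/= yE.
    by move/negP; rewrite -leNgt.
  by move=> ez; apply/negP; rewrite -leNgt.
have ig : mu.-integrable ((fun z => x + z) @^-1` (~` eball x e)) (g \o (fun z => x + z)).
  rewrite preE; have := integrable_far sp0 e0 (bdd_meas_spow_diff p2 x bu).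
  apply: eq_integrable; first exact: measurable_far.
  by move=> z _; rewrite /= -gE.
have := integral_pushforward mx mg ig mball; rewrite preE => pushE.
transitivity (\int[pushforward mu (fun z : E => (x + z)%R)]_(z in ~` eball x e) g z)%E.
  by apply: eq_measure_integral => A mA _; exact/esym/xE.
by rewrite pushE; apply: eq_integral => z _; rewrite /= gE.
Qed.

Lemma pv_of_fplap (u : E -> R) (x : E) (y : R) : bdd_meas u ->
  cvg (fplap_trunc s p u x e @[e --> 0^'+]) -> fplap C s p u x = y%:E ->
  pv p (s * p) u x (y / C).
Proof.
move=> bu cu; rewrite /fplap => limE.
have {}limE : lim (fplap_trunc s p u x e @[e --> 0^'+]) = (y / C)%:E.
  move: limE; case: (lim _) => [r| |] /=.
  - by rewrite -EFinM => -[<-]; rewrite mulrC mulKf ?gt_eqF.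
  - by rewrite gt0_muley.
  - by rewrite gt0_muleNy.
have /fine_cvg : fplap_trunc s p u x e @[e --> 0^'+] --> (y / C)%:E.
  by rewrite -limE.
apply: cvg_trans; apply: near_eq_cvg; near=> e.
by rewrite /= fplap_truncE.
Unshelve. all: by end_near.
Qed.

End pv_solution.

(** * Humps and touching paraboloids *)
Section humps.
Context (R : realType) (n : nat).
Ltac goal_lra := clear - n; lra.
Local Notation E := 'rV[R]_n.
Implicit Types (x y z : E) (t d r c : R).

(** A C^{1,1} convex function vanishing on the negative half-line: its
    second-order expansion has one-sided errors in both directions
    ([pos_sqrD_le] and [pos_sqrD_ge]). *)
Definition pos_sqr t : R := Num.max t 0 ^+ 2.

Lemma pos_sqr_ge0 t : 0 <= pos_sqr t. Proof. exact: sqr_ge0. Qed.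

Lemma pos_sqr_le1 t : t <= 1 -> pos_sqr t <= 1.
Proof. by move=> t1; rewrite /pos_sqr expr_le1// ?ge_max ?t1 ?ler01// le_max lexx orbT. Qed.

Lemma pos_sqr_eq0 t : t <= 0 -> pos_sqr t = 0.
Proof. by move=> t0; rewrite /pos_sqr max_r// expr0n. Qed.

Lemma pos_sqrE t : 0 <= t -> pos_sqr t = t ^+ 2.
Proof. by move=> t0; rewrite /pos_sqr max_l. Qed.

Lemma pos_sqrD_le t d : pos_sqr (t + d) <= pos_sqr t + 2 * Num.max t 0 * d + d ^+ 2.
Proof.
rewrite /pos_sqr; have [t0|t0] := leP 0 t; have [td|td] := leP 0 (t + d).
- by rewrite le_eqVlt; apply/orP; left; apply/eqP; ring.
- by rewrite expr0n/=; nra.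
- by rewrite expr0n/=; nra.
- by rewrite expr0n/=; nra.
Qed.

Lemma pos_sqrD_ge t d : pos_sqr t + 2 * Num.max t 0 * d <= pos_sqr (t + d).
Proof.
rewrite /pos_sqr; have [t0|t0] := leP 0 t; have [td|td] := leP 0 (t + d).
- by nra.
- by rewrite expr0n/=; nra.
- by rewrite expr0n/=; nra.
- by rewrite expr0n/=; nra.
Qed.

Lemma continuous_pos_sqr : continuous pos_sqr.
Proof.
move=> t; rewrite /pos_sqr.
have ct : {for t, continuous (fun t : R => Num.max t 0)}.
  by apply: continuous_max; [exact: cvg_id|exact: cst_continuous].
exact: (cvgM ct ct).
Qed.

Lemma oddlinD (l1 l2 : E -> R) L1 L2 : oddlin l1 L1 -> oddlin l2 L2 ->
  oddlin (fun z => l1 z + l2 z) (L1 + L2).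
Proof.
move=> [m1 o1 b1] [m2 o2 b2]; split.
- exact: measurable_funD.
- by move=> z; rewrite o1 o2 opprD.
- by move=> z; apply: le_trans (ler_normD _ _) _; rewrite mulrDl lerD.
Qed.

Lemma oddlinZ (l : E -> R) c L : 0 <= c -> oddlin l L -> oddlin (fun z => c * l z) (c * L).
Proof.
move=> c0 [m o b]; split.
- exact: measurable_funM.
- by move=> z; rewrite o mulrN.
- by move=> z; rewrite normrM ger0_norm// -mulrA ler_wpM2l.
Qed.

Lemma oddlinN (l : E -> R) L : oddlin l L -> oddlin (fun z => - l z) L.
Proof.
move=> [m o b]; split.
- exact: measurableT_comp.
- by move=> z; rewrite o.
- by move=> z; rewrite normrN.
Qed.

Lemma oddlin_le (l : E -> R) L L' : L <= L' -> oddlin l L -> oddlin l L'.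
Proof.
move=> LL [m o b]; split=> // z; apply: le_trans (b z) _.
by apply: ler_wpM2r => //; exact: enorm_ge0.
Qed.

Lemma oddlin0 : oddlin (fun _ : E => 0 : R) 0.
Proof. by split=> // z; rewrite ?oppr0// normr0 mul0r. Qed.

Lemma oddlin_coord (i : 'I_n) : oddlin (fun z : E => z ord0 i) 1.
Proof.
split; first exact: measurable_coord_rV.
- by move=> z; rewrite mxE.
- by move=> z; rewrite mul1r coord_le_enorm.
Qed.

(** A bump supported in the ball of radius [r] around [x0]; the height
    parameter [c] is 1 for a single hump, and smaller when it is one slice of
    a hump in a product space. *)
Definition hump c x0 r x : R := pos_sqr (c - sqn (x - x0) / r ^+ 2).

Lemma hump_ge0 c x0 r x : 0 <= hump c x0 r x.
Proof. exact: pos_sqr_ge0. Qed.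

Lemma hump_le1 c x0 r x : c <= 1 -> hump c x0 r x <= 1.
Proof.
move=> c1; apply: pos_sqr_le1; rewrite (le_trans _ c1)// gerBl.
by rewrite divr_ge0 ?sqn_ge0 ?sqr_ge0.
Qed.

Lemma hump_center c x0 r : hump c x0 r x0 = pos_sqr c.
Proof. by rewrite /hump subrr sqn0 mul0r subr0. Qed.

Lemma hump_out c x0 r x : 0 < r -> c <= 1 -> r ^+ 2 <= sqn (x - x0) -> hump c x0 r x = 0.
Proof.
move=> r0 c1 xr; apply: pos_sqr_eq0; rewrite subr_le0 (le_trans c1)//.
by rewrite ler_pdivlMr ?exprn_gt0// mul1r.
Qed.

(** The linear part is the gradient; the bound for it uses that the positive
    part vanishes outside the ball. *)
Lemma hump_touch c x0 r x : 0 < r -> c <= 1 -> exists2 l : E -> R,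
  oddlin l (4 * n%:R / r) &
  forall z, hump c x0 r x - hump c x0 r (x + z) <= l z + 2 / r ^+ 2 * sqn z.
Proof.
move=> r0 c1; set t := c - sqn (x - x0) / r ^+ 2; set m := Num.max t 0.
have r20 : 0 < r ^+ 2 by rewrite exprn_gt0.
have m0 : 0 <= m by rewrite le_max lexx orbT.
have t1 : t <= 1.
  by rewrite (le_trans _ c1)// gerBl divr_ge0 ?sqn_ge0// ltW.
have m1 : m <= 1 by rewrite ge_max t1 ler01.
have mr : m * enorm (x - x0) <= r.
  have [t0|t0] := leP t 0.
    by rewrite /m max_r// mul0r ltW.
  have xr : enorm (x - x0) <= r.
    rewrite sqn_le ?(ltW r0)//; move: t0; rewrite subr_gt0 ltr_pdivrMr// => /ltW.
    by move=> h; apply: (le_trans h); rewrite ler_piMl// ltW.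
  by apply: le_trans xr; rewrite ler_piMl// enorm_ge0.
exists (fun z => 4 * m / r ^+ 2 * dotp (x - x0) z).
  split.
  - by apply: measurable_funM => //; exact: measurable_dotp.
  - by move=> z; rewrite dotpN mulrN.
  - move=> z; rewrite normrM ger0_norm; last by rewrite divr_ge0 ?(ltW r20)// mulr_ge0.
    apply: (@le_trans _ _ (4 * m / r ^+ 2 * (n%:R * (enorm (x - x0) * enorm z)))).
      apply: ler_wpM2l; first by rewrite divr_ge0 ?(ltW r20)// mulr_ge0.
      exact: dotp_le.
    rewrite [leLHS](_ : _ = 4 * n%:R / r ^+ 2 * (m * enorm (x - x0)) * enorm z); last by ring.
    apply: ler_wpM2r; first exact: enorm_ge0.
    rewrite (_ : 4 * n%:R / r = 4 * n%:R / r ^+ 2 * r); last by field; exact: lt0r_neq0.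
    by apply: ler_wpM2l => //; rewrite divr_ge0 ?mulr_ge0// ltW.
move=> z; rewrite /hump -/t addrAC sqnDE.
have := pos_sqrD_ge t (- (2 * dotp (x - x0) z + sqn z) / r ^+ 2).
rewrite -/m (_ : t + _ = c - (sqn (x - x0) + 2 * dotp (x - x0) z + sqn z) / r ^+ 2); last first.
  by rewrite /t; ring.
have zr : m * (sqn z / r ^+ 2) <= sqn z / r ^+ 2.
  by rewrite ler_piMl// divr_ge0 ?sqn_ge0// ltW.
move=> H; rewrite -/t.
have -> : 2 / r ^+ 2 * sqn z = 2 * (sqn z / r ^+ 2) by ring.
have e : 2 * m * (- (2 * dotp (x - x0) z + sqn z) / r ^+ 2) =
  - (4 * m / r ^+ 2 * dotp (x - x0) z) - 2 * (m * (sqn z / r ^+ 2)) by ring.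
by rewrite e in H; lra.
Qed.

Lemma continuous_sqnB x0 : continuous (fun x => sqn (x - x0)).
Proof.
move=> x; apply: (@continuous_comp _ _ _ (fun x => x - x0) (@sqn R n)).
  by apply: continuousB; [move=> ?; exact: cvg_id|exact: cst_continuous].
exact: continuous_sqn.
Qed.

Lemma continuous_hump c x0 r : continuous (hump c x0 r).
Proof.
move=> x; apply: (@continuous_comp _ _ _ (fun x => c - sqn (x - x0) / r ^+ 2) pos_sqr).
  apply: continuousB; first exact: cst_continuous.
  by apply: continuousM; [exact: continuous_sqnB|exact: cst_continuous].
exact: continuous_pos_sqr.
Qed.

Definition cball x0 r : set E := [set x | sqn (x - x0) <= r ^+ 2].

Lemma compact_cball x0 r : 0 <= r -> compact (cball x0 r).
Proof.
move=> r0; pose A (i : 'I_n) := `[x0 ord0 i - r, x0 ord0 i + r]%classic.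
have cA : compact [set v : E | forall i, A i (v ord0 i)].
  by apply: rV_compact => i; exact: segment_compact.
apply: subclosed_compact cA _.
  apply: (@closed_comp _ _ (fun x => sqn (x - x0)) [set t : R | t <= r ^+ 2]).
    by move=> x _; exact: continuous_sqnB.
  exact: closed_le.
move=> x xr i; rewrite /A/= in_itv/=.
have : `|(x - x0) ord0 i| <= r.
  apply: le_trans (coord_le_enorm _ _) _.
  by rewrite sqn_le.
by rewrite !mxE ler_norml => /andP[h1 h2]; apply/andP; lra.
Qed.

Lemma compact_max (T : topologicalType) (K : set T) (h : T -> R) : compact K -> K !=set0 ->
  (forall a, K a -> {for a, continuous h}) ->
  exists2 a, K a & forall b, K b -> h b <= h a.
Proof.
move=> cK K0 ch.
have [|c /set_mem Kc Hc] := compact_EVT_max K0 cK (f := h).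
  by apply: continuous_in_subspaceT => x /set_mem; exact: ch.
by exists c => // b Kb; apply: Hc; exact/mem_set.
Qed.

End humps.

(** * Solutions in the half-space and the estimate from above *)
Section halfspace_solutions.
Context (R : realType) (n : nat) (p al : R) (p2 : 2 <= p) (al0 : 0 < al) (alp : al < p).
Ltac goal_lra := clear - n p al p2 al0 alp; lra.
Local Notation N := n.+1.
Local Notation E := 'rV[R]_n.+1.
Local Notation G := (spow p).
Local Notation pv := (@pv R n.+1 p al).
Implicit Types (F : R -> R) (u v : E -> R) (x y z : E).

Definition ht x : R := x ord0 ord_max.

Definition vert (a : R) : E := \row_i (if i == ord_max then a else 0).

Lemma htD x y : ht (x + y) = ht x + ht y. Proof. by rewrite /ht mxE. Qed.

Lemma htN x : ht (- x) = - ht x. Proof. by rewrite /ht mxE. Qed.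

Lemma ht_vert a : ht (vert a) = a. Proof. by rewrite /ht mxE eqxx. Qed.

Lemma ht_le_enorm x : `|ht x| <= enorm x. Proof. exact: coord_le_enorm. Qed.

Lemma sqn_vert a : sqn (vert a) = a ^+ 2.
Proof.
rewrite /sqn (bigD1 ord_max)//= mxE eqxx big1 ?addr0// => i /negbTE im.
by rewrite mxE im expr0n.
Qed.

Lemma cball_ht x0 r x : 0 <= r -> cball x0 r x -> ht x0 - r <= ht x /\ ht x <= ht x0 + r.
Proof.
move=> r0 xr; have : `|ht (x - x0)| <= r.
  by apply: le_trans (ht_le_enorm _) _; rewrite sqn_le.
by rewrite htD htN ler_norml => /andP[h1 h2]; split; lra.
Qed.

Lemma cube_vert (a w : R) z : cube (vert a) w z ->
  a - w <= ht z /\ ht z <= a + w.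
Proof.
move=> /cubeP/(_ ord_max); rewrite -/(ht z) -/(ht (vert a)) ht_vert ler_norml.
by move=> /andP[h1 h2]; split; lra.
Qed.

Lemma cube_vert_enorm (a w : R) z : 0 <= w -> cube (vert a) w z ->
  enorm z <= N%:R * (`|a| + w).
Proof.
move=> w0 /cubeP zc; apply: enorm_coord_le; first by rewrite addr_ge0.
move=> i; have := zc i; rewrite mxE => h.
rewrite -[z ord0 i](subrK (if i == ord_max then a else 0)) addrC.
apply: le_trans (ler_normD _ _) _; apply: lerD => //.
by case: ifP => // _; rewrite normr0.
Qed.

(** The mass of a cube of size [t] at distance comparable to [t], weighted by
    the kernel, scales like [t^-al]. *)
Lemma cube_scale (a b t : R) : 0 <= a -> 0 <= b -> 0 < t ->
  (a * t) ^+ N * (b * t) `^ (- (N%:R + al)) = a ^+ N * b `^ (- (N%:R + al)) * t `^ (- al).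
Proof.
move=> a0 b0 t0; rewrite exprMn powRM ?(ltW t0)//.
have -> : t `^ (- al) = t ^+ N * t `^ (- (N%:R + al)).
  rewrite -powR_mulrn ?(ltW t0)// -powRD; last by apply/implyP => _; rewrite gt_eqF.
  by congr (_ `^ _); ring.
by ring.
Qed.

(** The problem with the right-hand side [F = f / C], the constant of the
    operator being moved to the nonlinearity. *)
Definition pde_sol F u := [/\ bdd_meas u, forall x, 0 < ht x -> {for x, continuous u},
  forall x, 0 < ht x -> 0 < u x, forall x, ht x <= 0 -> u x = 0 &
  forall x, 0 < ht x -> pv u x (F (u x))].

Lemma pde_sol_ge0 F u x : pde_sol F u -> 0 <= u x.
Proof.
move=> [_ _ u0 u00 _]; have [h|h] := leP (ht x) 0; first by rewrite u00.
exact/ltW/u0.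
Qed.

Lemma spow_ge_opp (t m : R) : 0 <= m -> - m <= t -> - (m `^ (p - 1)) <= G t.
Proof.
move=> m0 mt; rewrite -spow_ge0E// -spowN; exact: spow_mono.
Qed.

(** If [u] nearly attains at [x0] its supremum [S] over a lower slab, adding a
    hump of amplitude [2 * e] and of the size of the distance to the boundary
    produces an interior maximum [x]; there [u] is touched from above. The
    region under the boundary, where [u] vanishes, contributes [(S - e)^(p-1)
    r^-al], whereas the hump costs [e^(p-1) r^-al], and the part above the
    slab costs [M^(p-1) d^-al]. All powers of [r] are the same, so the
    estimate is uniform in the distance to the boundary. *)
Lemma top_estimate : exists c1 c2 : R, [/\ 0 < c1, 0 < c2 &
  forall F u M x0 r S e d, pde_sol F u -> (forall x, u x <= M) ->
  0 < r -> ht x0 = 2 * r -> 6 * r <= d -> 0 < e -> e <= S ->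
  (forall x, ht x < d -> u x <= S) -> S - e <= u x0 ->
  exists x, [/\ 0 < ht x, S - e <= u x, u x <= S &
    c1 * (S - e) `^ (p - 1) * r `^ (- al) <= F (u x) +
      c2 * (e `^ (p - 1) * r `^ (- al) + M `^ (p - 1) * d `^ (- al))]].
Proof.
have [k k0 main] := @pv_paraboloid R N p al p2 al0 alp.
pose c1 : R := 2 ^+ N * (6 * N%:R) `^ (- (N%:R + al)).
pose b : R := (8 * N%:R + 4) `^ (p - 2) * 4.
have b0 : 0 <= b by rewrite mulr_ge0// powR_ge0.
pose c2 : R := k * (b + 1 + 2 `^ al).
have al2 : 0 < 2 `^ al :> R by rewrite powR_gt0.
exists c1, c2; split.
- by rewrite mulr_gt0 ?exprn_gt0// powR_gt0// mulr_gt0.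
- by rewrite mulr_gt0//; lra.
move=> F u M x0 r S e d solu uM r0 x0r rd e0 eS uS ux0.
have [bu cu upos u0 pvu] := solu.
have u_ge0 x : 0 <= u x by exact: pde_sol_ge0 solu.
have M0 : 0 <= M by exact: le_trans (u_ge0 x0) (uM x0).
have r2 : 0 < r ^+ 2 by rewrite exprn_gt0.
pose h x := u x + 2 * e * hump 1 x0 r x.
have Kht x : cball x0 r x -> r <= ht x /\ ht x <= 3 * r.
  by move=> /(cball_ht (ltW r0)); rewrite x0r => -[h1 h2]; split; move: h1 h2; goal_lra.
have Kx0 : cball x0 r x0 by rewrite /cball/= subrr sqn0 ltW.
have [x Kx xmax] : exists2 x, cball x0 r x & forall y, cball x0 r y -> h y <= h x.
  apply: compact_max; first by apply: compact_cball; exact: ltW.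
    by exists x0.
  move=> x /Kht[hx _]; apply: continuousD; first by apply: cu; lra.
  apply: continuousM; first exact: cst_continuous.
  exact: continuous_hump.
have hx0 : S + e <= h x.
  apply: le_trans (xmax _ Kx0); rewrite /h hump_center pos_sqrE// expr1n; lra.
have hmax y : ht y < d -> h y <= h x.
  move=> yd; have [Ky|Ky] := pselect (cball x0 r y); first exact: xmax.
  rewrite /h hump_out//; last by rewrite leNgt; apply/negP => /ltW.
  by rewrite mulr0 addr0; have := uS y yd; rewrite -/(h x); lra.
have [hx1 hx2] := Kht x Kx.
have bx : hump 1 x0 r x <= 1 by exact: hump_le1.
have bge y : 0 <= hump 1 x0 r y by exact: hump_ge0.
have uxS : u x <= S by apply: uS; lra.
have uxe : S - e <= u x.
  have : 2 * e * hump 1 x0 r x <= 2 * e by rewrite ler_piMr// mulr_ge0// ltW.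
  by move: hx0; rewrite /h; goal_lra.
have hx : 0 < ht x by exact: lt_le_trans hx1.
exists x; split=> //.
have [l ol lE] := @hump_touch R N 1 x0 r x r0 (lexx 1).
have e20 : 0 <= 2 * e by rewrite mulr_ge0// ltW.
pose L := 2 * e * (4 * N%:R / r); pose Q := 2 * e * (2 / r ^+ 2).
have L0 : 0 <= L by rewrite !mulr_ge0 ?invr_ge0// ltW.
have Q0 : 0 <= Q by rewrite !mulr_ge0 ?invr_ge0// ltW.
pose ga := (S - e) `^ (p - 1).
have LQ1 : L * r + Q * r ^+ 2 = (8 * N%:R + 4) * e.
  by rewrite /L /Q; field; exact: lt0r_neq0.
have LQ2 : Q * r ^+ 2 = 4 * e.
  by rewrite /Q; field; exact: lt0r_neq0.
have bu0 : bdd_meas (fun _ : E => 0 : R) by split=> //; exists 0 => z; rewrite normr0.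
have pu : pv u x (F (u x)) by exact: pvu.
have p0 : pv (fun _ : E => 0 : R) 0 0 by exact: pv_zero.
have ol1 : oddlin (fun z => - (2 * e * l z)) L by apply: oddlinN; exact: oddlinZ.
have ol2 : oddlin (fun _ : E => 0 : R) L by exact: oddlin_le (oddlin0 _ _).
have d20 : 0 < d / 2 by move: rd r0; goal_lra.
have N1 : 1 <= N%:R :> R by rewrite ler1n.
have near1 z : enorm z < r -> - (2 * e * l z) - Q * sqn z <= u x - u (x + z).
  move=> zr; have zh := ht_le_enorm z.
  have hz : ht (x + z) < d.
    by move: zh; rewrite ler_norml htD => /andP[_]; move: zr hx2 rd r0; goal_lra.
  have hm := hmax _ hz; have := ler_wpM2l e20 (lE z).
  by move: hm; rewrite /h /Q; goal_lra.
have near2 z : enorm z < r -> (0 : R) - 0 <= 0 + Q * sqn z.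
  by move=> _; rewrite subrr add0r mulr_ge0 ?sqn_ge0.
have farH z : r <= enorm z ->
    - e `^ (p - 1) - M `^ (p - 1) * ((d / 2 <= enorm z)%R)%:R +
      ga * \1_(cube (vert (- (5 * r))) r) z <= G (u x - u (x + z)) - G (0 - 0).
  move=> rz; rewrite subrr spow0 subr0 indicE.
  have ee : 0 <= e `^ (p - 1) by exact: powR_ge0.
  have MM : 0 <= M `^ (p - 1) by exact: powR_ge0.
  have [zc|zc] := boolP (z \in _).
    have [_ hz] := cube_vert (set_mem zc).
    rewrite mulr1 (u0 (x + z)); last by rewrite htD; move: hz hx2 r0; goal_lra.
    have : ga <= G (u x).
      by rewrite /ga -spow_ge0E ?subr_ge0//; [exact: spow_mono].
    have : 0 <= M `^ (p - 1) * ((d / 2 <= enorm z)%R)%:R by rewrite mulr_ge0.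
    by move: ee; rewrite subr0; goal_lra.
  rewrite mulr0 addr0.
  have [dz|dz] := leP (d / 2) (enorm z).
    rewrite mulr1; have := @spow_ge_opp (u x - u (x + z)) M M0.
    have h1 : - M <= u x - u (x + z) by move: (uM (x + z)) (u_ge0 x); goal_lra.
    by move=> /(_ h1); move: ee; goal_lra.
  rewrite mulr0 subr0; apply: spow_ge_opp; first exact: ltW.
  have : u (x + z) <= S.
    apply: uS; rewrite htD; have := ht_le_enorm z; rewrite ler_norml => /andP[_].
    by move: dz hx2 rd; goal_lra.
  by move: uxe; goal_lra.
have cubeH z : cube (vert (- (5 * r))) r z -> r <= enorm z /\ enorm z <= 6 * N%:R * r.
  move=> zc; have [_ hz] := cube_vert zc; split.
    have := ht_le_enorm z; rewrite ler_norml => /andP[+ _]; move: hz r0; goal_lra.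
  apply: le_trans (cube_vert_enorm (ltW r0) zc) _.
  rewrite normrN ger0_norm; last by rewrite mulr_ge0// ltW.
  by rewrite le_eqVlt; apply/orP; left; apply/eqP; ring.
have := main _ _ _ _ _ _ _ _ _ _ _ _ _ _ _ _ _ _ bu bu0 pu p0 r0 d20 L0 Q0
  (powR_ge0 e (p - 1)) (powR_ge0 M (p - 1)) (powR_ge0 (S - e) (p - 1)) r0
  ol1 ol2 near1 near2 farH cubeH.
rewrite cube_scale //.
rewrite LQ1 LQ2 subr0 => H.
have NN : 0 <= 8 * N%:R + 4 :> R by rewrite addr_ge0// mulr_ge0.
have H1 : ((8 * N%:R + 4) * e) `^ (p - 2) * (4 * e) = b * e `^ (p - 1).
  rewrite powRM ?(ltW e0)// -[in RHS]spow_ge0E ?(ltW e0)// /spow ger0_norm ?(ltW e0)//.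
  by rewrite /b; ring.
have H2 : (d / 2) `^ (- al) = 2 `^ al * d `^ (- al).
  rewrite powRM ?invr_ge0//; last by move: d20; goal_lra.
  by rewrite -powR_inv1// -powRrM mulN1r opprK mulrC.
rewrite H1 H2 in H.
rewrite (_ : c1 * (S - e) `^ (p - 1) * r `^ (- al) =
  ga * (2 ^+ N * (6 * N%:R) `^ (- (N%:R + al)) * r `^ (- al))); last by rewrite /c1 /ga; ring.
apply: le_trans H _; rewrite lerD2l /c2 -[leRHS]mulrA ler_wpM2l ?(ltW k0)//.
set X := e `^ (p - 1); set Y := r `^ (- al); set Z := M `^ (p - 1); set W := d `^ (- al).
have XY : 0 <= X * Y by rewrite mulr_ge0 ?powR_ge0.
have ZW : 0 <= Z * W by rewrite mulr_ge0 ?powR_ge0.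
have [i1 i2] : 0 <= b * (Z * W) /\ 0 <= 2 `^ al * (X * Y) by split; rewrite mulr_ge0// ltW.
by move: XY ZW i1 i2; goal_lra.
Qed.

End halfspace_solutions.

Lemma powR_surj (R : realType) (q y : R) : 0 < q -> 0 < y ->
  exists2 t, 0 < t & t `^ q = y.
Proof.
move=> q0 y0; exists (y `^ q^-1); first exact: powR_gt0.
by rewrite -powRrM mulVf ?gt_eqF// powRr1// ltW.
Qed.

Lemma powRN_le (R : realType) (q x y : R) : 0 < q -> 0 < x -> x <= y ->
  y `^ (- q) <= x `^ (- q).
Proof.
move=> q0 x0 xy; have y0 := lt_le_trans x0 xy.
by rewrite !powRN lef_pV2 ?posrE ?powR_gt0//; apply: ler_powRl; rewrite // ltW.
Qed.

(** * Boundedness by mu and decay at the boundary *)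
Section upper_bounds.
Context (R : realType) (n : nat) (p al : R) (p2 : 2 <= p) (al0 : 0 < al) (alp : al < p).
Local Notation E := 'rV[R]_n.+1.
Local Notation pde_sol := (@pde_sol R n p al).
Implicit Types (F : R -> R) (u v : E -> R) (x y z : E).

Let q0 : 0 < p - 1. Proof. by move: p2 => ?; lra. Qed.
Ltac goal_lra := clear - n p al p2 al0 alp q0; lra.

(** At a near-supremum above [mu] the right-hand side is nonpositive, so
    [top_estimate] fails when the slab is high enough. *)
Lemma sol_le_saturation F u (mu : R) : 0 < mu -> (forall t, mu <= t -> F t <= 0) ->
  pde_sol F u -> forall x, u x <= mu.
Proof.
move=> mu0 Fneg solu.
have [c1 [c2 [c10 c20 top]]] := @top_estimate R n p al p2 al0 alp.
have [[_ [B uB]] _ _ u0 _] := solu.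
have [//|/existsNP[x1 /negP]] := pselect (forall x, u x <= mu).
rewrite -ltNge => mux1.
pose M := sup (range u).
have hs : has_sup (range u).
  split; first by exists (u x1), x1.
  by exists B => _ [x _ <-]; exact: le_trans (ler_norm _) (uB x).
have uM x : u x <= M by apply: sup_upper_bound => //; exists x.
have muM : mu < M by exact: lt_le_trans (uM x1).
have M0 : 0 < M by exact: lt_trans muM.
pose eta := c1 * (M / 2) `^ (p - 1) / (4 * c2).
have pM2 : 0 < (M / 2) `^ (p - 1) by rewrite powR_gt0// divr_gt0.
have eta0 : 0 < eta by rewrite divr_gt0 ?mulr_gt0.
have [th th0 thE] := powR_surj q0 eta0.
pose e := Num.min ((M - mu) / 2) th.
have e0 : 0 < e by rewrite lt_min th0 divr_gt0// subr_gt0.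
have eM : e <= (M - mu) / 2 by rewrite ge_min lexx.
have epow : e `^ (p - 1) <= eta.
  by rewrite -thE; apply: ler_powRl; rewrite ?(ltW q0) ?(ltW e0)// ge_min lexx orbT.
have [_ [x0 _ <-] ux0] : exists2 y, range u y & M - e < y by exact: sup_adherent.
have hx0 : 0 < ht x0.
  rewrite ltNge; apply/negP => /u0 h; rewrite h in ux0.
  by move: ux0 eM muM mu0; goal_lra.
pose r := ht x0 / 2.
have r0 : 0 < r by rewrite divr_gt0.
have [D D0 DE] : exists2 D, 0 < D & M `^ (p - 1) * D `^ (- al) <= e `^ (p - 1) * r `^ (- al).
  have pe0 : 0 < e `^ (p - 1) by rewrite powR_gt0.
  have y0 : 0 < M `^ (p - 1) / e `^ (p - 1) by rewrite divr_gt0 ?powR_gt0.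
  have [t t0 tE] := powR_surj al0 y0.
  exists (r * t); first exact: mulr_gt0.
  rewrite powRM ?(ltW r0) ?(ltW t0)// (powRN t) tE invf_div mulrCA.
  rewrite [X in _ <= X]mulrC ler_wpM2l ?powR_ge0// mulrC divfK// gt_eqF// powR_gt0//.
have [||||x [hx ux1 ux2 Hx]] := top F u M x0 r M e (Num.max (6 * r) D) solu uM r0 _ _ e0 _ _ (ltW ux0).
- by rewrite /r; field.
- by rewrite le_max lexx.
- by move: eM mu0 M0; goal_lra.
- by [].
have Fx : F (u x) <= 0 by apply: Fneg; move: ux1 eM muM; goal_lra.
have rp : 0 < r `^ (- al) by exact: powR_gt0.
have H1 : M `^ (p - 1) * Num.max (6 * r) D `^ (- al) <= e `^ (p - 1) * r `^ (- al).
  apply: le_trans DE; rewrite ler_wpM2l ?powR_ge0//.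
  by apply: powRN_le => //; rewrite le_max lexx orbT.
have H2 : (M / 2) `^ (p - 1) <= (M - e) `^ (p - 1).
  apply: ler_powRl; first exact: ltW.
    by rewrite divr_ge0// ltW.
  by move: eM mu0 M0; goal_lra.
have H3 : c1 * (M / 2) `^ (p - 1) * r `^ (- al) <= c2 * (eta * r `^ (- al) + eta * r `^ (- al)).
  apply: (@le_trans _ _ (c1 * (M - e) `^ (p - 1) * r `^ (- al))).
    by rewrite ler_wpM2r ?(ltW rp)// ler_wpM2l// ltW.
  apply: (le_trans Hx); rewrite -[leRHS]add0r lerD// ler_wpM2l ?(ltW c20)//.
  have h : e `^ (p - 1) * r `^ (- al) <= eta * r `^ (- al) by rewrite ler_wpM2r// ltW.
  by apply: lerD => //; exact: le_trans H1 h.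
have : c2 * (eta * r `^ (- al) + eta * r `^ (- al)) =
    c1 * (M / 2) `^ (p - 1) * r `^ (- al) / 2.
  by rewrite /eta; field; exact: lt0r_neq0.
have : 0 < c1 * (M / 2) `^ (p - 1) * r `^ (- al) by rewrite !mulr_gt0.
by move: H3; goal_lra.
Qed.

(** Apply [top_estimate] to the limit superior [th] of [u] at the boundary: if
    it were positive, the left-hand side would blow up like [r^-al] as [x0]
    approaches the boundary, whereas the nonlinearity stays bounded. *)
Lemma boundary_decay F u (M Fm : R) : pde_sol F u -> (forall x, u x <= M) ->
  (forall t, 0 <= t -> t <= M -> F t <= Fm) ->
  forall eta, 0 < eta -> exists2 d, 0 < d & forall x, eta <= u x -> d <= ht x.
Proof.
move=> solu uM FM eta eta0.
have [c1 [c2 [c10 c20 top]]] := @top_estimate R n p al p2 al0 alp.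
have u_ge0 x : 0 <= u x by exact: pde_sol_ge0 solu.
have M0 : 0 <= M by exact: le_trans (u_ge0 0) (uM 0).
apply: contrapT => nd.
have bad d : 0 < d -> exists2 x, eta <= u x & ht x < d.
  move=> d0; apply: contrapT => H; apply: nd; exists d => // x ux.
  by rewrite leNgt; apply/negP => xd; apply: H; exists x.
pose A d := [set u x | x in [set x | ht x < d]].
have hA d : 0 < d -> has_sup (A d).
  move=> /bad[x ux xd]; split; first by exists (u x), x.
  by exists M => _ [y _ <-].
pose T := [set sup (A d) | d in [set d | 0 < d]].
have lbT : lbound T eta.
  move=> _ [d /= d0 <-]; have [x ux xd] := bad d d0; apply: le_trans ux _.
  by apply: sup_upper_bound; [exact: hA|exists x].
have hT : has_inf T.
  by split; [exists (sup (A 1)), 1 => //=; exact: ltr01|exists eta].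
pose th := inf T.
have th_eta : eta <= th by apply: lb_le_inf => //; exact: hT.1.
pose K := c1 * (eta / 2) `^ (p - 1) / 2.
have pe2 : 0 < (eta / 2) `^ (p - 1) by rewrite powR_gt0// divr_gt0.
have K0 : 0 < K by rewrite divr_gt0 ?mulr_gt0.
have [t t0 tE] := powR_surj q0 (divr_gt0 K0 c20).
pose e := Num.min (eta / 2) t.
have e0 : 0 < e by rewrite lt_min t0 divr_gt0.
have ee : e <= eta / 2 by rewrite ge_min lexx.
have epow : c2 * e `^ (p - 1) <= K.
  rewrite mulrC -ler_pdivlMr// -tE; apply: ler_powRl; rewrite ?(ltW q0) ?(ltW e0)//.
  by rewrite ge_min lexx orbT.
have e20 : 0 < e / 2 by rewrite divr_gt0.
have [_ [d1 /= d10 <-] Sd1] := inf_adherent e20 hT.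
rewrite -/th in Sd1.
pose S := th + e / 2.
have uS x : ht x < d1 -> u x <= S.
  move=> xd; apply: le_trans (ltW Sd1).
  by apply: sup_upper_bound; [exact: hA|exists x].
pose K1 := `|Fm| + c2 * (M `^ (p - 1) * d1 `^ (- al)).
have K10 : 0 <= K1 by rewrite addr_ge0// !mulr_ge0 ?powR_ge0// ltW.
have y0 : 0 < K / (K1 + 1) by rewrite divr_gt0//; move: K10; goal_lra.
have [r1 r10 r1E] := powR_surj al0 y0.
pose dl := Num.min (d1 / 3) r1.
have dl0 : 0 < dl by rewrite lt_min r10 divr_gt0.
have [_ [x0 /= x0d <-] ux0] := sup_adherent e20 (hA dl dl0).
have ux0S : S - e <= u x0.
  have : th <= sup (A dl) by apply: inf_lbound; [exact: hT.2|exists dl].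
  by move: ux0; rewrite /S; goal_lra.
have Seta : eta / 2 <= S - e.
  by move: eta0 th_eta ee; rewrite /S; goal_lra.
have x0h : 0 < ht x0.
  rewrite ltNge; apply/negP => h; have [_ _ _ u0 _] := solu.
  by move: ux0S Seta eta0; rewrite (u0 _ h); goal_lra.
pose r := ht x0 / 2.
have r0 : 0 < r by rewrite divr_gt0.
have [|||x [hx ux1 ux2 Hx]] := top F u M x0 r S e d1 solu uM r0 _ _ e0 _ uS ux0S.
- by rewrite /r; field.
- have : dl <= d1 / 3 by rewrite ge_min lexx.
  by move: x0d; rewrite /r; goal_lra.
- by move: Seta eta0; goal_lra.
have rp : 0 < r `^ (- al) by exact: powR_gt0.
have rr : r <= r1.
  have : dl <= r1 by rewrite ge_min lexx orbT.
  by move: x0d; rewrite /r => h1 h2; move: h1 h2 x0h; goal_lra.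
have Kr : K1 + 1 <= K * r `^ (- al).
  rewrite mulrC -ler_pdivrMr//; apply: le_trans (powRN_le al0 r0 rr).
  by rewrite powRN r1E [leRHS]invf_div.
have H1 : 2 * K * r `^ (- al) <= c1 * (S - e) `^ (p - 1) * r `^ (- al).
  rewrite ler_wpM2r ?(ltW rp)//.
  rewrite (_ : 2 * K = c1 * (eta / 2) `^ (p - 1)); last by rewrite /K; field.
  rewrite ler_wpM2l ?(ltW c10)//; apply: ler_powRl => //; first exact: ltW.
  by rewrite divr_ge0// ltW.
have H2 : c2 * e `^ (p - 1) * r `^ (- al) <= K * r `^ (- al) by rewrite ler_wpM2r// ltW.
have H3 : F (u x) <= `|Fm| by apply: le_trans (FM _ _ _) (ler_norm _).
by move: H1 H2 H3 Kr Hx; rewrite /K1; goal_lra.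
Qed.

End upper_bounds.

(** * Barriers from below *)
Section lower_bounds.
Context (R : realType) (n : nat) (p al : R).
Ltac goal_lra := clear - n p al; lra.
Local Notation N := n.+1.
Local Notation E := 'rV[R]_n.+1.
Local Notation G := (spow p).
Local Notation pde_sol := (@pde_sol R n p al).
Implicit Types (F : R -> R) (u v : E -> R) (x y z : E).

Lemma bdd_meas0 : bdd_meas (fun _ : E => 0 : R).
Proof. by split=> //; exists 0 => z; rewrite normr0. Qed.

Lemma powR_p1 (t : R) : 2 <= p -> 0 <= t -> t `^ (p - 2) * t = t `^ (p - 1).
Proof. by move=> p2 t0; rewrite -spow_ge0E// /spow ger0_norm. Qed.

Lemma hump_touch_below u x0 x (r e : R) : 0 < r -> 0 <= e ->
  (forall y, e * hump 1 x0 r y <= u y) -> u x = e * hump 1 x0 r x ->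
  exists2 l, oddlin l (e * (4 * N%:R / r)) &
    forall z, u x - u (x + z) <= l z + e * (2 / r ^+ 2) * sqn z.
Proof.
move=> r0 e0 hu ux.
have [l ol lE] := @hump_touch R N 1 x0 r x r0 (lexx 1).
exists (fun z => e * l z); first exact: oddlinZ.
move=> z; have H1 := ler_wpM2l e0 (lE z); have H2 := hu (x + z).
by rewrite ux; move: H1 H2; goal_lra.
Qed.

(** At a point where a multiple of a hump touches [u] from below, everything
    is bounded by the amplitude and the radius of the hump. *)
Lemma touch_below : 2 <= p -> 0 < al -> al < p -> exists2 b, 0 < b &
  forall F u x0 x (r e : R), pde_sol F u -> 0 < r -> 0 < e -> 0 < ht x ->
  (forall y, e * hump 1 x0 r y <= u y) -> u x = e * hump 1 x0 r x ->
  F (u x) <= b * e `^ (p - 1) * r `^ (- al).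
Proof.
move=> p2 al0 alp; have [k k0 main] := @pv_paraboloid R N p al p2 al0 alp.
pose b := (4 * N%:R + 2) `^ (p - 2) * 2 : R.
have b0 : 0 <= b by rewrite mulr_ge0// powR_ge0.
exists (k * (b + 1)); first by rewrite mulr_gt0//; move: b0; goal_lra.
move=> F u x0 x r e solu r0 e0 xh hu ux.
have [bu _ _ _ pvu] := solu.
have u_ge0 y : 0 <= u y by exact: pde_sol_ge0 solu.
have [l ol lE] := hump_touch_below r0 (ltW e0) hu ux.
set L := e * _ in ol; set Q := e * _ in lE.
have L0 : 0 <= L by rewrite !mulr_ge0 ?invr_ge0// ltW.
have Q0 : 0 <= Q by rewrite !mulr_ge0 ?invr_ge0 ?exprn_ge0// ltW.
have ol0 : oddlin (fun _ : E => 0 : R) L by exact: oddlin_le (oddlin0 _ _).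
have uxe : u x <= e.
  by rewrite ux ler_piMr ?(ltW e0)//; exact: hump_le1.
have near1 z : enorm z < r -> 0 - Q * sqn z <= 0 - 0 :> R.
  by move=> _; rewrite sub0r subrr oppr_le0 mulr_ge0 ?sqn_ge0.
have near2 z : enorm z < r -> u x - u (x + z) <= l z + Q * sqn z by move=> _; exact: lE.
have farH z : r <= enorm z -> - e `^ (p - 1) - 0 * ((1 <= enorm z)%R)%:R +
   0 * \1_(cube (vert n (2 * r)) r) z <= G (0 - 0) - G (u x - u (x + z)).
  move=> _; rewrite !mul0r subr0 addr0 subrr spow0 sub0r lerN2 -spow_ge0E ?(ltW e0)//.
  by apply: spow_mono => //; move: (u_ge0 (x + z)) uxe; goal_lra.
have cubeH z : cube (vert n (2 * r)) r z -> r <= enorm z /\ enorm z <= N%:R * (`|2 * r| + r).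
  move=> zc; split; last by apply: cube_vert_enorm => //; exact: ltW.
  have [h _] := cube_vert zc; apply: le_trans (le_trans (ler_norm _) (ht_le_enorm z)).
  by move: h; goal_lra.
have := main _ _ _ _ _ _ _ _ _ _ _ _ _ _ _ _ _ _ bdd_meas0 bu (@pv_zero R N p al 0) (pvu _ xh) r0 ltr01 L0 Q0
  (powR_ge0 e (p - 1)) (lexx 0) (lexx 0) r0 ol0 ol near1 near2 farH cubeH.
have -> : L * r + Q * r ^+ 2 = (4 * N%:R + 2) * e.
  by rewrite /L /Q; field; exact: lt0r_neq0.
have -> : Q * r ^+ 2 = 2 * e.
  by rewrite /Q; field; exact: lt0r_neq0.
have NN : 0 <= 4 * N%:R + 2 :> R by rewrite addr_ge0// mulr_ge0.
have -> : ((4 * N%:R + 2) * e) `^ (p - 2) * (2 * e) = b * e `^ (p - 1).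
  by rewrite powRM ?(ltW e0)// -powR_p1// ?(ltW e0)// /b; ring.
rewrite !mul0r addr0 sub0r => H.
rewrite (_ : k * (b + 1) * _ * _ = k * ((b * e `^ (p - 1) + e `^ (p - 1)) * r `^ (- al))); last by ring.
by move: H; lra.
Qed.

(** A smooth bump is a strict subsolution where it is small: near the edge the
    integral over the cube at the centre of the ball, where the bump is at
    least one half, dominates. This takes the place of a first eigenfunction.
    *)
Lemma touch_below_edge : 2 <= p -> 0 < al -> al < p -> exists2 kap, 0 < kap &
  forall F u x0 x (r e : R), pde_sol F u -> 0 < r -> 0 < e -> 0 < ht x ->
  (forall y, e * hump 1 x0 r y <= u y) -> u x = e * hump 1 x0 r x ->
  cball x0 r x -> hump 1 x0 r x <= kap -> F (u x) <= 0.
Proof.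
move=> p2 al0 alp; have [k k0 main] := @pv_paraboloid R N p al p2 al0 alp.
have p1 : 0 < p - 1 by move: p2 => ?; lra.
have pal : 0 < p - al by move: alp => ?; lra.
pose b := (4 * N%:R + 2) `^ (p - 2) * 2 : R.
have NN : 0 < 4 * N%:R + 2 :> R by rewrite addr_gt0// mulr_gt0.
have b0 : 0 < b by rewrite mulr_gt0// powR_gt0.
pose c0 : R := 4^-1 `^ (p - 1) * ((2 * (4 * N%:R)^-1) ^+ N * 2 `^ (- (N%:R + al))).
have c00 : 0 < c0 by rewrite !mulr_gt0 ?powR_gt0 ?exprn_gt0 ?invr_gt0 ?mulr_gt0 ?invr_gt0 ?mulr_gt0.
have y0 : 0 < c0 / (4 * (k * b)) by rewrite divr_gt0// !mulr_gt0.
have [t t0 tE] := powR_surj pal y0.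
(* [q] is the relative radius of the region near the touching point, and [kap]
   the relative height below which the bump counts as small: first [q], then
   [kap] makes its loss at most a quarter of the gain [c0]. *)
pose q := Num.min 4^-1 t.
have q0 : 0 < q by rewrite lt_min t0 invr_gt0 ltr0n.
have q4 : q <= 4^-1 by rewrite ge_min lexx.
have qE : k * (b * q `^ (p - al)) <= c0 / 4.
  have qt : q `^ (p - al) <= t `^ (p - al).
    by apply: ler_powRl; rewrite ?(ltW pal) ?(ltW q0)// ge_min lexx orbT.
  apply: (@le_trans _ _ (k * (b * t `^ (p - al)))).
    by rewrite ler_wpM2l ?(ltW k0)// ler_wpM2l// ltW.
  by rewrite tE le_eqVlt; apply/orP; left; apply/eqP; field; rewrite !lt0r_neq0.
have y1 : 0 < c0 / (4 * (k * q `^ (- al))) by rewrite divr_gt0// !mulr_gt0// powR_gt0.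
have [t' t'0 t'E] := powR_surj p1 y1.
pose kap := Num.min 4^-1 t'.
have kap0 : 0 < kap by rewrite lt_min t'0 invr_gt0 ltr0n.
have kap4 : kap <= 4^-1 by rewrite ge_min lexx.
have kapE : k * (kap `^ (p - 1) * q `^ (- al)) <= c0 / 4.
  have kt : kap `^ (p - 1) <= t' `^ (p - 1).
    by apply: ler_powRl; rewrite ?(ltW p1) ?(ltW kap0)// ge_min lexx orbT.
  apply: (@le_trans _ _ (k * (t' `^ (p - 1) * q `^ (- al)))).
    by rewrite ler_wpM2l ?(ltW k0)// ler_wpM2r// powR_ge0.
  have qn : q `^ (- al) != 0 by rewrite gt_eqF// powR_gt0.
  by rewrite t'E le_eqVlt; apply/orP; left; apply/eqP; field; rewrite qn lt0r_neq0.
exists kap => // F u x0 x r e solu r0 e0 xh hu ux Kx hx.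
have [bu _ _ _ pvu] := solu.
have u_ge0 y : 0 <= u y by exact: pde_sol_ge0 solu.
have [l ol lE] := hump_touch_below r0 (ltW e0) hu ux.
set L := e * _ in ol; set Q := e * _ in lE.
have L0 : 0 <= L by rewrite !mulr_ge0 ?invr_ge0// ltW.
have Q0 : 0 <= Q by rewrite !mulr_ge0 ?invr_ge0 ?exprn_ge0// ltW.
have ol0 : oddlin (fun _ : E => 0 : R) L by exact: oddlin_le (oddlin0 _ _).
have uxe : u x <= e * kap by rewrite ux ler_wpM2l// ltW.
pose rho := q * r.
have rho0 : 0 < rho by exact: mulr_gt0.
pose w := (4 * N%:R)^-1 * r.
have N1 : 1 <= N%:R :> R by rewrite ler1n.
have N40 : 0 < (4 * N%:R)^-1 :> R by rewrite invr_gt0 mulr_gt0.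
have w0 : 0 < w by exact: mulr_gt0.
have r20 : 0 < r ^+ 2 by exact: exprn_gt0.
have cubeS z : cube (x0 - x) w z -> sqn (x + z - x0) <= r ^+ 2 / 16.
  move=> /cubeP zc; apply: (@le_trans _ _ (N%:R * w ^+ 2)).
    apply: sqn_coord_le => i; have := zc i; rewrite !mxE.
    by congr (`|_| <= _); ring.
  have -> : N%:R * w ^+ 2 = r ^+ 2 / 16 * N%:R^-1.
    by rewrite /w; field.
  by rewrite ler_piMr// ?invf_le1// divr_ge0// ltW.
have xr : r ^+ 2 / 2 <= sqn (x - x0).
  rewrite leNgt; apply/negP => h.
  have t2 : 2^-1 < 1 - sqn (x - x0) / r ^+ 2.
    suff : sqn (x - x0) / r ^+ 2 < 2^-1 by goal_lra.
    by rewrite ltr_pdivrMr// mulrC.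
  have : hump 1 x0 r x <= 4^-1 by exact: le_trans kap4.
  rewrite /hump pos_sqrE; last by move: t2; goal_lra.
  by move: t2; clear; nra.
have cubeH z : cube (x0 - x) w z -> rho <= enorm z /\ enorm z <= 2 * r.
  move=> /cubeS zs.
  have h1 : sqn (x - x0) <= 2 * sqn (x + z - x0) + 2 * sqn z.
    have -> : x - x0 = (x + z - x0) + (- z) by rewrite addrAC addrK.
    by apply: le_trans (sqnD_le _ _) _; rewrite sqnN.
  have h2 : sqn z <= 2 * sqn (x + z - x0) + 2 * sqn (x - x0).
    have e1 : z = (x + z - x0) + (- (x - x0)).
      by rewrite opprB addrA subrK addrAC subrr add0r.
    by rewrite {1}e1; apply: le_trans (sqnD_le _ _) _; rewrite sqnN.
  have h3 : sqn (x - x0) <= r ^+ 2 by [].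
  split.
    apply: (@le_trans _ _ (4^-1 * r)); first by rewrite ler_wpM2r// ltW.
    rewrite leNgt sqn_lt; last by rewrite mulr_ge0// ltW.
    rewrite -leNgt exprMn (_ : 4^-1 ^+ 2 = 16^-1); last by field.
    by move: h1 zs xr r20; goal_lra.
  rewrite sqn_le; last by rewrite mulr_ge0// ltW.
  rewrite exprMn (_ : 2 ^+ 2 = 4); last by ring.
  by move: h2 zs h3 r20; goal_lra.
have near1 z : enorm z < rho -> 0 - Q * sqn z <= 0 - 0 :> R.
  by move=> _; rewrite sub0r subrr oppr_le0 mulr_ge0 ?sqn_ge0.
have near2 z : enorm z < rho -> u x - u (x + z) <= l z + Q * sqn z by move=> _; exact: lE.
have farH z : rho <= enorm z -> - (e * kap) `^ (p - 1) - 0 * ((1 <= enorm z)%R)%:R +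
   (e * 4^-1) `^ (p - 1) * \1_(cube (x0 - x) w) z <= G (0 - 0) - G (u x - u (x + z)).
  move=> _; rewrite mul0r subr0 subrr spow0 sub0r.
  have ek0 : 0 <= e * kap by rewrite mulr_ge0// ltW.
  have e40 : 0 <= e * 4^-1 by rewrite mulr_ge0// ltW.
  rewrite indicE; have [/set_mem/cubeS zc|_] := boolP (z \in _); last first.
    rewrite mulr0 addr0 lerN2 -spow_ge0E//; apply: spow_mono => //.
    by move: (u_ge0 (x + z)) uxe; goal_lra.
  rewrite mulr1 -!spow_ge0E// -[X in X <= _]addrC.
  have hz : e / 2 <= u (x + z).
    apply: le_trans (hu _); rewrite ler_wpM2l ?(ltW e0)//.
    have hh : sqn (x + z - x0) / r ^+ 2 <= 16^-1.
      by rewrite ler_pdivrMr// mulrC.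
    rewrite /hump pos_sqrE; last by move: hh; goal_lra.
    by move: hh; clear; nra.
  have g1 : G (e * 4^-1) <= - G (u x - u (x + z)).
    rewrite -spowN; apply: spow_mono => //.
    have ke : e * kap <= e * 4^-1 by rewrite ler_wpM2l// ltW.
    by move: hz uxe ke; goal_lra.
  have g2 : 0 <= G (e * kap) by exact: spow_ge0.
  by move: g1 g2; goal_lra.
have := main _ _ _ _ _ _ _ _ _ _ _ _ _ _ _ _ _ _ bdd_meas0 bu (@pv_zero R N p al 0) (pvu _ xh) rho0 ltr01 L0 Q0
  (powR_ge0 (e * kap) (p - 1)) (lexx 0) (powR_ge0 (e * 4^-1) (p - 1)) w0 ol0 ol near1 near2 farH cubeH.
set P := e `^ (p - 1) * r `^ (- al).
have P0 : 0 < P by rewrite mulr_gt0// powR_gt0.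
have -> : (e * 4^-1) `^ (p - 1) * ((2 * w) ^+ N * (2 * r) `^ (- (N%:R + al))) = c0 * P.
  rewrite /w mulrA cube_scale//.
  by rewrite powRM ?(ltW e0)// /c0 /P; ring.
have qr : rho `^ (- al) = q `^ (- al) * r `^ (- al) by rewrite powRM// ltW.
have H1 : (e * kap) `^ (p - 1) * rho `^ (- al) = kap `^ (p - 1) * q `^ (- al) * P.
  by rewrite qr powRM ?(ltW e0) ?(ltW kap0)// /P; ring.
have H2 : (L * rho + Q * rho ^+ 2) `^ (p - 2) * (Q * rho ^+ 2) * rho `^ (- al) <=
    b * q `^ (p - al) * P.
  have -> : Q * rho ^+ 2 = 2 * e * q ^+ 2.
    by rewrite /Q /rho; field; exact: lt0r_neq0.
  have h : (L * rho + 2 * e * q ^+ 2) `^ (p - 2) <= ((4 * N%:R + 2) * e * q) `^ (p - 2).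
    apply: ler_powRl; first by rewrite subr_ge0.
      apply: addr_ge0; first by rewrite mulr_ge0 ?(ltW rho0).
      by apply: mulr_ge0; [apply: mulr_ge0 => //; exact: ltW|rewrite exprn_ge0 ?(ltW q0)].
    rewrite (_ : L * rho = 4 * N%:R * e * q); last first.
      by rewrite /L /rho; field; exact: lt0r_neq0.
    have eq1 : e * q * q <= e * q * 1.
      apply: ler_wpM2l; first by rewrite mulr_ge0// ltW.
      by move: q4; goal_lra.
    by move: eq1; rewrite expr2; goal_lra.
  apply: (@le_trans _ _ (((4 * N%:R + 2) * e * q) `^ (p - 2) * (2 * e * q ^+ 2) * rho `^ (- al))).
    rewrite ler_wpM2r ?powR_ge0// ler_wpM2r// !mulr_ge0 ?exprn_ge0 ?(ltW e0) ?(ltW q0)//.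
  rewrite le_eqVlt; apply/orP; left; apply/eqP.
  rewrite qr !powRM ?mulr_ge0 ?(ltW e0) ?(ltW q0) ?(ltW NN)//.
  rewrite (powRD (x := q) (r := p) (s := - al)); last by apply/implyP => _; rewrite gt_eqF.
  by rewrite -(powR_sub2 p2 (ltW q0)) /P -(powR_p1 p2 (ltW e0)) /b; ring.
move=> H.
have H3 : k * (b * q `^ (p - al) * P) <= c0 / 4 * P.
  by have := ler_wpM2r (ltW P0) qE; rewrite !mulrA.
have H4 : k * (kap `^ (p - 1) * q `^ (- al) * P) <= c0 / 4 * P.
  by have := ler_wpM2r (ltW P0) kapE; rewrite !mulrA.
rewrite mulrDl H1 mul0r addr0 sub0r in H.
have H5 := ler_wpM2l (ltW k0) H2.
have H6 : 0 < c0 * P by exact: mulr_gt0.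
by move: H H3 H4 H5 H6; goal_lra.
Qed.

(** Touch [u] from below with the largest admissible multiple [e] of the hump,
    found by maximising the quotient of the hump by [u]. If [e < m], the
    touching point is not near the edge of the ball by [touch_below_edge], so
    there [F (u x) >= c * e * kap], which contradicts [touch_below] once the
    radius is large. The radius depends on neither the centre nor [e]. *)
Lemma bubble_below : 2 <= p -> 0 < al -> al < p ->
  forall F u (m c : R), pde_sol F u -> 0 < m -> 0 < c ->
  (forall t, 0 < t -> t <= m -> c * t <= F t) ->
  exists2 r, 0 < r & forall x0, r < ht x0 -> forall x, m * hump 1 x0 r x <= u x.
Proof.
move=> p2 al0 alp F u m c solu m0 c0 Fc.
have [b b0 touch] := touch_below p2 al0 alp.
have [kap kap0 edge] := touch_below_edge p2 al0 alp.
have [bu cu upos u0 pvu] := solu.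
have y0 : 0 < 2 * (b * m `^ (p - 2)) / (c * kap).
  by rewrite divr_gt0 ?mulr_gt0// powR_gt0.
have [r r0 rE] := powR_surj al0 y0.
exists r => // x0 rx0.
have Kpos x : cball x0 r x -> 0 < ht x.
  by move=> /(cball_ht (ltW r0))[h _]; move: h rx0; goal_lra.
have Kx0 : cball x0 r x0 by rewrite /cball/= subrr sqn0 exprn_ge0// ltW.
have [x Kx xmax] : exists2 x, cball x0 r x & forall y, cball x0 r y ->
    hump 1 x0 r y / u y <= hump 1 x0 r x / u x.
  apply: compact_max; first by apply: compact_cball; exact: ltW.
    by exists x0.
  move=> x /Kpos hx; apply: continuousM; first exact: continuous_hump.
  by apply: continuousV; [rewrite gt_eqF// upos|exact: cu].
have hx := Kpos _ Kx; have ux := upos _ hx.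
have hump0 : 0 < hump 1 x0 r x.
  have : 0 < hump 1 x0 r x / u x.
    apply: lt_le_trans (xmax _ Kx0).
    by rewrite hump_center pos_sqrE// expr1n div1r invr_gt0; exact/upos/Kpos.
  by rewrite pmulr_lgt0// invr_gt0.
pose e := u x / hump 1 x0 r x.
have e0 : 0 < e by exact: divr_gt0.
have uxe : u x = e * hump 1 x0 r x by rewrite /e divfK// gt_eqF.
have ue y : e * hump 1 x0 r y <= u y.
  have [Ky|Ky] := pselect (cball x0 r y); last first.
    rewrite hump_out//; last by rewrite leNgt; apply/negP => /ltW.
    by rewrite mulr0; exact: pde_sol_ge0 solu.
  have uy := upos _ (Kpos _ Ky).
  have := xmax _ Ky; rewrite ler_pdivrMr// => h.
  rewrite /e mulrC mulrA ler_pdivrMr//.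
  have := ler_wpM2r (ltW ux) h.
  by rewrite [X in _ <= X -> _]mulrAC divfK ?gt_eqF// [X in _ <= X -> _]mulrC.
have [me|em] := leP m e.
  by move=> y; apply: le_trans (ue y); rewrite ler_wpM2r// hump_ge0.
have uxm : u x <= m.
  apply: (le_trans _ (ltW em)); rewrite uxe ler_piMr ?(ltW e0)//.
  exact: hump_le1.
have Fx := Fc _ ux uxm.
exfalso.
have [hk|hk] := leP (hump 1 x0 r x) kap.
  have := edge F u x0 x r e solu r0 e0 hx ue uxe Kx hk.
  by rewrite leNgt (lt_le_trans _ Fx)// mulr_gt0.
have T := touch F u x0 x r e solu r0 e0 hx ue uxe.
have h1 : c * (e * kap) <= b * e `^ (p - 1) * r `^ (- al).
  apply: le_trans T; apply: le_trans Fx.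
  by rewrite ler_wpM2l ?(ltW c0)// uxe ler_wpM2l// ltW.
have h2 : b * e `^ (p - 1) * r `^ (- al) <= b * m `^ (p - 2) * e * r `^ (- al).
  rewrite ler_wpM2r ?powR_ge0// -(powR_p1 p2 (ltW e0)) mulrA ler_wpM2r ?(ltW e0)//.
  rewrite ler_wpM2l ?(ltW b0)//; apply: ler_powRl; rewrite ?(ltW e0) ?(ltW em)//.
  by move: p2 => ?; lra.
have h3 : b * m `^ (p - 2) * e * r `^ (- al) = c * (e * kap) / 2.
  rewrite powRN rE; field.
  by rewrite !lt0r_neq0// powR_gt0.
have : 0 < c * (e * kap) by rewrite mulr_gt0// mulr_gt0.
by move: h1 h2; rewrite h3; goal_lra.
Qed.

End lower_bounds.

(** * Humps and penalties in two variables *)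
Section doubling.
Context (R : realType) (n : nat) (p al : R).
Ltac goal_lra := clear - n p al; lra.
Local Notation N := n.+1.
Local Notation E := 'rV[R]_n.+1.
Local Notation G := (spow p).
Local Notation pde_sol := (@pde_sol R n p al).
Implicit Types (F : R -> R) (u v : E -> R) (x y z : E).

Definition joint_hump x0 y0 (r : R) (q : E * E) : R :=
  pos_sqr (1 - (sqn (q.1 - x0) + sqn (q.2 - y0)) / r ^+ 2).

Lemma joint_hump_left x0 y0 r x y :
  joint_hump x0 y0 r (x, y) = hump (1 - sqn (y - y0) / r ^+ 2) x0 r x.
Proof. by rewrite /joint_hump /hump /=; congr pos_sqr; ring. Qed.

Lemma joint_hump_right x0 y0 r x y :
  joint_hump x0 y0 r (x, y) = hump (1 - sqn (x - x0) / r ^+ 2) y0 r y.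
Proof. by rewrite /joint_hump /hump /=; congr pos_sqr; ring. Qed.

Lemma hump_height_le1 (y : E) (r : R) : 1 - sqn y / r ^+ 2 <= 1.
Proof. by rewrite gerBl divr_ge0 ?sqn_ge0 ?sqr_ge0. Qed.

Lemma joint_hump_le1 x0 y0 r q : joint_hump x0 y0 r q <= 1.
Proof. case: q => x y; rewrite joint_hump_left; exact/hump_le1/hump_height_le1. Qed.

Lemma joint_hump_out x0 y0 r q : 0 < r ->
  ~ (cball x0 r q.1 /\ cball y0 r q.2) -> joint_hump x0 y0 r q = 0.
Proof.
case: q => x y r0 /=; rewrite /cball/= => /not_andP[|] /negP; rewrite -ltNge => /ltW h.
  by rewrite joint_hump_left hump_out// hump_height_le1.
by rewrite joint_hump_right hump_out// hump_height_le1.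
Qed.

Lemma joint_hump_center x0 y0 r : joint_hump x0 y0 r (x0, y0) = 1.
Proof. by rewrite /joint_hump /= !subrr !sqn0 addr0 mul0r subr0 pos_sqrE// expr1n. Qed.

Lemma continuous_fst (q : E * E) : {for q, continuous (fun q : E * E => q.1)}.
Proof. exact: cvg_fst. Qed.

Lemma continuous_snd (q : E * E) : {for q, continuous (fun q : E * E => q.2)}.
Proof. exact: cvg_snd. Qed.

Lemma continuous_joint_hump x0 y0 r : continuous (joint_hump x0 y0 r).
Proof.
move=> q; apply: (@continuous_comp _ _ _
  (fun q : E * E => 1 - (sqn (q.1 - x0) + sqn (q.2 - y0)) / r ^+ 2) (@pos_sqr R)); last first.
  exact: continuous_pos_sqr.
apply: continuousB; first exact: cst_continuous.
apply: continuousM; last exact: cst_continuous.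
apply: continuousD.
  apply: (@continuous_comp _ _ _ (fun q : E * E => q.1) (fun x => sqn (x - x0))).
    exact: continuous_fst.
  exact: continuous_sqnB.
apply: (@continuous_comp _ _ _ (fun q : E * E => q.2) (fun x => sqn (x - y0))).
  exact: continuous_snd.
exact: continuous_sqnB.
Qed.

(** A smooth penalty on the height difference of two points: zero for
    differences above [tau], at least 1 below [tau - dl]. *)
Definition shift_penalty (tau dl : R) (q : E * E) : R := pos_sqr ((tau - (ht q.2 - ht q.1)) / dl).

Lemma continuous_ht : continuous (@ht R n).
Proof. exact: continuous_coord. Qed.

Lemma continuous_shift_penalty tau dl : continuous (shift_penalty tau dl).
Proof.
move=> q; apply: (@continuous_comp _ _ _
  (fun q : E * E => (tau - (ht q.2 - ht q.1)) / dl) (@pos_sqr R)); last exact: continuous_pos_sqr.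
apply: continuousM; last exact: cst_continuous.
apply: continuousB; first exact: cst_continuous.
apply: continuousB.
  apply: (@continuous_comp _ _ _ (fun q : E * E => q.2) (@ht R n)).
    exact: continuous_snd.
  exact: continuous_ht.
apply: (@continuous_comp _ _ _ (fun q : E * E => q.1) (@ht R n)).
  exact: continuous_fst.
exact: continuous_ht.
Qed.

Lemma shift_penalty_out tau dl q : 0 < dl -> tau <= ht q.2 - ht q.1 -> shift_penalty tau dl q = 0.
Proof.
move=> d0 h; apply: pos_sqr_eq0; rewrite pmulr_lle0 ?invr_gt0//.
by move: h; goal_lra.
Qed.

Lemma shift_penalty_ge1 tau dl q : 0 < dl -> ht q.2 - ht q.1 <= tau - dl -> 1 <= shift_penalty tau dl q.
Proof.
move=> d0 h; have h1 : 1 <= (tau - (ht q.2 - ht q.1)) / dl.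
  by rewrite ler_pdivlMr// mul1r; move: h; goal_lra.
rewrite /shift_penalty pos_sqrE; last exact: le_trans h1.
by rewrite expr2; move: h1; clear; nra.
Qed.

(** Moving one of the points changes the penalty by the same linear term with
    opposite signs, up to a quadratic error. *)
Lemma shift_penalty_touch tau dl x y : 0 < dl -> tau - dl <= ht y - ht x ->
  exists2 m, 0 <= m /\ m <= 1 & forall z,
  shift_penalty tau dl (x + z, y) <= shift_penalty tau dl (x, y) + 2 * m / dl * ht z + (dl ^+ 2)^-1 * sqn z /\
  shift_penalty tau dl (x, y + z) <= shift_penalty tau dl (x, y) - 2 * m / dl * ht z + (dl ^+ 2)^-1 * sqn z.
Proof.
move=> d0 h; pose t := (tau - (ht y - ht x)) / dl.
exists (Num.max t 0).
  split; first by rewrite le_max lexx orbT.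
  rewrite ge_max ler01 andbT ler_pdivrMr// mul1r.
  by move: h; goal_lra.
move=> z; have hz : ht z ^+ 2 <= sqn z.
  by rewrite /sqn (bigD1 ord_max)//= lerDl sumr_ge0// => i _; exact: sqr_ge0.
have hz2 : (ht z / dl) ^+ 2 <= (dl ^+ 2)^-1 * sqn z.
  by rewrite exprMn exprVn mulrC ler_wpM2l// invr_ge0 sqr_ge0.
have H1 := pos_sqrD_le t (ht z / dl); have H2 := pos_sqrD_le t (- (ht z / dl)).
rewrite sqrrN in H2.
split; rewrite /shift_penalty /= htD.
  rewrite (_ : _ / dl = t + ht z / dl); last by rewrite /t; ring.
  rewrite -/t (_ : 2 * _ / dl * ht z = 2 * Num.max t 0 * (ht z / dl)); last by ring.
  by move: H1 hz2; goal_lra.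
rewrite (_ : _ / dl = t - ht z / dl); last by rewrite /t; ring.
rewrite -/t (_ : 2 * _ / dl * ht z = 2 * Num.max t 0 * (ht z / dl)); last by ring.
by move: H2 hz2; goal_lra.
Qed.

End doubling.

(** * The doubling inequality *)
Section doubling_theorem.
Context (R : realType) (n : nat) (p al : R).
Ltac goal_lra := clear - n p al; lra.
Local Notation N := n.+1.
Local Notation E := 'rV[R]_n.+1.
Local Notation G := (spow p).
Local Notation pde_sol := (@pde_sol R n p al).
Implicit Types (F : R -> R) (u v : E -> R) (x y z : E).

(** Doubling the variables allows translations in all directions at once. The
    height difference is penalised by [shift_penalty] rather than constrained,
    so that moving a single variable is allowed and both functions are touched
    by paraboloids; the hump turns an approximate supremum into a maximum. The
    decay hypothesis on [u] keeps the near-maximum away from the boundary. *)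
Lemma perturbed_max u v (mu tau dl d h e : R) :
  (forall x, 0 < ht x -> {for x, continuous u}) ->
  (forall x, 0 < ht x -> {for x, continuous v}) ->
  (forall x, 0 <= u x /\ u x <= mu) -> (forall x, 0 <= v x /\ v x <= mu) ->
  0 < dl -> dl <= tau -> 0 < d -> (forall x, h / 4 <= u x -> d <= ht x) ->
  0 < e -> e <= h / 2 ->
  (exists x1 y1, tau <= ht y1 - ht x1 /\ h <= u x1 - v y1) ->
  let Phi q := u q.1 - v q.2 - (mu + 1) * shift_penalty tau dl q in
  exists x0 y0 x y, [/\ 0 < ht x /\ tau - dl <= ht y - ht x,
    h / 2 <= u x - v y,
    forall q, Phi q <= Phi (x, y) + e / 2 &
    forall q, Phi q + e * joint_hump x0 y0 (d / 2) q <= Phi (x, y) + e * joint_hump x0 y0 (d / 2) (x, y)].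
Proof.
move=> cu cv u01 v01 dl0 dltau d0 ud e0 eh [x1 [y1 [xy1 hxy1]]] Phi.
have mu0 : 0 <= mu by have [h1 h2] := u01 0; exact: le_trans h2.
have shift_penalty_ge0 q : 0 <= shift_penalty tau dl q by exact: pos_sqr_ge0.
have m10 : 0 <= mu + 1 by rewrite addr_ge0.
have PhiH q : Phi q <= u q.1 - v q.2.
  by rewrite /Phi lerBlDr lerDl mulr_ge0.
have Phimu q : Phi q <= mu.
  apply: le_trans (PhiH q) _; have [[_ h1] [h2 _]] := (u01 q.1, v01 q.2).
  by move: h1 h2; goal_lra.
have hs : has_sup (range Phi).
  by split; [exists (Phi (0, 0)), (0, 0)|exists mu => _ [q _ <-]].
pose S := sup (range Phi).
have PS q : Phi q <= S by apply: sup_upper_bound => //; exists q.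
have hS : h <= S.
  apply: le_trans (PS (x1, y1)); rewrite /Phi shift_penalty_out//= mulr0 subr0//.
have e20 : 0 < e / 2 by rewrite divr_gt0.
have Phi_pos q : 0 < Phi q -> tau - dl <= ht q.2 - ht q.1.
  move=> P0; rewrite leNgt; apply/negP => /ltW /(shift_penalty_ge1 dl0) t1.
  have : mu + 1 <= (mu + 1) * shift_penalty tau dl q by rewrite ler_peMr.
  have [[_ h1] [h2 _]] := (u01 q.1, v01 q.2).
  by move: P0 h1 h2; rewrite /Phi; lra.
have [_ [[x0 y0] _ <-] P0] := sup_adherent e20 hs.
rewrite -/S in P0.
have P0h : h / 2 < Phi (x0, y0) by move: P0 hS eh e0; goal_lra.
have h0 : 0 < h by move: eh e0; goal_lra.
have x0d : d <= ht x0.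
  apply: ud; have := PhiH (x0, y0); have [_ [h2 _]] := (u01 x0, v01 y0).
  by move: P0h h2 h0 => /=; goal_lra.
have y0d : d <= ht y0.
  have := Phi_pos (x0, y0) (lt_trans _ P0h); rewrite divr_gt0// => /(_ isT) /=.
  by move: dltau x0d; goal_lra.
pose r := d / 2.
have r0 : 0 < r by rewrite divr_gt0.
pose J := joint_hump x0 y0 r.
have ballpos a b : d <= ht a -> cball a r b -> 0 < ht b.
  by move=> ad /(cball_ht (ltW r0))[h1 _]; move: h1 ad d0; rewrite /r; goal_lra.
have ballc a : cball a r a by rewrite /cball/= subrr sqn0 exprn_ge0// ltW.
have [[x y] [/= Kx Ky] xymax] : exists2 q : E * E, (cball x0 r `*` cball y0 r) q &
   forall q', (cball x0 r `*` cball y0 r) q' -> Phi q' + e * J q' <= Phi q + e * J q.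
  apply: compact_max.
  - by apply: compact_setX; apply: compact_cball; exact: ltW.
  - by exists (x0, y0); split; exact: ballc.
  move=> [a b] [/= Ka Kb]; apply: continuousD; last first.
    by apply: continuousM; [exact: cst_continuous|exact: continuous_joint_hump].
  apply: continuousB; last first.
    by apply: continuousM; [exact: cst_continuous|exact: continuous_shift_penalty].
  apply: continuousB.
    apply: (@continuous_comp _ _ _ (fun q : E * E => q.1) u); first exact: continuous_fst.
    by apply: cu; exact: ballpos Ka.
  apply: (@continuous_comp _ _ _ (fun q : E * E => q.2) v); first exact: continuous_snd.
  by apply: cv; exact: ballpos Kb.
have xyS : S + e / 2 <= Phi (x, y) + e * J (x, y).
  apply: le_trans (xymax (x0, y0) _); last by split; exact: ballc.
  by rewrite /J joint_hump_center mulr1; move: P0; goal_lra.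
have J1 : e * J (x, y) <= e by rewrite ler_piMr ?(ltW e0)//; exact: joint_hump_le1.
have Pxy : S - e / 2 <= Phi (x, y) by move: xyS J1; goal_lra.
have Pxyh : h / 2 < Phi (x, y) by move: Pxy hS eh e0 h0; goal_lra.
exists x0, y0, x, y; split.
- split; first by apply: ballpos Kx.
  by apply: (Phi_pos (x, y)); apply: lt_trans Pxyh; rewrite divr_gt0.
- exact: le_trans (ltW Pxyh) (PhiH (x, y)).
- by move=> q; move: (PS q) Pxy; goal_lra.
move=> q; have [Kq|Kq] := pselect ((cball x0 r `*` cball y0 r) q); first exact: xymax.
rewrite (joint_hump_out r0 Kq) mulr0 addr0; apply: le_trans (PS q) _.
by move: xyS e0; rewrite /J; goal_lra.
Qed.

(** The opening of the paraboloids depends on the penalty and on the distance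
    to the boundary only, so [rho] and then the amplitude [e] of the hump can
    be chosen such that all errors are below [kap]. Translating both variables
    by the same [z] leaves the penalty unchanged: hence the increments of [u]
    and [v] are ordered up to [e] outside the ball of radius [rho], which
    costs little there and leaves the gain on the cube [c]. *)
Lemma doubling : 2 <= p -> 0 < al -> al < p ->
  forall F u v (mu tau sg h kap : R), pde_sol F u -> pde_sol F v -> 0 < mu ->
  (forall x, u x <= mu) -> (forall x, v x <= mu) ->
  (forall eta, 0 < eta -> exists2 d, 0 < d & forall x, eta <= u x -> d <= ht x) ->
  0 <= sg -> sg < tau -> 0 < h -> 0 < kap ->
  (exists x1 y1, tau <= ht y1 - ht x1 /\ h <= u x1 - v y1) ->
  exists x y, [/\ 0 < ht x, sg <= ht y - ht x, h / 2 <= u x - v y &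
    forall c (w g T : R), 0 < w -> 0 <= g ->
    (forall z, cube c w z -> kap <= enorm z /\ enorm z <= T) ->
    (forall z, cube c w z -> u (x + z) - v (y + z) + g <= u x - v y) ->
    (g / 2) `^ (p - 1) * ((2 * w) ^+ N * T `^ (- (N%:R + al))) <=
      F (u x) - F (v y) + kap].
Proof.
move=> p2 al0 alp F u v mu tau sg h kap solu solv mu0 umu vmu decay sg0 sgtau h0 kap0 ex.
have [k k0 main] := @pv_paraboloid R N p al p2 al0 alp.
have [ka ka0 lip] := @spow_lipschitz R p p2.
have pal : 0 < p - al by move: alp => ?; lra.
have p20 : 0 <= p - 2 by move: p2 => ?; lra.
have [bu cu _ _ pvu] := solu.
have [bv cv _ _ pvv] := solv.
have u_ge0 x : 0 <= u x by exact: pde_sol_ge0 solu.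
have v_ge0 x : 0 <= v x by exact: pde_sol_ge0 solv.
have [d d0 ud] := decay (h / 4) ltac:(by rewrite divr_gt0).
pose r := d / 2.
have r0 : 0 < r by rewrite divr_gt0.
pose dl := tau - sg.
have dl0 : 0 < dl by rewrite subr_gt0.
have dltau : dl <= tau by rewrite gerBl.
pose B0 := mu + 1.
have B00 : 0 < B0 by rewrite addr_gt0.
have N0 : 0 < N%:R :> R by rewrite ltr0n.
pose L := B0 * (2 / dl) + 4 * N%:R / r.
pose Q := B0 * (dl ^+ 2)^-1 + 2 / r ^+ 2.
have L0 : 0 < L by apply: addr_gt0; [rewrite mulr_gt0 ?divr_gt0|rewrite divr_gt0 ?mulr_gt0].
have Q0 : 0 < Q by apply: addr_gt0; [rewrite mulr_gt0 ?invr_gt0 ?exprn_gt0|rewrite divr_gt0 ?exprn_gt0].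
have LQ0 : 0 < (L + Q) `^ (p - 2) by rewrite powR_gt0// addr_gt0.
have y0 : 0 < kap / (2 * (k * ((L + Q) `^ (p - 2) * Q))) by rewrite divr_gt0// !mulr_gt0.
have [t t0 tE] := powR_surj pal y0.
pose rho := Num.min (Num.min kap 1) t.
have rho0 : 0 < rho by rewrite !lt_min kap0 ltr01 t0.
have rho1 : rho <= 1 by rewrite !ge_min lexx orbT.
have rhok : rho <= kap by rewrite !ge_min lexx.
have rhoE : k * ((L + Q) `^ (p - 2) * Q * rho `^ (p - al)) <= kap / 2.
  have ht : rho `^ (p - al) <= t `^ (p - al).
    by apply: ler_powRl; rewrite ?(ltW pal) ?(ltW rho0)// ge_min lexx orbT.
  apply: (@le_trans _ _ (k * ((L + Q) `^ (p - 2) * Q * t `^ (p - al)))).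
    by rewrite ler_wpM2l ?(ltW k0)// ler_wpM2l// ltW// mulr_gt0.
  by rewrite tE le_eqVlt; apply/orP; left; apply/eqP; field; rewrite !lt0r_neq0.
have rr0 : 0 < rho `^ (- al) by exact: powR_gt0.
have mup : 0 < mu `^ (p - 2) by exact: powR_gt0.
pose C1 := ka * mu `^ (p - 2).
have C10 : 0 < C1 by exact: mulr_gt0.
pose e := Num.min (Num.min 1 (h / 2)) (kap / (2 * (k * (C1 * rho `^ (- al))))).
have e0 : 0 < e by rewrite !lt_min ltr01 !divr_gt0// !mulr_gt0.
have e1 : e <= 1 by rewrite !ge_min lexx.
have eh : e <= h / 2 by rewrite !ge_min lexx orbT.
have eE : k * (C1 * e * rho `^ (- al)) <= kap / 2.
  have ee : e <= kap / (2 * (k * (C1 * rho `^ (- al)))) by rewrite !ge_min lexx orbT.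
  rewrite ler_pdivlMr in ee; last by rewrite !mulr_gt0.
  by move: ee; goal_lra.
have u01 x : 0 <= u x /\ u x <= mu by [].
have v01 x : 0 <= v x /\ v x <= mu by [].
have [x0 [y1 [x [y [[xh xy] hxy PhiS PhiJ]]]]] :=
  perturbed_max cu cv u01 v01 dl0 dltau d0 ud e0 eh ex.
have yh : 0 < ht y by move: xh xy sg0; rewrite /dl; goal_lra.
have sgxy : sg <= ht y - ht x by move: xy; rewrite /dl; goal_lra.
exists x, y; split=> // c w g T w0 g0 cubeH gH.
have [m [m0 m1] tl] := shift_penalty_touch dl0 xy.
have [l1 ol1 l1E] := hump_touch x0 x r0 (hump_height_le1 (y - y1) r).
have [l2 ol2 l2E] := hump_touch y1 y r0 (hump_height_le1 (x - x0) r).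
have shift z : v y - v (y + z) <= u x - u (x + z) + e.
  have := PhiS (x + z, y + z); rewrite /= /shift_penalty /= !htD.
  rewrite (_ : ht y + ht z - (ht x + ht z) = ht y - ht x); last by ring.
  by move: e0; goal_lra.
have bM : 0 <= B0 * (2 * m / dl) by rewrite mulr_ge0 ?(ltW B00)// divr_ge0 ?mulr_ge0// ltW.
have bM1 : B0 * (2 * m / dl) <= B0 * (2 / dl).
  by rewrite ler_wpM2l ?(ltW B00)// ler_wpM2r ?invr_ge0 ?(ltW dl0)// ler_piMr.
have ohz : oddlin (fun z : E => B0 * (2 * m / dl) * ht z) (B0 * (2 / dl)).
  apply: (@oddlin_le _ _ _ (B0 * (2 * m / dl) * 1)); first by rewrite mulr1.
  by apply: oddlinZ => //; exact: oddlin_coord.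
have eL (l : E -> R) : oddlin l (4 * N%:R / r) -> oddlin (fun z => e * l z) (4 * N%:R / r).
  move=> ol; apply: (@oddlin_le _ _ _ (e * (4 * N%:R / r))).
    by rewrite ler_piMl// divr_ge0 ?mulr_ge0// ltW.
  by apply: oddlinZ => //; exact: ltW.
have o1 : oddlin (fun z => - (B0 * (2 * m / dl) * ht z + e * l1 z)) L.
  by apply: oddlinN; apply: oddlinD => //; exact: eL.
have o2 : oddlin (fun z => - (B0 * (2 * m / dl) * ht z) + e * l2 z) L.
  by apply: oddlinD; [exact: oddlinN|exact: eL].
have qz z : B0 * ((dl ^+ 2)^-1 * sqn z) + e * (2 / r ^+ 2 * sqn z) <= Q * sqn z.
  have : e * (2 / r ^+ 2 * sqn z) <= 2 / r ^+ 2 * sqn z.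
    by rewrite ler_piMl// mulr_ge0 ?sqn_ge0// divr_ge0// sqr_ge0.
  by rewrite /Q; goal_lra.
have near1 z : enorm z < rho ->
    - (B0 * (2 * m / dl) * ht z + e * l1 z) - Q * sqn z <= u x - u (x + z).
  move=> _; have H1 := PhiJ (x + z, y); rewrite -/r !joint_hump_left /= -/B0 in H1.
  have H2 := ler_wpM2l (ltW e0) (l1E z).
  have H3 := ler_wpM2l (ltW B00) (tl z).1.
  by move: H1 H2 H3 (qz z); goal_lra.
have near2 z : enorm z < rho ->
    v y - v (y + z) <= - (B0 * (2 * m / dl) * ht z) + e * l2 z + Q * sqn z.
  move=> _; have H1 := PhiJ (x, y + z); rewrite -/r !joint_hump_right /= -/B0 in H1.
  have H2 := ler_wpM2l (ltW e0) (l2E z).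
  have H3 := ler_wpM2l (ltW B00) (tl z).2.
  by move: H1 H2 H3 (qz z); goal_lra.
have C1e : 0 <= C1 * e by rewrite mulr_ge0 ?(ltW C10) ?(ltW e0).
have farH z : rho <= enorm z -> - (C1 * e) - 0 * ((1 <= enorm z)%R)%:R +
    (g / 2) `^ (p - 1) * \1_(cube c w) z <=
    G (u x - u (x + z)) - G (v y - v (y + z)).
  move=> _; rewrite mul0r subr0 indicE.
  have [/set_mem zc|_] := boolP (z \in _).
    rewrite mulr1; have gap : v y - v (y + z) + g <= u x - u (x + z).
      by move: (gH z zc); goal_lra.
    have := spow_gap p2 g0 gap.
    by move: C1e; goal_lra.
  rewrite mulr0 addr0.
  have [ba|/ltW ab] := leP (v y - v (y + z)) (u x - u (x + z)).
    have := spow_mono p2 ba; move: C1e; goal_lra.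
  have ua : `|u x - u (x + z)| <= mu.
    rewrite ler_norml; apply/andP; move: (u01 x) (u01 (x + z)) => [i1 i2] [i3 i4].
    by move: i1 i2 i3 i4; goal_lra.
  have va : `|v y - v (y + z)| <= mu.
    rewrite ler_norml; apply/andP; move: (v01 y) (v01 (y + z)) => [i1 i2] [i3 i4].
    by move: i1 i2 i3 i4; goal_lra.
  have := lip mu _ _ ua va; rewrite ler_norml => /andP[+ _].
  have -> : `|u x - u (x + z) - (v y - v (y + z))| = (v y - v (y + z)) - (u x - u (x + z)).
    by rewrite distrC ger0_norm// subr_ge0.
  rewrite -/C1.
  have : C1 * ((v y - v (y + z)) - (u x - u (x + z))) <= C1 * e.
    by rewrite ler_wpM2l ?(ltW C10)//; move: (shift z); goal_lra.
  by goal_lra.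
have cubeH' z : cube c w z -> rho <= enorm z /\ enorm z <= T.
  by move=> /cubeH[h1 h2]; split=> //; exact: le_trans h1.
have := main _ _ _ _ _ _ _ _ _ _ _ _ _ _ _ _ _ _ bu bv (pvu _ xh) (pvv _ yh) rho0 ltr01
  (ltW L0) (ltW Q0) C1e (lexx 0) (powR_ge0 (g / 2) (p - 1)) w0 o1 o2 near1 near2 farH cubeH'.
move=> H; apply: le_trans H _; rewrite lerD2l mul0r addr0 mulrDl mulrDr.
have H1 : (L * rho + Q * rho ^+ 2) `^ (p - 2) * (Q * rho ^+ 2) * rho `^ (- al) <=
    (L + Q) `^ (p - 2) * Q * rho `^ (p - al).
  have -> : (L + Q) `^ (p - 2) * Q * rho `^ (p - al) =
     ((L + Q) * rho) `^ (p - 2) * (Q * rho ^+ 2) * rho `^ (- al).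
    rewrite (powRD (x := rho) (r := p) (s := - al)); last by apply/implyP => _; rewrite gt_eqF.
    have LQ : 0 <= L + Q by exact/ltW/addr_gt0.
    by rewrite -(powR_sub2 p2 (ltW rho0)) (powRM _ LQ (ltW rho0)); ring.
  apply: ler_wpM2r; first exact: powR_ge0.
  apply: ler_wpM2r; first by rewrite mulr_ge0 ?(ltW Q0) ?exprn_ge0 ?(ltW rho0).
  apply: ler_powRl => //.
    apply: addr_ge0; first by rewrite mulr_ge0 ?(ltW L0) ?(ltW rho0).
    by rewrite mulr_ge0 ?(ltW Q0) ?exprn_ge0 ?(ltW rho0).
  have h1 : rho ^+ 2 <= rho by rewrite expr2 ler_piMr// ltW.
  by have := ler_wpM2l (ltW Q0) h1; rewrite (mulrDl L); goal_lra.
have := ler_wpM2l (ltW k0) H1.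
by move: rhoE eE; goal_lra.
Qed.

End doubling_theorem.

(** * Consequences of the doubling inequality *)
Section sliding.
Context (R : realType) (n : nat) (p al : R).
Ltac goal_lra := clear - n p al; lra.
Local Notation N := n.+1.
Local Notation E := 'rV[R]_n.+1.
Local Notation G := (spow p).
Local Notation pde_sol := (@pde_sol R n p al).
Implicit Types (F : R -> R) (u v : E -> R) (x y z : E).

(** Convergence to [mu] from below at large height, uniformly in the
    horizontal directions. *)
Definition uniformly_large v (mu : R) := forall m, 0 < m -> m < mu ->
  exists2 r, 0 < r & forall x, r < ht x -> m <= v x.

Definition uniformly_positive v := forall t : R, 0 < t ->
  exists2 c, 0 < c & forall x, t <= ht x -> c <= v x.

Lemma sol_uniformly_large : 2 <= p -> 0 < al -> al < p -> forall F v (mu : R), pde_sol F v ->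
  (forall m, 0 < m -> m < mu -> exists2 c, 0 < c & forall t, 0 < t -> t <= m -> c * t <= F t) ->
  uniformly_large v mu.
Proof.
move=> p2 al0 alp F v mu solv Flow m m0 mmu.
have [c c0 Fc] := Flow m m0 mmu.
have [r r0 B] := bubble_below p2 al0 alp solv m0 c0 Fc.
exists r => // x rx; have := B x rx x.
by rewrite hump_center pos_sqrE// expr1n mulr1.
Qed.

(** A point below the radius [r] of the barrier is reached by a ball centred
    vertically above it. *)
Lemma sol_uniformly_positive : 2 <= p -> 0 < al -> al < p -> forall F v (mu : R), pde_sol F v -> 0 < mu ->
  (forall m, 0 < m -> m < mu -> exists2 c, 0 < c & forall t, 0 < t -> t <= m -> c * t <= F t) ->
  uniformly_positive v.
Proof.
move=> p2 al0 alp F v mu solv mu0 Flow t t0.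
pose m := mu / 2.
have m0 : 0 < m by rewrite divr_gt0.
have mmu : m < mu by rewrite /m; lra.
have [c c0 Fc] := Flow m m0 mmu.
have [r r0 B] := bubble_below p2 al0 alp solv m0 c0 Fc.
pose s := Num.min (t / 2) (r / 2).
have s0 : 0 < s by rewrite lt_min !divr_gt0.
have st : s <= t / 2 by rewrite ge_min lexx.
have sr : s <= r / 2 by rewrite ge_min lexx orbT.
pose th := 1 - ((r - s) / r) ^+ 2.
have rs1 : (r - s) / r < 1 by rewrite ltr_pdivrMr// mul1r gtrBl.
have rs0 : 0 <= (r - s) / r by rewrite divr_ge0 ?(ltW r0)//; move: sr r0; lra.
have th0 : 0 < th by rewrite /th subr_gt0 expr_lt1.
have th1 : th <= 1 by rewrite gerBl sqr_ge0.
exists (m * th ^+ 2); first by rewrite mulr_gt0// exprn_gt0.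
move=> x tx; have [rx|xr] := ltP r (ht x).
  apply: le_trans (B x rx x); rewrite hump_center pos_sqrE// expr1n ler_wpM2l ?(ltW m0)//.
  by rewrite exprn_ile1// ltW.
pose b := r + s - ht x.
have b0 : 0 <= b by rewrite /b; lra.
have brs : b <= r - s by rewrite /b; lra.
have hx0 : r < ht (x + vert n b) by rewrite htD ht_vert /b; lra.
apply: le_trans (B _ hx0 x); rewrite ler_wpM2l ?(ltW m0)//.
rewrite /hump opprD addNKr sqnN sqn_vert -expr_div_n.
have bth : th <= 1 - (b / r) ^+ 2.
  rewrite /th lerD2l lerN2; apply: lerXn2r; rewrite ?nnegrE//.
    by rewrite divr_ge0// ltW.
  by rewrite ler_wpM2r// invr_ge0 ltW.
rewrite pos_sqrE; last exact: le_trans (ltW th0) bth.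
by apply: lerXn2r => //; rewrite nnegrE ?(ltW th0)// (le_trans (ltW th0)).
Qed.

(** The conclusion of [doubling] at the pair [(x, y)]. *)
Definition doubling_estimate F u v (kap : R) x y := forall c (w g T : R), 0 < w -> 0 <= g ->
    (forall z, cube c w z -> kap <= enorm z /\ enorm z <= T) ->
    (forall z, cube c w z -> u (x + z) - v (y + z) + g <= u x - v y) ->
    (g / 2) `^ (p - 1) * ((2 * w) ^+ N * T `^ (- (N%:R + al))) <=
      F (u x) - F (v y) + kap.

Lemma ht_ge_enorm (z : E) (a : R) : ht z <= - a -> a <= enorm z.
Proof.
move=> h; apply: le_trans (ht_le_enorm z); rewrite -normrN.
by apply: le_trans (ler_norm _); rewrite lerNr.
Qed.

(** Since [v] approaches [mu], a difference of at least [h / 2] confines [y]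
    to a height depending on [h] only; then a cube below the boundary at a
    fixed distance gives a gain independent of [kap]. *)
Lemma doubling_nonincreasing v (mu h : R) : 0 < mu -> uniformly_large v mu -> (forall x, 0 <= v x) ->
  0 < h -> exists2 kap0, 0 < kap0 & forall F u kap x y, kap <= kap0 ->
  (forall x, ht x <= 0 -> u x = 0) -> u x <= mu ->
  0 < ht x -> ht x <= ht y -> h / 2 <= u x - v y -> doubling_estimate F u v kap x y ->
  F (u x) <= F (v y) -> False.
Proof.
move=> mu0 highv v0 h0.
have [r r0 vr] : exists2 r, 0 < r & forall x, r < ht x -> mu - h / 4 <= v x.
  have [m0|m0] := ltP 0 (mu - h / 4).
    by apply: highv => //; move: h0; lra.
  by exists 1 => // x _; exact: le_trans (v0 x).
pose T := N%:R * (r + 2) : R.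
have T0 : 0 < T by rewrite mulr_gt0// addr_gt0.
pose P := (h / 2 / 2) `^ (p - 1) * ((2 * 1) ^+ N * T `^ (- (N%:R + al))).
have P0 : 0 < P.
  apply: mulr_gt0; first by apply: powR_gt0; rewrite !divr_gt0.
  by apply: mulr_gt0; [rewrite exprn_gt0// mulr_gt0|exact: powR_gt0].
exists (Num.min r (P / 2)); first by rewrite lt_min r0 divr_gt0.
move=> F u kap x y; rewrite le_min => /andP[kr kP] u0 umu hx hxy hxyv D Fuv.
have yr : ht y <= r.
  rewrite leNgt; apply/negP => /vr h1.
  by move: h1 umu hxyv h0; lra.
have cz z : cube (vert n (- (r + 1))) 1 z -> ht z <= - r.
  by move=> /cube_vert[_]; lra.
have := D (vert n (- (r + 1))) 1 (h / 2) T ltr01 _ _ _.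
rewrite -/P divr_ge0 ?(ltW h0)// => /(_ isT).
have Pk : P <= F (u x) - F (v y) + kap -> False by move: P0 kP Fuv; lra.
move=> H; apply: Pk; apply: H => z zc.
  split; first by apply: le_trans kr _; exact/ht_ge_enorm/cz.
  apply: le_trans (cube_vert_enorm ler01 zc) _; rewrite /T ler_wpM2l//.
  by rewrite normrN ger0_norm; move: r0; lra.
rewrite (u0 (x + z)); last by rewrite htD; move: (cz z zc) hxy yr; lra.
by move: hxyv (v0 (y + z)); lra.
Qed.

(** The cube lies just below the boundary for [u] but inside the half-space
    for the translate of [v], where [v] is at least [c]. *)
Lemma doubling_strip v (L1 s0 : R) : uniformly_positive v -> 0 < L1 -> 0 < s0 ->
  exists gam kap1, [/\ 0 < gam, 0 < kap1 & forall F u kap x y, kap <= kap1 ->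
  (forall x, ht x <= 0 -> u x = 0) ->
  0 < ht x -> s0 <= ht y - ht x -> ht y <= L1 -> 0 <= u x - v y -> doubling_estimate F u v kap x y ->
  gam <= F (u x) - F (v y)].
Proof.
move=> lowv L10 s00.
have [c c0 vc] := lowv (s0 / 4) ltac:(by rewrite divr_gt0).
pose w := s0 / 4.
have w0 : 0 < w by rewrite divr_gt0.
pose T := N%:R * (L1 + s0) : R.
have T0 : 0 < T by rewrite mulr_gt0// addr_gt0.
pose P := (c / 2) `^ (p - 1) * ((2 * w) ^+ N * T `^ (- (N%:R + al))).
have P0 : 0 < P.
  apply: mulr_gt0; first by apply: powR_gt0; rewrite !divr_gt0.
  by apply: mulr_gt0; [rewrite exprn_gt0// mulr_gt0|exact: powR_gt0].
exists (P / 2), (Num.min w (P / 2)); split; [by rewrite divr_gt0|by rewrite lt_min w0 divr_gt0|].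
move=> F u kap x y; rewrite le_min => /andP[kw kP] u0 hx hxy yL uv D.
have cz z : cube (vert n (- (ht x + s0 / 2))) w z ->
    ht x + ht z <= - w /\ s0 / 4 <= ht y + ht z.
  by move=> /cube_vert[h1 h2]; split; move: h1 h2 hxy s00; rewrite /w; lra.
suff : P <= F (u x) - F (v y) + kap by move: kP; lra.
apply: (D (vert n (- (ht x + s0 / 2)))) => // [|z zc|z zc]; first exact: ltW.
  have [h1 h2] := cz z zc; split.
    by apply: le_trans kw _; apply: ht_ge_enorm; move: h1 hx; lra.
  apply: le_trans (cube_vert_enorm (ltW w0) zc) _; rewrite /T ler_wpM2l//.
  rewrite normrN ger0_norm; last by rewrite addr_ge0 ?(ltW hx)// divr_ge0// ltW.
  by move: hx hxy yL s00; rewrite /w; lra.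
have [h1 h2] := cz z zc.
rewrite (u0 (x + z)); last by rewrite htD; move: h1 w0; lra.
have : c <= v (y + z) by apply: vc; rewrite htD.
by move: uv; lra.
Qed.

(** The decrements telescope. *)
Lemma pigeonhole_decrease (w : nat -> R) (mu : R) (J M : nat) : (0 < M)%N ->
  w J - w (J + M)%N <= mu -> exists2 j, (J <= j < J + M)%N & w j - w j.+1 <= mu / M%:R.
Proof.
move=> M0 wmu; apply: contrapT => H.
have all_big j : (J <= j < J + M)%N -> mu / M%:R < w j - w j.+1.
  by move=> jJ; rewrite ltNge; apply/negP => h; apply: H; exists j.
have := ltr_sum_nat (_ : J < J + M)%N all_big.
rewrite -[X in (X < _)%N]addn0 ltn_add2l M0 => /(_ isT).
have Mn0 : M%:R != 0 :> R by rewrite pnatr_eq0 -lt0n.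
have -> : \sum_(J <= j < J + M) (w j - w j.+1) = w J - w (J + M)%N.
  rewrite (telescope_sumr_eq (fun j => - w j)) ?leq_addr// ?opprK 1?addrC// => j _.
  by rewrite opprK addrC.
by rewrite sumr_const_nat addKn -[X in X < _]mulr_natr divfK// ltNge wmu.
Qed.
End sliding.

(** * The sliding method *)
Section sliding_theorem.
Context (R : realType) (n : nat) (p al : R).
Ltac goal_lra := clear - n p al; lra.
Local Notation N := n.+1.
Local Notation E := 'rV[R]_n.+1.
Local Notation pde_sol := (@pde_sol R n p al).
Local Notation doubling_estimate := (@doubling_estimate R n p al).
Implicit Types (F : R -> R) (u v : E -> R) (x y z : E).

(** The largest function of the height that is below [v] and nondecreasing:
    comparing [u] with all higher points of [v] amounts to comparing it with
    this envelope. *)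
Definition lower_env v (t : R) : R := inf [set v y | y in [set y | t <= ht y]].

Section lower_env_theory.
Variables (v : E -> R) (mu : R).
Hypothesis v01 : forall x, 0 <= v x /\ v x <= mu.

Let hinf t : has_inf [set v y | y in [set y | t <= ht y]].
Proof.
split; first by exists (v (vert n t)), (vert n t) => //=; rewrite ht_vert.
by exists 0 => _ [y _ <-]; have [] := v01 y.
Qed.

Lemma lower_env_le t y : t <= ht y -> lower_env v t <= v y.
Proof. by move=> ty; apply: inf_lbound; [exact: (hinf t).2|exists y]. Qed.

Lemma lower_env_ge t a : (forall y, t <= ht y -> a <= v y) -> a <= lower_env v t.
Proof. by move=> H; apply: lb_le_inf; [exact: (hinf t).1|move=> _ [y ty <-]; exact: H]. Qed.

Lemma lower_env_mono t t' : t <= t' -> lower_env v t <= lower_env v t'.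
Proof. by move=> tt; apply: lower_env_ge => y ty; apply: lower_env_le; exact: le_trans ty. Qed.

Lemma lower_env_ge0 t : 0 <= lower_env v t.
Proof. by apply: lower_env_ge => y _; have [] := v01 y. Qed.

Lemma lower_env_le_mu t : lower_env v t <= mu.
Proof.
apply: le_trans (lower_env_le (_ : t <= ht (vert n t))) _; first by rewrite ht_vert.
by have [] := v01 (vert n t).
Qed.

End lower_env_theory.

(** For gaps above [tau0], [u] lies below the envelope of [v] shifted by the
    gap; so at a gap at least [tau0 - d] the translated difference is at most
    an increment of the envelope over a short interval of heights. Among [M]
    consecutive scales [4^-j], some increment is at most [om / 2]
    ([pigeonhole_decrease]). On the cube at that scale, the difference is
    smaller by [om / 2] than at the maximum, and the gain is of order [s^-al],
    which exceeds any bound if the scales are small enough. *)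
Lemma doubling_jump (mu om tau0 Fm : R) : 2 <= p -> 0 < al -> 0 < mu -> 0 < om -> 0 < tau0 -> 0 <= Fm ->
  exists d kap2, [/\ 0 < d, d <= tau0 / 2, 0 < kap2 & forall F u v kap x y, kap <= kap2 ->
  (forall x, 0 <= v x /\ v x <= mu) ->
  F (u x) - F (v y) <= Fm ->
  (forall tau a b, tau0 < tau -> tau <= ht b - ht a -> u a <= v b) ->
  tau0 - d <= ht y - ht x -> om <= u x - v y -> doubling_estimate F u v kap x y -> False].
Proof.
move=> p2 al0 mu0 om0 tau00 Fm0.
have [M M0 Mom] : exists2 M, (0 < M)%N & mu / M%:R <= om / 2.
  exists (Num.trunc (2 * mu / om)).+1 => //.
  have := truncnS_gt (2 * mu / om); set m := _.+1%:R => h.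
  have m0 : 0 < m by rewrite ltr0n.
  rewrite ler_pdivrMr//; rewrite ltr_pdivrMr// in h; lra.
pose Q0 := (om / 2 / 2) `^ (p - 1) * (2^-1 ^+ N * N%:R `^ (- (N%:R + al))).
have Q00 : 0 < Q0.
  apply: mulr_gt0; first by apply: powR_gt0; rewrite !divr_gt0.
  by apply: mulr_gt0; [rewrite exprn_gt0// invr_gt0|exact: powR_gt0].
have y0 : 0 < Q0 / (Fm + 2) by rewrite divr_gt0//; lra.
have [s1 s10 s1E] := powR_surj al0 y0.
pose s j : R := 4^-1 ^+ j.
have s0 j : 0 < s j by rewrite exprn_gt0// invr_gt0.
have sS j : s j.+1 = s j / 4 by rewrite /s exprSr.
have s_mono i j : (i <= j)%N -> s j <= s i.
  by move=> ij; apply: ler_wiXn2l => //; rewrite ?invr_ge0// invf_le1// ler1n.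
have [J Js1] : exists J, s J <= s1.
  have [J hJ] := ex_pow2_ge s1^-1; exists J.
  have : s J <= 2^-1 ^+ J.
    by apply: lerXn2r; rewrite ?nnegrE ?invr_ge0// lef_pV2 ?posrE//; lra.
  move=> h; apply: (le_trans h); rewrite exprVn.
  by rewrite -[leRHS]invrK lef_pV2 ?posrE ?exprn_gt0 ?invr_gt0.
pose sm := s (J + M)%N.
exists (Num.min (tau0 / 2) (sm / 8)), (Num.min 1 (sm / 2)).
set d := Num.min _ _; set kap2 := Num.min 1 _.
have sm0 : 0 < sm by exact: s0.
have d0 : 0 < d by rewrite lt_min !divr_gt0.
have dt : d <= tau0 / 2 by rewrite ge_min lexx.
have dsm : d <= sm / 8 by rewrite ge_min lexx orbT.
have k20 : 0 < kap2 by rewrite lt_min ltr01 divr_gt0.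
have k21 : kap2 <= 1 by rewrite ge_min lexx.
have k2s : kap2 <= sm / 2 by rewrite ge_min lexx orbT.
split=> // F u v kap x y kk v01 FF slide hxy uv D.
pose X := ht x + tau0 + d.
pose w j := lower_env v (X + s j).
have wmu : w J - w (J + M)%N <= mu.
  have := lower_env_le_mu v01 (X + s J); have := lower_env_ge0 v01 (X + s (J + M)%N).
  by rewrite /w; lra.
have [j /andP[Jj jJM] wj] := pigeonhole_decrease M0 wmu.
have sj := s0 j.
have smj : sm <= s j by apply: s_mono; exact: ltnW.
have sjs1 : s j <= s1 by apply: le_trans Js1; exact: s_mono.
have s40 : 0 < s j / 4 by rewrite divr_gt0.
have cz z : cube (vert n (3 / 4 * s j)) (s j / 4) z -> s j / 2 <= ht z /\ ht z <= s j.
  by move=> /cube_vert[h1 h2]; split; move: h1 h2; goal_lra.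
have om20 : 0 <= om / 2 by rewrite divr_ge0// ltW.
have QE : (om / 2 / 2) `^ (p - 1) * ((2 * (s j / 4)) ^+ N * (N%:R * s j) `^ (- (N%:R + al))) =
    Q0 * s j `^ (- al).
  have -> : 2 * (s j / 4) = 2^-1 * s j by field.
  by rewrite cube_scale// /Q0; ring.
have Q0s : Fm + 2 <= Q0 * s j `^ (- al).
  have := powRN_le al0 sj sjs1; rewrite (powRN s1) s1E invf_div.
  by rewrite ler_pdivrMr// mulrC.
suff : Q0 * s j `^ (- al) <= F (u x) - F (v y) + kap.
  by move: FF kk k21 Q0s; goal_lra.
rewrite -QE; apply: (D (vert n (3 / 4 * s j))) => // z zc; have [h1 h2] := cz z zc.
  split.
    apply: le_trans (le_trans (ler_norm _) (ht_le_enorm z)).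
    by move: kk k2s smj h1; goal_lra.
  apply: le_trans (cube_vert_enorm (ltW s40) zc) _.
  rewrite ler_wpM2l// ger0_norm; first by goal_lra.
  by rewrite mulr_ge0// ltW.
have Hu : u (x + z) <= w j.
  apply: (@le_trans _ _ (lower_env v (ht (x + z) + (tau0 + d)))).
    apply: (lower_env_ge v01) => b hb; apply: (slide (tau0 + d)).
      by rewrite ltrDl.
    by move: hb; goal_lra.
  by apply: (lower_env_mono v01); rewrite htD /X; move: h2; goal_lra.
have Hv : w j.+1 <= v (y + z).
  by apply: (lower_env_le v01); rewrite htD /X sS; move: hxy h1 dsm smj; goal_lra.
by move: Hu Hv wj Mom uv; goal_lra.
Qed.

(** By compactness of the set of pairs with a given gap, on which the distance
    is positive. *)
Lemma continuous_gap F (mu gam : R) : continuous F -> 0 < gam ->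
  exists2 om, 0 < om & forall a b, 0 <= a -> a <= mu -> 0 <= b -> b <= mu ->
    gam <= F a - F b -> om <= `|a - b|.
Proof.
move=> cF gam0.
pose I := `[0, mu]%classic : set R.
pose K : set (R * R) := (I `*` I) `&` [set q | gam <= F q.1 - F q.2].
have c1 (q : R * R) : {for q, continuous (fun q : R * R => q.1)} by exact: cvg_fst.
have c2 (q : R * R) : {for q, continuous (fun q : R * R => q.2)} by exact: cvg_snd.
have cK : compact K.
  apply: compact_closedI.
    by apply: compact_setX; exact: segment_compact.
  apply: (@closed_comp _ _ (fun q : R * R => F q.1 - F q.2) [set t : R | gam <= t]).
    move=> q _; apply: continuousB.
      by apply: (@continuous_comp _ _ _ (fun q : R * R => q.1) F); [exact: c1|exact: cF].
    by apply: (@continuous_comp _ _ _ (fun q : R * R => q.2) F); [exact: c2|exact: cF].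
  exact: closed_ge.
have [K0|K0] := pselect (K !=set0); last first.
  exists 1 => // a b a0 am b0 bm ab; exfalso; apply: K0; exists (a, b).
  by split=> //; split; rewrite /I/= in_itv/= ?a0 ?b0.
have [[a b] [_ /= ab] qmax] : exists2 q, K q & forall q', K q' ->
    - `|q'.1 - q'.2| <= - `|q.1 - q.2|.
  apply: (compact_max cK K0) => q _; apply: continuousN.
  apply: (@continuous_comp _ _ _ (fun q : R * R => q.1 - q.2) (@Num.norm _ R)).
      by apply: continuousB; [exact: c1|exact: c2].
  exact: norm_continuous.
exists `|a - b|.
  rewrite normr_gt0; apply/negP => /eqP/subr0_eq e.
  by move: ab; rewrite e subrr leNgt gam0.
move=> a' b' a0 am b0 bm ab'; have := qmax (a', b'); rewrite lerN2; apply.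
by split=> //; split; rewrite /I/= in_itv/= ?a0 ?b0.
Qed.

(** Suppose the infimum [tau0] of the admissible gaps is positive.
    [doubling_strip] and [continuous_gap] give a size [om] of the difference
    at the maximum that does not depend on the chosen gap; [doubling_jump]
    then fixes [d], and a maximum for a gap between [tau0 - d] and [tau0] is
    impossible. *)
Lemma sliding : 2 <= p -> 0 < al -> al < p ->
  forall F (mu t1 : R), 0 < mu -> t1 < mu -> 0 < t1 -> continuous F ->
  (forall a b, t1 < b -> b <= a -> a <= mu -> F a <= F b) ->
  (forall t, mu <= t -> F t <= 0) ->
  (forall m, 0 < m -> m < mu -> exists2 c, 0 < c & forall t, 0 < t -> t <= m -> c * t <= F t) ->
  forall u v, pde_sol F u -> pde_sol F v ->
  forall x y, ht x < ht y -> u x <= v y.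
Proof.
move=> p2 al0 alp F mu t1 mu0 t1mu t10 cF Fmono Fneg Flow u v solu solv.
have umu x : u x <= mu by exact: (sol_le_saturation p2 al0 alp mu0 Fneg solu).
have vmu x : v x <= mu by exact: (sol_le_saturation p2 al0 alp mu0 Fneg solv).
have u_ge0 x : 0 <= u x by exact: pde_sol_ge0 solu.
have v_ge0 x : 0 <= v x by exact: pde_sol_ge0 solv.
have v01 x : 0 <= v x /\ v x <= mu by [].
have [_ _ upos u0 _] := solu.
have [cmax cmaxI Fmax] := EVT_max (ltW mu0) (continuous_subspaceT cF).
have [cmin cminI Fmin] := EVT_min (ltW mu0) (continuous_subspaceT cF).
have Fle t : 0 <= t -> t <= mu -> F t <= F cmax.
  by move=> h0 h1; apply: Fmax; rewrite in_itv/= h0.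
have Fge t : 0 <= t -> t <= mu -> F cmin <= F t.
  by move=> h0 h1; apply: Fmin; rewrite in_itv/= h0.
pose Fm := F cmax - F cmin.
have Fm0 : 0 <= Fm by rewrite subr_ge0 (le_trans (Fge mu _ _) (Fle mu _ _))// ltW.
have FF x y : F (u x) - F (v y) <= Fm by apply: lerB; [exact: Fle|exact: Fge].
have decay := boundary_decay p2 al0 alp solu umu Fle.
have highv := sol_uniformly_large p2 al0 alp solv Flow.
have lowv := sol_uniformly_positive p2 al0 alp solv mu0 Flow.
have [L1 L10 vL1] : exists2 L1, 0 < L1 & forall y, L1 < ht y -> t1 < v y.
  have [r r0 vr] := highv ((t1 + mu) / 2) ltac:(lra) ltac:(lra).
  by exists r => // y /vr; lra.
pose P tau := forall x y, tau <= ht y - ht x -> u x <= v y.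
have Pmono tau tau' : tau <= tau' -> P tau -> P tau'.
  by move=> tt Pt x y h; apply: Pt; exact: le_trans h.
have notP tau : ~ P tau -> exists h x1 y1, [/\ 0 < h, tau <= ht y1 - ht x1 & h <= u x1 - v y1].
  move=> /existsNP[x1 /existsNP[y1 /not_implyP[xy /negP]]]; rewrite -ltNge => uv.
  by exists (u x1 - v y1), x1, y1; split=> //; rewrite subr_gt0.
(* Far up, [v] exceeds [t1], so only the first case of the alternative occurs.
   *)
have PL : P (L1 + 1).
  apply: contrapT => /notP[h [x1 [y1 [h0 xy1 uv1]]]].
  have [k0 k00 caseA] := doubling_nonincreasing p al mu0 highv v_ge0 h0.
  have L11 : L1 < L1 + 1 by lra.
  have ex : exists x1 y1, L1 + 1 <= ht y1 - ht x1 /\ h <= u x1 - v y1 by exists x1, y1.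
  have [x [y [hx hxy uv D]]] := doubling p2 al0 alp solu solv mu0 umu vmu decay (ltW L10) L11 h0 k00 ex.
  have hyL : L1 < ht y by move: hx hxy; goal_lra.
  have hle : ht x <= ht y by move: hxy L10; goal_lra.
  have vu : v y <= u x by move: uv h0; goal_lra.
  apply: (caseA F u k0 x y (lexx _) u0 (umu x) hx hle uv D).
  by apply: Fmono => //; exact: vL1.
suff H tau : 0 < tau -> P tau.
  by move=> x y xy; apply: (H (ht y - ht x)) => //; rewrite subr_gt0.
pose A := [set tau | 0 < tau /\ P tau].
have hA : has_inf A.
  by split; [exists (L1 + 1); split=> //; lra|exists 0 => t [/ltW]].
pose tau0 := inf A.
have above t : tau0 < t -> P t.
  move=> h; have e0 : 0 < t - tau0 by rewrite subr_gt0.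
  have [t' [_ Pt'] t't] := inf_adherent e0 hA.
  by apply: Pmono Pt'; move: t't; rewrite -/tau0; lra.
suff tau00 : tau0 <= 0 by move=> t0; apply: above; exact: le_lt_trans t0.
rewrite leNgt; apply/negP => tau00.
have s00 : 0 < tau0 / 2 by rewrite divr_gt0.
have [gam [k1 [gam0 k10 caseB]]] := doubling_strip p al lowv L10 s00.
have [om om0 gap] := continuous_gap mu cF gam0.
have [d [k2 [d0 dt k20 caseC]]] := doubling_jump p2 al0 mu0 om0 tau00 Fm0.
have nP : ~ P (tau0 - d / 2).
  move=> Pd; have : tau0 <= tau0 - d / 2.
    by apply: inf_lbound; [exact: hA.2|split=> //; move: dt tau00; goal_lra].
  by move: d0; goal_lra.
have [h [x1 [y1 [h0 xy1 uv1]]]] := notP _ nP.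
have [k0 k00 caseA] := doubling_nonincreasing p al mu0 highv v_ge0 h0.
pose kap := Num.min k0 (Num.min k1 k2).
have kap0 : 0 < kap by rewrite !lt_min k00 k10.
have kk0 : kap <= k0 by rewrite ge_min lexx.
have kk1 : kap <= k1 by rewrite !ge_min lexx orbT.
have kk2 : kap <= k2 by rewrite !ge_min lexx !orbT.
have ex : exists x1 y1, tau0 - d / 2 <= ht y1 - ht x1 /\ h <= u x1 - v y1 by exists x1, y1.
have sg0 : 0 <= tau0 - d by move: dt tau00; goal_lra.
have sgt : tau0 - d < tau0 - d / 2 by move: d0; goal_lra.
have [x [y [hx hxy uv D]]] := doubling p2 al0 alp solu solv mu0 umu vmu decay sg0 sgt h0 kap0 ex.
have uvpos : 0 <= u x - v y by move: uv h0; goal_lra.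
have vu : v y <= u x by rewrite -subr_ge0.
have hle : ht x <= ht y by move: hxy sg0; goal_lra.
have [vt1|vt1] := ltP t1 (v y).
  by apply: (caseA F u kap x y kk0 u0 (umu x) hx hle uv D); exact: Fmono.
have yL1 : ht y <= L1.
  by rewrite leNgt; apply/negP => /vL1; rewrite ltNge vt1.
have hhalf : tau0 / 2 <= ht y - ht x by move: hxy dt; goal_lra.
have Fgam := caseB F u kap x y kk1 u0 hx hhalf yL1 uvpos D.
have := gap _ _ (u_ge0 x) (umu x) (v_ge0 y) (vmu y) Fgam.
rewrite ger0_norm// => omuv.
exact: (caseC F u v kap x y kk2 v01 (FF x y) (fun tau a b tt => above tau tt a b) hxy omuv D).
Qed.

End sliding_theorem.

(** * Symmetry, monotonicity and uniqueness *)
Section consequences.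
Context (R : realType) (n : nat) (p al : R).
Local Notation N := n.+1.
Local Notation E := 'rV[R]_n.+1.
Local Notation G := (spow p).
Local Notation pde_sol := (@pde_sol R n p al).
Implicit Types (F : R -> R) (u v : E -> R) (x y z : E).

Lemma lt_height_closure u v :
  (forall x, 0 < ht x -> {for x, continuous v}) -> (forall x, 0 <= v x) ->
  (forall x, ht x <= 0 -> u x = 0) -> (forall x y, ht x < ht y -> u x <= v y) ->
  forall x y, ht x <= ht y -> u x <= v y.
Proof.
move=> cv v_ge0 u0 lt_uv x y xy.
have [x0|x0] := leP (ht x) 0; first by rewrite u0.
rewrite leNgt; apply/negP => vu.
have cvy : {for y, continuous v} by apply: cv; exact: lt_le_trans xy.
have : \forall z \near y, v z < u x by exact: (cvgr_lt _ cvy).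
move=> /nbhs_ballP[r /= r0 /(_ (y + vert n (r / 2)))].
suff yr : ball y r (y + vert n (r / 2)).
  move=> /(_ yr); rewrite /= ltNge => /negP; apply.
  apply: lt_uv; rewrite htD ht_vert; apply: (le_lt_trans xy).
  by rewrite ltrDl divr_gt0.
split=> // i j; rewrite (ord1 i) /ball/= !mxE opprD addNKr normrN.
by case: ifP => _; rewrite ?normr0// ger0_norm; lra.
Qed.

(** If [u x = u y] with [y] higher, the increments of [u] at [x] dominate
    those at [y] for all [z], and strictly on a cube that is below the
    boundary seen from [x] and above it seen from [y]; but the two principal
    values agree. *)
Lemma strictly_increasing_in_height F u : 2 <= p -> 0 < al -> al < p ->
  pde_sol F u -> uniformly_positive u -> (forall x y, ht x < ht y -> u x <= u y) ->
  forall x y, 0 < ht x -> ht x < ht y -> u x < u y.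
Proof.
move=> p2 al0 alp solu lowu mono x y hx hxy.
have [bu cu upos u0 pvu] := solu.
rewrite lt_neqAle mono// andbT; apply/eqP => uxy.
have [k k0 main] := @pv_comparison R N p al p2 al0 alp.
pose w := (ht y - ht x) / 4.
have w0 : 0 < w by rewrite divr_gt0// subr_gt0.
have [c c0 uc] := lowu w w0.
pose T := N%:R * (`|- (ht x + 2 * w)| + w).
have T0 : 0 < T by rewrite mulr_gt0// ltr_wpDl.
have cz z : cube (vert n (- (ht x + 2 * w))) w z -> ht x + ht z <= - w /\ w <= ht y + ht z.
  by move=> /cube_vert[h1 h2]; split; rewrite /w in h1 h2 *; lra.
have cubeH z : cube (vert n (- (ht x + 2 * w))) w z -> w <= enorm z /\ enorm z <= T.
  move=> zc; have [h1 h2] := cz z zc; split; last exact: cube_vert_enorm (ltW w0) zc.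
  by apply: ht_ge_enorm; lra.
have dom z : u y - u (y + z) <= u x - u (x + z).
  by rewrite uxy lerB// mono// !htD ltrD2r.
have o0 : measurable_fun setT (fun _ : E => 0 : R) by [].
have near0 z : enorm z < w -> 0 - 0 * enorm z `^ p <= G (u x - u (x + z)) - G (u y - u (y + z)).
  by move=> _; rewrite mul0r subrr subr_ge0; exact: spow_mono.
have farH z : w <= enorm z -> - 0 - 0 * ((1 <= enorm z)%R)%:R +
    (c / 2) `^ (p - 1) * \1_(cube (vert n (- (ht x + 2 * w))) w) z <=
    G (u x - u (x + z)) - G (u y - u (y + z)).
  move=> _; rewrite oppr0 mul0r subr0 add0r indicE.
  have [/set_mem/cz[h1 h2]|_] := boolP (z \in _); last first.
    by rewrite mulr0 subr_ge0; exact: spow_mono.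
  rewrite mulr1; apply: spow_gap; rewrite ?(ltW c0)//.
  rewrite (u0 (x + z)); last by rewrite htD; lra.
  have : c <= u (y + z) by apply: uc; rewrite htD.
  by rewrite uxy; lra.
have hy : 0 < ht y by exact: lt_trans hxy.
have := main _ _ _ _ _ _ _ _ _ _ _ _ _ _ _ _ bu bu (pvu x hx) (pvu y hy) w0 ltr01 (lexx 0)
  (lexx 0) (lexx 0) (powR_ge0 (c / 2) (p - 1)) w0 o0 (fun z => esym (oppr0 R)) _ near0 farH cubeH.
rewrite uxy subrr !mul0r !addr0 mulr0 addr0 => H.
have : 0 < (c / 2) `^ (p - 1) * ((2 * w) ^+ N * T `^ (- (N%:R + al))).
  apply: mulr_gt0; first by apply: powR_gt0; rewrite divr_gt0.
  by apply: mulr_gt0; [rewrite exprn_gt0// mulr_gt0|exact: powR_gt0].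
rewrite ltNge H//; exists 0 => z _; rewrite normr0//.
Qed.

End consequences.

Lemma pde_sol_of_bounded_solution (R : realType) (n : nat) (C s p : R) (f : R -> R)
    (u : 'rV[R]_n.+1 -> R) : 0 < C -> 0 < s -> 2 <= p ->
  bounded_solution C s p f u -> pde_sol p (s * p) (fun t => f t / C) u.
Proof.
move=> C0 s0 p2 [c11 _ [M [_ uM]] [eqn upos u0]].
have sp0 : 0 < s * p by rewrite mulr_gt0//; lra.
have cu x : 0 < ht x -> {for x, continuous u}.
  by move=> /c11[+ _]; exact: differentiable_continuous.
have open_half : open (@halfspace R n).
  apply: (@open_comp _ _ (@ht R n) [set t : R | 0 < t]); last exact: open_gt.
  by move=> x _; exact: continuous_ht.
have bu : bdd_meas u.
  split.
    apply: (measurable_fun_continuous_on open_half) => [x|x]; first exact: cu.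
    exact: u0.
  exists (M + 1) => x; apply: uM => //; rewrite ltrDl; exact: ltr01.
split=> // [x|x hx].
  by move=> hx; apply: u0 => /=; rewrite /halfspace/=; apply/negP; rewrite -leNgt.
have [cv eqnx] := eqn x hx.
exact: pv_of_fplap.
Qed.

Theorem theorem5 (R : realType) (n : nat) (C s p : R)
    (hC : 0 < C) (hs0 : 0 < s) (hs1 : s < 1) (hp : 2 <= p)
    (f : R -> R) (hf : continuous f)
    (mu t0 t1 : R) (hmu : 0 < mu) (ht0 : 0 < t0) (ht01 : t0 < t1)
    (ht1 : t1 < mu)
    (ha_pos : forall t, 0 < t -> t < mu -> 0 < f t)
    (ha_npos : forall t, mu <= t -> f t <= 0)
    (hb : exists2 delta0, 0 < delta0 &
            forall t, 0 <= t -> t <= t0 -> delta0 * t <= f t)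
    (hc : forall a b, t1 < a -> a <= b -> b < mu -> f b <= f a) :
  (forall u : 'rV[R]_n.+1 -> R, bounded_solution C s p f u ->
    (forall x y : 'rV[R]_n.+1, halfspace x -> halfspace y ->
       (forall i, i != ord_max -> x ord0 i = y ord0 i) ->
       x ord0 ord_max < y ord0 ord_max -> u x < u y) /\
    (exists g : R -> R, forall x, u x = g (x ord0 ord_max))) /\
  (forall u v : 'rV[R]_n.+1 -> R, bounded_solution C s p f u ->
     bounded_solution C s p f v -> u = v).
Proof.
pose F t := f t / C.
have C0 : 0 < C^-1 by rewrite invr_gt0.
have al0 : 0 < s * p by rewrite mulr_gt0//; lra.
have alp : s * p < p by rewrite gtr_pMl//; lra.
have cF : continuous F.
  by move=> t; exact: (cvgM (hf t) (cvg_cst C^-1)).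
have Fneg t : mu <= t -> F t <= 0.
  by move=> /ha_npos h; rewrite /F mulr_le0_ge0// ltW.
have Fmono a b : t1 < b -> b <= a -> a <= mu -> F a <= F b.
  move=> t1b ba amu; rewrite /F ler_wpM2r ?(ltW C0)//.
  move: amu; rewrite le_eqVlt => /predU1P[amu|]; last exact: hc.
  move: ba; rewrite le_eqVlt => /predU1P[->//|ba].
  apply: (@le_trans _ _ 0); first by rewrite amu ha_npos.
  by apply/ltW/ha_pos; [lra|rewrite -amu].
(* Below [t0] this is the linear lower bound on [f]; between [t0] and [m] it
   is compactness. *)
have Flow m : 0 < m -> m < mu ->
    exists2 c, 0 < c & forall t, 0 < t -> t <= m -> c * t <= F t.
  move=> m0 mmu; have [de de0 fde] := hb.
  have [c c0 fc] : exists2 c, 0 < c & forall t, t0 <= t -> t <= m -> c * t <= f t.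
    have [t0m|mt0] := leP t0 m; last first.
      by exists 1 => // t h1 h2; have := le_trans h1 h2; rewrite leNgt mt0.
    have [tm + fmin] := EVT_min t0m (continuous_subspaceT hf).
    rewrite in_itv/= => /andP[tm1 tm2].
    have ftm : 0 < f tm by apply: ha_pos; [exact: lt_le_trans tm1|exact: le_lt_trans mmu].
    exists (f tm / m); first exact: divr_gt0.
    move=> t h1 h2; apply: (@le_trans _ _ (f tm)); last by apply: fmin; rewrite in_itv/= h1.
    by rewrite -mulrA ler_piMr ?(ltW ftm)// mulrC ler_pdivrMr// mul1r.
  exists (Num.min de c / C); first by rewrite divr_gt0// lt_min de0.
  move=> t tpos tm; rewrite /F mulrAC ler_wpM2r ?(ltW C0)//.
  have [tt0|t0t] := leP t t0.
    by apply: le_trans (fde t (ltW tpos) tt0); rewrite ler_wpM2r ?(ltW tpos)// ge_min lexx.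
  apply: le_trans (fc t (ltW t0t) tm); rewrite ler_wpM2r ?(ltW tpos)// ge_min lexx orbT//.
have sol (u : 'rV[R]_n.+1 -> R) : bounded_solution C s p f u -> pde_sol p (s * p) F u.
  exact: pde_sol_of_bounded_solution.
have t10 : 0 < t1 by exact: lt_trans ht01.
have slide (u v : 'rV[R]_n.+1 -> R) : bounded_solution C s p f u -> bounded_solution C s p f v ->
    forall x y, ht x < ht y -> u x <= v y.
  move=> /sol su /sol sv.
  exact: (sliding hp al0 alp hmu ht1 t10 cF Fmono Fneg Flow su sv).
have slide_le (u v : 'rV[R]_n.+1 -> R) : bounded_solution C s p f u -> bounded_solution C s p f v ->
    forall x y, ht x <= ht y -> u x <= v y.
  move=> bu bv; have [_ _ _ u0 _] := sol u bu; have [_ cv _ _ _] := sol v bv.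
  apply: lt_height_closure => //; last exact: slide.
  by move=> x; exact: pde_sol_ge0 (sol v bv).
split=> [u bu|u v bu bv]; last first.
  apply/funext => x; apply/le_anti/andP; split.
    exact: (slide_le u v bu bv).
  exact: (slide_le v u bv bu).
split.
  move=> x y hx hy _ hxy.
  apply: (strictly_increasing_in_height hp al0 alp (sol u bu)) => //.
    exact: (sol_uniformly_positive hp al0 alp (sol u bu) hmu Flow).
  exact: slide.
exists (fun t => u (vert n t)) => x; apply/le_anti/andP.
by split; apply: (slide_le u u bu bu); rewrite ht_vert.
Qed.
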